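(* The system $\mathrm{RCA}_0^\omega+\mathrm{ARZ}_{\mathrm{net}}$ proves $\mathrm{HBU}$. Here $\mathrm{ARZ}_{\mathrm{net}}$ (Arzel\`a's theorem for nets) is the statement: for $D$ a directed subset of Baire space and continuous functions $f_d:(D\times[0,1])\to\mathbb{R}$ forming a net convergent to a continuous $f:[0,1]\to\mathbb{R}$, the convergence is quasi-uniform. And $\mathrm{HBU}$ is the statement that for every $\Psi:\mathbb{R}\to\mathbb{R}^+$ there are finitely many $y_1,\dots,y_k\in[0,1]$ such that $(\forall x\in[0,1])(\exists i\le k)\big(x\in(y_i-\Psi(y_i),y_i+\Psi(y_i))\big)$.
   Context: Base theory. Finite types: $0$ (natural numbers) is a type, and if $\sigma,\tau$ are types then so is $\sigma\to\tau$ (mappings from type $\sigma$ to type $\tau$ objects); $1:=0\to0$ and $n+1:=n\to0$; a superscript on a variable is its type. $L_\omega$ is the language with variables and quantifiers of all finite types, constants $0,1,<_0,+_0,\times_0,=_0$ on $\mathbb{N}$, the combinators $\Pi,\Sigma$ and a recursor constant $\mathbf{R}_0$. Equality at higher types is defined extensionally: $x=_\tau y$ iff $xz_1\dots z_k=_0yz_1\dots z_k$ for all arguments. $\mathrm{QF\text{-}AC}^{\sigma,\tau}$ is the schema $(\forall x^\sigma)(\exists y^\tau)A(x,y)\to(\exists Y^{\sigma\to\tau})(\forall x^\sigma)A(x,Y(x))$ for quantifier-free $A$ of $L_\omega$ (parameters of any type allowed). $\mathrm{RCA}_0^\omega$ is the theory in $L_\omega$ with classical logic and the axioms: $\mathbb{N}$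 is an ordered semi-ring; the defining axioms of $\Pi,\Sigma$ (giving $\lambda$-abstraction); $\mathbf{R}_0(f,m,0)=m$ and $\mathbf{R}_0(f,m,n+1)=f(n,\mathbf{R}_0(f,m,n))$; extensionality $x=_\rho y\to\varphi(x)=_\tau\varphi(y)$ for all types $\rho,\tau$ and $\varphi^{\rho\to\tau}$; induction for quantifier-free formulas of $L_\omega$; $\mathrm{QF\text{-}AC}^{1,0}$. Reals. A real is a sequence of rationals $(q_n)$ with $|q_n-q_{n+i}|<2^{-n}$ for all $n,i$ (a type 1 object); $(q_n)=_{\mathbb{R}}(r_n)$ iff $|q_n-r_n|\le2^{-n+1}$ for all $n$. A function $\mathbb{R}\to\mathbb{R}$ is a type $1\to1$ functional mapping equal reals to equal reals (similarly for functions on $[0,1]$); continuity is the usual epsilon-delta notion. Sets. A subset $D$ of Baire space $\mathbb{N}^{\mathbb{N}}$ is given by a characteristic function $F_D^2\le1$ ($f\in D$ means $F_D(f)=1$); a binary relation $\preceq$ on $D$ is likewise given by a characteristic function of type $(1\times1)\to0$. Via coding (and extensionality with respect to $=_{\mathbb{R}}$), subsets of $\mathbb{R}$ and sets of finite sequences of reals, and relations on them, are included. Nets. $(D,\preceq)$ with $D\neq\emptyset$ is directed if $\preceq$ is transitive and reflexive on $D$ and for all $x,y\in D$ there is $z\in D$ with $x\preceq z$ and $y\preceq z$. A net of functions is a map $f_d:(D\times[0,1])\to\mathbb{R}$ with $(D,\preceq)$ directed; all index sets are subsets of Baire space given by characteristic functions $F_D^2\le1$, with $\preceq$ given by a characteristic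 function of type $(1\times1)\to0$ (including, via coding, subsets of $\mathbb{R}$ and sets of finite sequences of reals); continuity concerns the variable $x\in[0,1]$ of $f_d(x)$ for fixed $d$. It converges to $f$ if for every $x\in[0,1]$ and $\varepsilon>0$ there is $d_0\in D$ with $|f_e(x)-f(x)|<\varepsilon$ for all $e\succeq d_0$. It converges quasi-uniformly to $f$ if $f$ is the limit of the net $f_d$ and $(\forall\varepsilon>0,d\in D)(\exists d_0,\dots,d_k\succeq d)(\forall x\in[0,1])(\exists j\le k)(|f_{d_j}(x)-f(x)|<\varepsilon)$. *)

(* Defs.v *)
(* A deep embedding of the finite-type language L_omega, of
   classical natural deduction over it, and of the theory RCA_0^omega; HBU and
   ARZ_net are closed formulas of L_omega. *)
From Stdlib Require Import List.
Import ListNotations.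
Set Implicit Arguments.
Unset Strict Implicit.
Unset Printing Implicit Defensive.

(** * Types, terms, formulas *)

Inductive ty : Type :=
| TN : ty
| Arr : ty -> ty -> ty.

Declare Scope ty_scope.
Delimit Scope ty_scope with ty.
Bind Scope ty_scope with ty.
Notation "s ~> t" := (Arr s t) (at level 55, right associativity) : ty_scope.
(* The types 1 and 2. *)
Notation T1 := (Arr TN TN) (only parsing).
Notation T2 := (Arr (Arr TN TN) TN) (only parsing).

Definition ctx : Type := list ty.

(* Typed de Bruijn variables: terms and formulas are well typed by
   construction, and live in a context listing the types of their free
   variables. *)
Inductive var : ctx -> ty -> Type :=
| vz (G : ctx) (s : ty) : var (s :: G) s
| vs (G : ctx) (s t : ty) : var G s -> var (t :: G) s.
Arguments vz {G s}.
Arguments vs {G s t} _.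

(* Multi-argument functionals are curried.  [Rec f m n] is R_0(f,m,n). *)
Inductive tm (G : ctx) : ty -> Type :=
| Var (s : ty) : var G s -> tm G s
| App (s t : ty) : tm G (s ~> t) -> tm G s -> tm G t
| Zero : tm G TN
| One : tm G TN
| Plus : tm G (TN ~> TN ~> TN)
| Times : tm G (TN ~> TN ~> TN)
| Pi (s t : ty) : tm G (s ~> t ~> s)
| Sigma (r s t : ty) : tm G ((r ~> s ~> t) ~> (r ~> s) ~> r ~> t)
| Rec : tm G ((TN ~> TN ~> TN) ~> TN ~> TN ~> TN).
Arguments Var {G s} _.
Arguments Zero {G}.
Arguments One {G}.
Arguments Plus {G}.
Arguments Times {G}.
Arguments Pi {G s t}.
Arguments Sigma {G r s t}.
Arguments Rec {G}.

(* The atomic formulas are those of type 0; =_0 and <_0 are relation symbols. *)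
Inductive fm (G : ctx) : Type :=
| Eq : tm G TN -> tm G TN -> fm G
| Lt : tm G TN -> tm G TN -> fm G
| Bot : fm G
| And : fm G -> fm G -> fm G
| Or : fm G -> fm G -> fm G
| Imp : fm G -> fm G -> fm G
| All (s : ty) : fm (s :: G) -> fm G
| Ex (s : ty) : fm (s :: G) -> fm G.
Arguments Bot {G}.

Definition sentence : Type := fm [].

Fixpoint qf (G : ctx) (p : fm G) : bool :=
  match p with
  | Eq _ _ | Lt _ _ | Bot => true
  | And a b | Or a b | Imp a b => andb (qf a) (qf b)
  | All _ | Ex _ => false
  end.

(** * Renaming and substitution *)

Definition upr (G D : ctx) (s : ty) (r : forall t, var G t -> var D t)
  (t : ty) (v : var (s :: G) t) : var (s :: D) t :=
  match v in var G' t' return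
    match G' with
    | [] => unit
    | s' :: G0 => (forall t, var G0 t -> var D t) -> var (s' :: D) t'
    end
  with
  | vz => fun _ => vz
  | vs w => fun r => vs (r _ w)
  end r.

Fixpoint ren (G D : ctx) (r : forall t, var G t -> var D t) (t : ty)
  (a : tm G t) : tm D t :=
  match a with
  | Var v => Var (r _ v)
  | App a b => App (ren r a) (ren r b)
  | Zero => Zero
  | One => One
  | Plus => Plus
  | Times => Times
  | Pi => Pi
  | Sigma => Sigma
  | Rec => Rec
  end.

Fixpoint renf (G D : ctx) (r : forall t, var G t -> var D t) (p : fm G) : fm D :=
  match p with
  | Eq a b => Eq (ren r a) (ren r b)
  | Lt a b => Lt (ren r a) (ren r b)
  | Bot => Bot
  | And a b => And (renf r a) (renf r b)
  | Or a b => Or (renf r a) (renf r b)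
  | Imp a b => Imp (renf r a) (renf r b)
  | All q => All (renf (upr r) q)
  | Ex q => Ex (renf (upr r) q)
  end.

Definition wkf (G : ctx) (s : ty) (p : fm G) : fm (s :: G) :=
  renf (fun _ v => vs v) p.

Definition no_var (D : ctx) (t : ty) (v : var [] t) : var D t :=
  match v in var G' t' return match G' with [] => var D t' | _ => unit end with
  | vz => tt
  | vs _ => tt
  end.

Definition scons (G D : ctx) (s : ty) (a : tm D s) (r : forall t, var G t -> tm D t)
  (t : ty) (v : var (s :: G) t) : tm D t :=
  match v in var G' t' return
    match G' with
    | [] => unit
    | s' :: G0 => tm D s' -> (forall t, var G0 t -> tm D t) -> tm D t'
    end
  with
  | vz => fun a _ => a
  | vs w => fun _ r => r _ w
  end a r.

Definition ups (G D : ctx) (s : ty) (r : forall t, var G t -> tm D t) :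
  forall t, var (s :: G) t -> tm (s :: D) t :=
  scons (Var vz) (fun t v => ren (fun _ w => vs w) (r t v)).

Fixpoint sub (G D : ctx) (r : forall t, var G t -> tm D t) (t : ty)
  (a : tm G t) : tm D t :=
  match a with
  | Var v => r _ v
  | App a b => App (sub r a) (sub r b)
  | Zero => Zero
  | One => One
  | Plus => Plus
  | Times => Times
  | Pi => Pi
  | Sigma => Sigma
  | Rec => Rec
  end.

Fixpoint subf (G D : ctx) (r : forall t, var G t -> tm D t) (p : fm G) : fm D :=
  match p with
  | Eq a b => Eq (sub r a) (sub r b)
  | Lt a b => Lt (sub r a) (sub r b)
  | Bot => Bot
  | And a b => And (subf r a) (subf r b)
  | Or a b => Or (subf r a) (subf r b)
  | Imp a b => Imp (subf r a) (subf r b)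
  | All q => All (subf (ups r) q)
  | Ex q => Ex (subf (ups r) q)
  end.

Definition inst (G : ctx) (s : ty) (a : tm G s) (p : fm (s :: G)) : fm G :=
  subf (scons a (fun _ v => Var v)) p.

(** * Classical natural deduction from a set of sentences *)

(* [prv T H p]: the formula p, with free variables in G, is derivable from the
   hypotheses H (in the same context) and the axioms T. *)
Inductive prv (T : sentence -> Prop) : forall G : ctx, list (fm G) -> fm G -> Prop :=
| p_ax G (H : list (fm G)) (p : sentence) : T p -> prv T H (renf (@no_var G) p)
| p_hyp G (H : list (fm G)) (p : fm G) : In p H -> prv T H p
| p_raa G (H : list (fm G)) (p : fm G) : prv T (Imp p Bot :: H) Bot -> prv T H p
| p_impI G (H : list (fm G)) (p q : fm G) : prv T (p :: H) q -> prv T H (Imp p q)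
| p_impE G (H : list (fm G)) (p q : fm G) :
    prv T H (Imp p q) -> prv T H p -> prv T H q
| p_andI G (H : list (fm G)) (p q : fm G) :
    prv T H p -> prv T H q -> prv T H (And p q)
| p_andE1 G (H : list (fm G)) (p q : fm G) : prv T H (And p q) -> prv T H p
| p_andE2 G (H : list (fm G)) (p q : fm G) : prv T H (And p q) -> prv T H q
| p_orI1 G (H : list (fm G)) (p q : fm G) : prv T H p -> prv T H (Or p q)
| p_orI2 G (H : list (fm G)) (p q : fm G) : prv T H q -> prv T H (Or p q)
| p_orE G (H : list (fm G)) (p q c : fm G) :
    prv T H (Or p q) -> prv T (p :: H) c -> prv T (q :: H) c -> prv T H c
| p_allI G (H : list (fm G)) (s : ty) (p : fm (s :: G)) :
    prv T (map (@wkf G s) H) p -> prv T H (All p)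
| p_allE G (H : list (fm G)) (s : ty) (p : fm (s :: G)) (a : tm G s) :
    prv T H (All p) -> prv T H (inst a p)
| p_exI G (H : list (fm G)) (s : ty) (p : fm (s :: G)) (a : tm G s) :
    prv T H (inst a p) -> prv T H (Ex p)
| p_exE G (H : list (fm G)) (s : ty) (p : fm (s :: G)) (c : fm G) :
    prv T H (Ex p) -> prv T (p :: map (@wkf G s) H) (wkf s c) -> prv T H c.

Definition proves (T : sentence -> Prop) (p : sentence) : Prop :=
  @prv T [] [] p.

Definition add_axiom (T : sentence -> Prop) (p : sentence) : sentence -> Prop :=
  fun q => T q \/ q = p.

(** * Notation for object-level terms and formulas *)

(* A bound variable is named at its binder; [# x] weakens a term x to the
   larger context in which it is used, the weakening being inferred. *)
Class Ext (G D : ctx) : Type := ext_var : forall t, var G t -> var D t.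
#[global] Hint Mode Ext + + : typeclass_instances.
#[global] Instance ext_refl (G : ctx) : Ext G G | 0 := fun _ v => v.
#[global] Instance ext_step (G D : ctx) (s : ty) (e : Ext G D) : Ext G (s :: D) | 1 :=
  fun t v => vs (e t v).
Definition lift (G D : ctx) (e : Ext G D) (t : ty) (a : tm G t) : tm D t :=
  ren e a.

Declare Scope fm_scope.
Delimit Scope fm_scope with fm.
Bind Scope fm_scope with fm.
Bind Scope fm_scope with tm.
Open Scope fm_scope.

Notation "# x" := (lift _ x) (at level 8, x at level 8, format "# x") : fm_scope.
Notation "a @ b" := (App a b) (at level 11, left associativity) : fm_scope.
Notation "a + b" := (App (App Plus a) b) : fm_scope.
Notation "a * b" := (App (App Times a) b) : fm_scope.
Notation "a == b" := (Eq a b) (at level 70, no associativity) : fm_scope.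
Notation "a <0 b" := (Lt a b) (at level 70, no associativity) : fm_scope.
Notation "a <=0 b" := (Or (Lt a b) (Eq a b)) (at level 70, no associativity) : fm_scope.
Notation "p /\ q" := (And p q) : fm_scope.
Notation "p \/ q" := (Or p q) : fm_scope.
Notation "p --> q" := (Imp p q) (at level 99, right associativity, q at level 200) : fm_scope.
Notation "'Not' p" := (Imp p Bot) (at level 75, right associativity) : fm_scope.
Notation "p <--> q" := (And (Imp p q) (Imp q p)) (at level 95, no associativity) : fm_scope.

Definition allx (G : ctx) (s : ty) (p : tm (s :: G) s -> fm (s :: G)) : fm G :=
  All (p (Var vz)).
Definition exx (G : ctx) (s : ty) (p : tm (s :: G) s -> fm (s :: G)) : fm G :=
  Ex (p (Var vz)).
Notation "'all' x : s , p" := (@allx _ s%ty (fun x => p))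
  (at level 200, x name, s at level 60, right associativity) : fm_scope.
Notation "'ex' x : s , p" := (@exx _ s%ty (fun x => p))
  (at level 200, x name, s at level 60, right associativity) : fm_scope.

(* Lambda-abstraction, by bracket abstraction with the combinators. *)
Definition lam_var (G : ctx) (s t : ty) (v : var (s :: G) t) : tm G (s ~> t) :=
  match v in var G' t' return
    match G' with [] => unit | s' :: G0 => tm G0 (s' ~> t') end
  with
  | @vz G0 s0 => App (App Sigma Pi) (@Pi G0 s0 s0)
  | vs w => App Pi (Var w)
  end.

Fixpoint lambda (G : ctx) (s t : ty) (a : tm (s :: G) t) : tm G (s ~> t) :=
  match a with
  | Var v => lam_var v
  | App a b => App (App Sigma (lambda a)) (lambda b)
  | Zero => App Pi Zero
  | One => App Pi One
  | Plus => App Pi Plus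
  | Times => App Pi Times
  | Pi => App Pi Pi
  | Sigma => App Pi Sigma
  | Rec => App Pi Rec
  end.

Definition lamx (G : ctx) (s t : ty) (a : tm (s :: G) s -> tm (s :: G) t) :
  tm G (s ~> t) := lambda (a (Var vz)).
Notation "'lam' x : s , a" := (@lamx _ s%ty _ (fun x => a))
  (at level 200, x name, s at level 60, right associativity) : fm_scope.

(** * The theory RCA_0^omega *)

Fixpoint eqt (G : ctx) (s : ty) : tm G s -> tm G s -> fm G :=
  match s return tm G s -> tm G s -> fm G with
  | TN => fun x y => x == y
  | Arr r t => fun x y => all z : r, eqt (#x @ #z) (#y @ #z)
  end.

(* Universal closure of a formula with parameters. *)
Fixpoint closure (G : ctx) : fm G -> sentence :=
  match G return fm G -> sentence with
  | [] => fun p => p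
  | s :: G' => fun p => @closure G' (All p)
  end.

Definition ext_axiom (r t : ty) : sentence :=
  all f : (r ~> t), all x : r, all y : r,
    eqt #x #y --> eqt (#f @ #x) (#f @ #y).

Definition ind_axiom (G : ctx) (A : fm (TN :: G)) : sentence :=
  closure
    (inst Zero A /\
     (all n : TN, A --> subf (scons (#n + One) (fun _ v => Var (vs v))) A) -->
     All A).

(* In A the variable of index 0 is y and the variable of index 1 is x. *)
Definition qfac10 (G : ctx) (A : fm (TN :: T1 :: G)) : sentence :=
  closure
    (All (Ex A) -->
     ex Y : T2, all x : T1,
       subf (scons (#Y @ #x) (scons #x (fun _ v => Var (vs (vs v))))) A).

Inductive RCA0w : sentence -> Prop :=
(* =_0 is an equality; compatibility of function symbols with it is ext_axiom *)
| ax_refl : RCA0w (all x : TN, #x == #x)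
| ax_sym : RCA0w (all x : TN, all y : TN, #x == #y --> #y == #x)
| ax_trans : RCA0w (all x : TN, all y : TN, all z : TN,
    #x == #y --> #y == #z --> #x == #z)
| ax_lt_eq : RCA0w (all x : TN, all y : TN, all u : TN, all v : TN,
    #x == #u --> #y == #v --> #x <0 #y --> #u <0 #v)
(* N is an ordered semi-ring; discreteness follows by induction *)
| ax_addA : RCA0w (all x : TN, all y : TN, all z : TN,
    (#x + #y) + #z == #x + (#y + #z))
| ax_addC : RCA0w (all x : TN, all y : TN, #x + #y == #y + #x)
| ax_add0 : RCA0w (all x : TN, #x + Zero == #x)
| ax_mulA : RCA0w (all x : TN, all y : TN, all z : TN,
    (#x * #y) * #z == #x * (#y * #z))
| ax_mulC : RCA0w (all x : TN, all y : TN, #x * #y == #y * #x)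
| ax_mul1 : RCA0w (all x : TN, #x * One == #x)
| ax_mul0 : RCA0w (all x : TN, #x * Zero == Zero)
| ax_mulD : RCA0w (all x : TN, all y : TN, all z : TN,
    #x * (#y + #z) == #x * #y + #x * #z)
| ax_lt_irrefl : RCA0w (all x : TN, Not (#x <0 #x))
| ax_lt_trans : RCA0w (all x : TN, all y : TN, all z : TN,
    #x <0 #y --> #y <0 #z --> #x <0 #z)
| ax_lt_total : RCA0w (all x : TN, all y : TN,
    #x <0 #y \/ #x == #y \/ #y <0 #x)
| ax_lt_add : RCA0w (all x : TN, all y : TN, all z : TN,
    #x <0 #y --> #x + #z <0 #y + #z)
| ax_lt_mul : RCA0w (all x : TN, all y : TN, all z : TN,
    #x <0 #y --> Zero <0 #z --> #x * #z <0 #y * #z)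
| ax_lt01 : RCA0w (Zero <0 One)
| ax_Pi (s t : ty) : RCA0w (all x : s, all y : t, eqt (Pi @ #x @ #y) #x)
| ax_Sigma (r s t : ty) :
    RCA0w (all x : (r ~> s ~> t), all y : (r ~> s), all z : r,
      eqt (Sigma @ #x @ #y @ #z) (#x @ #z @ (#y @ #z)))
| ax_Rec0 : RCA0w (all f : (TN ~> TN ~> TN), all m : TN,
    Rec @ #f @ #m @ Zero == #m)
| ax_RecS : RCA0w (all f : (TN ~> TN ~> TN), all m : TN, all n : TN,
    Rec @ #f @ #m @ (#n + One) == #f @ #n @ (Rec @ #f @ #m @ #n))
| ax_ext (r t : ty) : RCA0w (ext_axiom r t)
| ax_ind (G : ctx) (A : fm (TN :: G)) : qf A = true -> RCA0w (ind_axiom A)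
| ax_qfac (G : ctx) (A : fm (TN :: T1 :: G)) : qf A = true -> RCA0w (qfac10 A).

(** * Rational numbers coded by natural numbers *)

Definition predec (G : ctx) (n : tm G TN) : tm G TN :=
  Rec @ (lam k : TN, lam r : TN, #k) @ Zero @ n.
Definition monus (G : ctx) (x y : tm G TN) : tm G TN :=
  Rec @ (lam k : TN, lam r : TN, predec #r) @ x @ y.
Definition exp2 (G : ctx) (n : tm G TN) : tm G TN :=
  Rec @ (lam k : TN, lam r : TN, #r + #r) @ One @ n.

(* Integer part of the square root: the root is increased at k+1 exactly when
   (r+1)^2 <= k+1. *)
Definition isqrt (G : ctx) (n : tm G TN) : tm G TN :=
  Rec @ (lam k : TN, lam r : TN,
           #r + monus One (monus ((#r + One) * (#r + One)) (#k + One)))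
      @ Zero @ n.

(* The pairing (x,y) |-> (x+y)^2 + x, with its projections: x <= x+y, so x+y is
   the integer square root of the code. *)
Definition pair (G : ctx) (x y : tm G TN) : tm G TN := (x + y) * (x + y) + x.
Definition pfst (G : ctx) (c : tm G TN) : tm G TN := monus c (isqrt c * isqrt c).
Definition psnd (G : ctx) (c : tm G TN) : tm G TN := monus (isqrt c) (pfst c).

(* The rational (pos - neg) / den; only used with den positive. *)
Record rat (G : ctx) : Type :=
  Rat { pos : tm G TN; neg : tm G TN; den : tm G TN }.

(* The natural number ((a,b),c) codes the rational (a - b) / (c + 1). *)
Definition decode (G : ctx) (c : tm G TN) : rat G :=
  Rat (pfst (pfst c)) (psnd (pfst c)) (psnd c + One).
Definition encode (G : ctx) (q : rat G) : tm G TN :=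
  pair (pair (pos q) (neg q)) (predec (den q)).

Section Rationals.
Variable G : ctx.
Implicit Types q r : rat G.

Definition qadd q r : rat G :=
  Rat (pos q * den r + pos r * den q) (neg q * den r + neg r * den q)
      (den q * den r).
Definition qopp q : rat G := Rat (neg q) (pos q) (den q).
Definition qsub q r : rat G := qadd q (qopp r).
Definition qabs q : rat G :=
  Rat (monus (pos q) (neg q) + monus (neg q) (pos q)) Zero (den q).
(* 2^{-n} and 2^{-n+1} *)
Definition qhalf (n : tm G TN) : rat G := Rat One Zero (exp2 n).
Definition qhalf1 (n : tm G TN) : rat G := Rat (One + One) Zero (exp2 n).

Definition qlt q r : fm G :=
  pos q * den r + neg r * den q <0 pos r * den q + neg q * den r.
Definition qle q r : fm G :=
  pos q * den r + neg r * den q <=0 pos r * den q + neg q * den r.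

End Rationals.

(** * Real numbers *)

Section Reals.
Variable G : ctx.
Implicit Types x y z : tm G T1.

Definition is_real x : fm G :=
  all n : TN, all i : TN,
    qlt (qabs (qsub (decode (#x @ #n)) (decode (#x @ (#n + #i))))) (qhalf #n).

Definition req x y : fm G :=
  all n : TN,
    qle (qabs (qsub (decode (#x @ #n)) (decode (#y @ #n)))) (qhalf1 #n).

Definition rlt x y : fm G :=
  ex n : TN, qlt (qadd (decode (#x @ #n)) (qhalf1 #n)) (decode (#y @ #n)).
Definition rle x y : fm G :=
  all n : TN, qle (decode (#x @ #n)) (qadd (decode (#y @ #n)) (qhalf1 #n)).

(* The shift by one restores the modulus 2^{-n}. *)
Definition radd x y : tm G T1 :=
  lam n : TN, encode (qadd (decode (#x @ (#n + One))) (decode (#y @ (#n + One)))).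
Definition rsub x y : tm G T1 :=
  lam n : TN, encode (qsub (decode (#x @ (#n + One))) (decode (#y @ (#n + One)))).
Definition rabs x : tm G T1 := lam n : TN, encode (qabs (decode (#x @ #n))).

Definition rzero : tm G T1 := lam n : TN, encode (Rat Zero Zero One).
Definition rone : tm G T1 := lam n : TN, encode (Rat One Zero One).

Definition in01 x : fm G := is_real x /\ rle rzero x /\ rle x rone.
Definition is_pos x : fm G := is_real x /\ rlt rzero x.

End Reals.
Arguments rzero {G}.
Arguments rone {G}.

(** * Functions, nets, and the two principles *)

Section Functions.
Variable G : ctx.
Implicit Types f : tm G (T1 ~> T1).

(* f : [0,1] -> R *)
Definition fun01 f : fm G :=
  (all x : T1, in01 #x --> is_real (#f @ #x)) /\
  (all x : T1, all y : T1,
     in01 #x /\ in01 #y --> req #x #y --> req (#f @ #x) (#f @ #y)).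

(* f : R -> R^+ *)
Definition fun_pos f : fm G :=
  (all x : T1, is_real #x --> is_pos (#f @ #x)) /\
  (all x : T1, all y : T1,
     is_real #x /\ is_real #y --> req #x #y --> req (#f @ #x) (#f @ #y)).

Definition continuous01 f : fm G :=
  all x : T1, in01 #x --> all e : T1, is_pos #e -->
    ex d : T1, is_pos #d /\
      all y : T1, in01 #y -->
        rlt (rabs (rsub #x #y)) #d -->
        rlt (rabs (rsub (#f @ #x) (#f @ #y))) #e.

End Functions.

Definition mem (G : ctx) (D : tm G T2) (d : tm G T1) : fm G := D @ d == One.
Definition prec (G : ctx) (R : tm G (T1 ~> T1 ~> TN)) (d e : tm G T1) : fm G :=
  R @ d @ e == One.

Section Nets.
Variable G : ctx.
(* D and R are the characteristic functions of the index set and of its order,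
   F is the net (d, x) |-> f_d(x), and f is the limit. *)
Variables (D : tm G T2) (R : tm G (T1 ~> T1 ~> TN)).
Variables (F : tm G (T1 ~> T1 ~> T1)) (f : tm G (T1 ~> T1)).

Definition charset : fm G := all d : T1, #D @ #d <=0 One.
Definition charrel : fm G := all d : T1, all e : T1, #R @ #d @ #e <=0 One.

Definition directed : fm G :=
  (ex d : T1, mem #D #d) /\
  (all a : T1, mem #D #a --> prec #R #a #a) /\
  (all a : T1, all b : T1, all c : T1,
     mem #D #a /\ mem #D #b /\ mem #D #c -->
     prec #R #a #b --> prec #R #b #c --> prec #R #a #c) /\
  (all a : T1, all b : T1, mem #D #a /\ mem #D #b -->
     ex c : T1, mem #D #c /\ prec #R #a #c /\ prec #R #b #c).

Definition converges : fm G :=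
  all x : T1, in01 #x --> all e : T1, is_pos #e -->
    ex d0 : T1, mem #D #d0 /\
      all d : T1, mem #D #d --> prec #R #d0 #d -->
        rlt (rabs (rsub (#F @ #d @ #x) (#f @ #x))) #e.

(* The finite sequence d_0, ..., d_k is given by k and s : 0 -> 1. *)
Definition quasi_uniform : fm G :=
  converges /\
  all e : T1, is_pos #e --> all d : T1, mem #D #d -->
    ex k : TN, ex s : (TN ~> T1),
      (all j : TN, #j <=0 #k --> mem #D (#s @ #j) /\ prec #R #d (#s @ #j)) /\
      (all x : T1, in01 #x -->
         ex j : TN, #j <=0 #k /\
           rlt (rabs (rsub (#F @ (#s @ #j) @ #x) (#f @ #x))) #e).

End Nets.

Definition ARZ_net : sentence :=
  all D : T2, all R : (T1 ~> T1 ~> TN),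
  all F : (T1 ~> T1 ~> T1), all f : (T1 ~> T1),
    charset #D --> charrel #R --> directed #D #R -->
    (all d : T1, mem #D #d --> fun01 (#F @ #d) /\ continuous01 (#F @ #d)) -->
    fun01 #f --> continuous01 #f -->
    converges #D #R #F #f -->
    quasi_uniform #D #R #F #f.

(* The points y_1, ..., y_k are given by k and y : 0 -> 1. *)
Definition HBU : sentence :=
  all Psi : (T1 ~> T1), fun_pos #Psi -->
    ex k : TN, ex y : (TN ~> T1),
      (all i : TN, One <=0 #i /\ #i <=0 #k --> in01 (#y @ #i)) /\
      (all x : T1, in01 #x -->
         ex i : TN, (One <=0 #i /\ #i <=0 #k) /\
           rlt (rsub (#y @ #i) (#Psi @ (#y @ #i))) #x /\
           rlt #x (radd (#y @ #i) (#Psi @ (#y @ #i)))).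

(* Main.v *)
(* By Goedel's completeness theorem (Henkin's construction, carried out here for
   the finite-type language) and an extensional collapse, it suffices to derive
   HBU in an arbitrary extensional model M of RCA_0^omega + ARZ_net, where one can
   argue with M's own, possibly nonstandard, naturals, embedded in their ordered
   field of fractions.

   In M, let Psi : R -> R^+. An index w is an arbitrary element of Baire space, read
   as a finite sequence of sequences of rationals, each of which is forced into a
   real y of [0,1]. QF-AC^{1,0} yields a functional nu with 2^-nu(y) < Psi(y), and y
   is replaced by a *code* of a rational ball of radius 2^-(nu(y)+1) around a
   rational close to y. Put w <= u when every ball code of w is a ball code of u:
   although the indices are lists of reals, this comparison of finite sets of
   natural numbers is decidable, so the order has a characteristic function in M,
   and concatenation makes it directed. Let f_w : [0,1] -> [0,1] be continuous, equal
   to 0 outside the balls of w and to 1 near their centres. The net f_w converges to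
   1, because <x> <= w forces f_w(x) = 1. By quasi-uniformity for epsilon = 1
   finitely many f_w have no common zero, hence the finitely many points y occurring
   in these indices w give the required covering. *)
From HB Require Import structures.
From mathcomp Require Import all_boot all_order all_algebra.
From mathcomp Require Import boolp ring lra.
Require Import Defs.
Set Implicit Arguments.
Unset Strict Implicit.
Unset Printing Implicit Defensive.
Close Scope fm_scope.
Close Scope ring_scope.
Import Order.TTheory GRing.Theory Num.Theory.

(** * Substitution and derivations *)

(** Equality on Baire space is not decided by any closed term, whereas the order on indices needs a
    characteristic function; this is why the balls enter only through numerical codes. The price is
    that a code common to w and u may stem from two different points y and y'. Nothing is lost: the
    code alone determines the bump, and the code contains the exponent nu, so each of the two points
    lies near the coded centre and satisfies 2^-nu < Psi at that point; its own neighbourhood thus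
    contains the coded ball. For the same reason nu may depend on the sequence y and not only on the
    real it is turned into.

    The second constraint is that the model has only quantifier-free induction while its lists may
    have nonstandard length. Maxima over the balls of an index and bounded quantifiers over its
    entries are therefore computed by the recursor, and each induction exhibits a quantifier-free
    formula about codes. Estimates are made in an ordered field outside the model, where linear
    arithmetic is automatic; a rational re-enters the model only through a code. *)

Notation renaming G D := (forall t : ty, var G t -> var D t).
Notation substitution G D := (forall t : ty, var G t -> tm D t).
Notation shift := (fun _ v => vs v).

(** Functional extensionality makes the laws for composing renamings and substitutions Leibniz
    equalities, so that they rewrite under binders. *)
Lemma fam_ext (A : ty -> Type) (B : forall t, A t -> Type)
    (f g : forall t (x : A t), B t x) :
  (forall t x, f t x = g t x) -> f = g.
Proof.
by move=> e; apply: functional_extensionality_dep => t;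
  apply: functional_extensionality_dep => x.
Qed.

Section VarCase.
Variables (G : ctx) (s : ty).
(** Dependent elimination with the context fixed to be nonempty: the motive is [True] on the empty
    context, so no equation between contexts arises. *)
Lemma var_case (P : forall t, var (s :: G) t -> Prop) :
  P s vz -> (forall t v, P t (vs v)) -> forall t v, P t v.
Proof.
move=> Pz Ps t v.
refine (match v as v0 in var G' t' return
  match G' as G0 return var G0 t' -> Prop with
  | [::] => fun _ => True
  | s' :: G0 => fun v1 => forall P : (forall t, var (s' :: G0) t -> Prop),
      P s' vz -> (forall t v, P t (vs v)) -> P t' v1
  end v0 with vz _ _ => _ | vs _ _ _ _ => _ end P Pz Ps) => //.
Qed.
End VarCase.

Lemma var0_elim (P : forall t, var [::] t -> Prop) t v : P t v.
Proof.
by refine (match v as v0 in var G' t' return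
  match G' as G0 return var G0 t' -> Prop with
  | [::] => fun v0 => P t' v0
  | s' :: G0 => fun v1 => True
  end v0 with vz _ _ => I | vs _ _ _ _ => I end).
Qed.

Lemma fam0_ext (A : ty -> Type) (f g : forall t, var [::] t -> A t) : f = g.
Proof. by apply: fam_ext => t v; apply: (@var0_elim (fun t v => f t v = g t v)). Qed.

Section Composition.

Lemma upr_id G s : upr (fun t v => v) = (fun t (v : var (s :: G) t) => v).
Proof. by apply: fam_ext; apply: var_case. Qed.

Lemma upr_comp G D E s (r1 : renaming G D) (r2 : renaming D E) :
  (fun t v => upr r2 (upr r1 v)) = upr (s := s) (fun t v => r2 t (r1 t v)).
Proof. by apply: fam_ext; apply: var_case. Qed.

Lemma ren_id G t (a : tm G t) : ren (fun _ v => v) a = a.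
Proof. by elim: a => //= s u a -> b ->. Qed.

Lemma renf_id G (p : fm G) : renf (fun _ v => v) p = p.
Proof.
elim: p => //= {G} [G a b|G a b|G a -> b -> //|G a -> b -> //|G a -> b -> //|G s p e|G s p e].
all: by rewrite ?ren_id ?upr_id ?e.
Qed.

Lemma ren_ren G D E (r1 : renaming G D) (r2 : renaming D E) t (a : tm G t) :
  ren r2 (ren r1 a) = ren (fun t v => r2 t (r1 t v)) a.
Proof. by elim: a => //= s u a -> b ->. Qed.

Lemma renf_renf G (p : fm G) : forall D E (r1 : renaming G D) (r2 : renaming D E),
  renf r2 (renf r1 p) = renf (fun t v => r2 t (r1 t v)) p.
Proof.
elim: p => //= {G} [G a b|G a b|G a ea b eb|G a ea b eb|G a ea b eb|G s p e|G s p e] D E r1 r2.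
all: by rewrite ?ren_ren ?ea ?eb ?e ?upr_comp.
Qed.

Lemma sub_ren G D E (r : renaming G D) (f : substitution D E) t (a : tm G t) :
  sub f (ren r a) = sub (fun t v => f t (r t v)) a.
Proof. by elim: a => //= s u a -> b ->. Qed.

Lemma ups_upr G D E s (r : renaming G D) (f : substitution D E) :
  (fun t v => ups f (upr r v)) = ups (s := s) (fun t v => f t (r t v)).
Proof. by apply: fam_ext; apply: var_case. Qed.

Lemma subf_renf G (p : fm G) : forall D E (r : renaming G D) (f : substitution D E),
  subf f (renf r p) = subf (fun t v => f t (r t v)) p.
Proof.
elim: p => //= {G} [G a b|G a b|G a ea b eb|G a ea b eb|G a ea b eb|G s p e|G s p e] D E r f.
all: by rewrite ?sub_ren ?ea ?eb ?e ?ups_upr.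
Qed.

Lemma ren_sub G D E (f : substitution G D) (r : renaming D E) t (a : tm G t) :
  ren r (sub f a) = sub (fun t v => ren r (f t v)) a.
Proof. by elim: a => //= s u a -> b ->. Qed.

Lemma upr_ups G D E s (f : substitution G D) (r : renaming D E) :
  (fun t v => ren (upr r) (ups f v)) = ups (s := s) (fun t v => ren r (f t v)).
Proof.
apply: fam_ext; apply: var_case => //= t v.
by rewrite /= !ren_ren.
Qed.

Lemma renf_subf G (p : fm G) : forall D E (f : substitution G D) (r : renaming D E),
  renf r (subf f p) = subf (fun t v => ren r (f t v)) p.
Proof.
elim: p => //= {G} [G a b|G a b|G a ea b eb|G a ea b eb|G a ea b eb|G s p e|G s p e] D E f r.
all: by rewrite ?ren_sub ?ea ?eb ?e ?upr_ups.
Qed.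

Lemma sub_sub G D E (f : substitution G D) (g : substitution D E) t (a : tm G t) :
  sub g (sub f a) = sub (fun t v => sub g (f t v)) a.
Proof. by elim: a => //= s u a -> b ->. Qed.

Lemma ups_ups G D E s (f : substitution G D) (g : substitution D E) :
  (fun t v => sub (ups g) (ups f v)) = ups (s := s) (fun t v => sub g (f t v)).
Proof.
apply: fam_ext; apply: var_case => //= t v.
by rewrite /= ren_sub sub_ren.
Qed.

Lemma subf_subf G (p : fm G) : forall D E (f : substitution G D) (g : substitution D E),
  subf g (subf f p) = subf (fun t v => sub g (f t v)) p.
Proof.
elim: p => //= {G} [G a b|G a b|G a ea b eb|G a ea b eb|G a ea b eb|G s p e|G s p e] D E f g.
all: by rewrite ?sub_sub ?ea ?eb ?e ?ups_ups.
Qed.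

Lemma sub_id G t (a : tm G t) : sub (fun _ v => Var v) a = a.
Proof. by elim: a => //= s u a -> b ->. Qed.

Lemma ups_id G s : ups (fun t v => Var v) = (fun t (v : var (s :: G) t) => Var v).
Proof. by apply: fam_ext; apply: var_case. Qed.

Lemma subf_id G (p : fm G) : subf (fun _ v => Var v) p = p.
Proof.
elim: p => //= {G} [G a b|G a b|G a -> b -> //|G a -> b -> //|G a -> b -> //|G s p e|G s p e].
all: by rewrite ?sub_id ?ups_id ?e.
Qed.

Lemma inst_wkf G s (a : tm G s) (p : fm G) : inst a (wkf s p) = p.
Proof. by rewrite /inst /wkf subf_renf subf_id. Qed.

Lemma inst_subf G D s (f : substitution G D) (a : tm D s) (p : fm (s :: G)) :
  inst a (subf (ups f) p) = subf (scons a f) p.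
Proof.
rewrite /inst subf_subf; congr subf; apply: fam_ext; apply: var_case => //= t v.
by rewrite sub_ren sub_id.
Qed.

Lemma renf_wkf G D s (r : renaming G D) (p : fm G) :
  renf (upr r) (wkf s p) = wkf s (renf r p).
Proof. by rewrite /wkf !renf_renf. Qed.

Lemma renf_inst G D s (r : renaming G D) (a : tm G s) (p : fm (s :: G)) :
  renf r (inst a p) = inst (ren r a) (renf (upr r) p).
Proof.
rewrite /inst renf_subf subf_renf; congr subf.
by apply: fam_ext; apply: var_case.
Qed.

End Composition.

(** * Structural rules of the natural deduction system *)

Section Derivations.
Variable T : sentence -> Prop.

Lemma prv_weaken G (H : list (fm G)) p : prv T H p ->
  forall H', (forall q, List.In q H -> List.In q H') -> prv T H' p.
Proof.
have cons_sub G' (q : fm G') (K K' : list (fm G')) :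
    (forall q, List.In q K -> List.In q K') ->
    forall r, List.In r (q :: K) -> List.In r (q :: K').
  by move=> sKK' r /= [->|/sKK']; [left|right].
have map_sub G' s (K K' : list (fm G')) :
    (forall q, List.In q K -> List.In q K') ->
    forall r, List.In r (List.map (@wkf G' s) K) -> List.In r (List.map (@wkf G' s) K').
  by move=> sKK' r /List.in_map_iff[q [<- /sKK'/(List.in_map (@wkf _ s))]].
elim=> {G H p}.
- by move=> *; apply: p_ax.
- by move=> G H p pH H' sH; apply: p_hyp; apply: sH.
- by move=> G H p _ IH H' sH; apply: p_raa; apply: IH; apply: cons_sub.
- by move=> G H p q _ IH H' sH; apply: p_impI; apply: IH; apply: cons_sub.
- by move=> G H p q _ IH1 _ IH2 H' sH; apply: p_impE (IH1 _ sH) (IH2 _ sH).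
- by move=> G H p q _ IH1 _ IH2 H' sH; apply: p_andI (IH1 _ sH) (IH2 _ sH).
- by move=> G H p q _ IH H' sH; apply: p_andE1 (IH _ sH).
- by move=> G H p q _ IH H' sH; apply: p_andE2 (IH _ sH).
- by move=> G H p q _ IH H' sH; apply: p_orI1 (IH _ sH).
- by move=> G H p q _ IH H' sH; apply: p_orI2 (IH _ sH).
- move=> G H p q c _ IH1 _ IH2 _ IH3 H' sH.
  by apply: p_orE (IH1 _ sH) (IH2 _ _) (IH3 _ _); apply: cons_sub.
- by move=> G H s p _ IH H' sH; apply: p_allI; apply: IH; apply: map_sub.
- by move=> G H s p a _ IH H' sH; apply: p_allE (IH _ sH).
- by move=> G H s p a _ IH H' sH; apply: p_exI (IH _ sH).
- move=> G H s p c _ IH1 _ IH2 H' sH.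
  by apply: p_exE (IH1 _ sH) (IH2 _ _); apply: cons_sub; apply: map_sub.
Qed.

Lemma map_renf_wkf G D s (r : renaming G D) (H : list (fm G)) :
  List.map (renf (upr r)) (List.map (@wkf G s) H) = List.map (@wkf D s) (List.map (renf r) H).
Proof. by elim: H => //= p H ->; rewrite renf_wkf. Qed.

Lemma prv_ren G (H : list (fm G)) p : prv T H p ->
  forall D (r : renaming G D), prv T (List.map (renf r) H) (renf r p).
Proof.
elim=> {G H p}.
- move=> G H p Tp D r; rewrite renf_renf.
  by rewrite (fam0_ext (fun t v => r t (no_var G v)) (@no_var D)); apply: p_ax.
- by move=> G H p pH D r; apply: p_hyp; apply: List.in_map.
- by move=> G H p _ IH D r; apply: p_raa; apply: IH.
- by move=> G H p q _ IH D r; apply: p_impI; apply: IH.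
- by move=> G H p q _ IH1 _ IH2 D r; apply: p_impE (IH1 _ r) (IH2 _ r).
- by move=> G H p q _ IH1 _ IH2 D r; apply: p_andI (IH1 _ r) (IH2 _ r).
- by move=> G H p q _ IH D r; apply: p_andE1 (IH _ r).
- by move=> G H p q _ IH D r; apply: p_andE2 (IH _ r).
- by move=> G H p q _ IH D r; apply: p_orI1 (IH _ r).
- by move=> G H p q _ IH D r; apply: p_orI2 (IH _ r).
- by move=> G H p q c _ IH1 _ IH2 _ IH3 D r;
    apply: p_orE (IH1 _ r) (IH2 _ r) (IH3 _ r).
- move=> G H s p _ IH D r; apply: p_allI.
  by rewrite -map_renf_wkf; apply: IH.
- by move=> G H s p a _ IH D r; rewrite renf_inst; apply: p_allE (IH _ r).
- move=> G H s p a _ IH D r; apply: (@p_exI _ _ _ _ _ (ren r a)).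
  by rewrite -renf_inst; apply: IH.
- move=> G H s p c _ IH1 _ IH2 D r.
  apply: p_exE (IH1 _ r) _; rewrite -map_renf_wkf -renf_wkf; exact: IH2.
Qed.

Lemma prv_wkf G s (H : list (fm G)) p :
  prv T H p -> prv T (List.map (@wkf G s) H) (wkf s p).
Proof. by move/prv_ren; apply. Qed.

Lemma prv_cons G (H : list (fm G)) p q : prv T H p -> prv T (q :: H) p.
Proof. by move/prv_weaken; apply => r; right. Qed.

Lemma prv_head G (H : list (fm G)) p : prv T (p :: H) p.
Proof. by apply: p_hyp; left. Qed.

Lemma prv_cut G (H : list (fm G)) p q : prv T H p -> prv T (p :: H) q -> prv T H q.
Proof. by move=> Hp /p_impI/p_impE; apply. Qed.

Lemma prv_bot G (H : list (fm G)) p : prv T H Bot -> prv T H p.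
Proof. by move=> Hb; apply: p_raa; apply: prv_cons. Qed.

(** Classical duality, needed in [truth] to find a Henkin witness against a universal formula that
    fails. *)
Lemma prv_notAll G s (H : list (fm G)) (q : fm (s :: G)) :
  prv T H (Imp (All q) Bot) -> prv T H (Ex (Imp q Bot)).
Proof.
move=> HN; apply: p_raa; apply: p_impE (prv_cons _ HN) _.
apply: p_allI => /=; apply: p_raa.
apply: (@p_impE _ _ _ (wkf s (Ex (Imp q Bot)))); first by apply: p_hyp; right; left.
apply: (@p_exI _ _ _ _ _ (Var vz)).
suff -> : inst (Var vz) (renf (upr shift) (Imp q Bot)) = Imp q Bot by exact: prv_head.
rewrite /inst subf_renf /=; congr Imp.
rewrite -[RHS]subf_id; congr subf.
by apply: fam_ext; apply: var_case.
Qed.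

End Derivations.

(** * Completeness *)

(** An applicative structure: the domain of an arrow type is not a function space and [ieq] need not
    be equality. This generality lets the term model qualify; the collapse repairs both points
    afterwards. *)
Record struct := Struct {
  dom : ty -> Type;
  ap : forall s t, dom (s ~> t)%ty -> dom s -> dom t;
  i0 : dom TN;
  i1 : dom TN;
  iplus : dom (TN ~> TN ~> TN)%ty;
  itimes : dom (TN ~> TN ~> TN)%ty;
  iPi : forall s t, dom (s ~> t ~> s)%ty;
  iSigma : forall r s t, dom ((r ~> s ~> t) ~> (r ~> s) ~> r ~> t)%ty;
  iRec : dom ((TN ~> TN ~> TN) ~> TN ~> TN ~> TN)%ty;
  ieq : dom TN -> dom TN -> Prop;
  ilt : dom TN -> dom TN -> Prop }.
Arguments ap {M s t} _ _ : rename.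

Definition econs (A : ty -> Type) G s (a : A s) (r : forall t, var G t -> A t)
    t (v : var (s :: G) t) : A t :=
  match v in var G' t' return
    match G' with
    | [::] => unit
    | s' :: G0 => A s' -> (forall t, var G0 t -> A t) -> A t'
    end
  with
  | vz _ _ => fun a _ => a
  | vs _ _ _ w => fun _ r => r _ w
  end a r.

Definition enil (A : ty -> Type) t (v : var [::] t) : A t :=
  match v in var G' t' return match G' with [::] => A t' | _ => unit end with
  | vz _ _ => tt
  | vs _ _ _ _ => tt
  end.

Section Semantics.
Variable M : struct.
Notation env G := (forall t : ty, var G t -> dom M t).

Fixpoint ev G (r : env G) t (a : tm G t) : dom M t :=
  match a with
  | Var _ v => r _ v
  | App _ _ a b => ap (ev r a) (ev r b)
  | Zero => i0 M
  | One => i1 M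
  | Plus => iplus M
  | Times => itimes M
  | Pi s t => iPi M s t
  | Sigma u s t => iSigma M u s t
  | Rec => iRec M
  end.

Fixpoint sat G (r : env G) (p : fm G) : Prop :=
  match p in fm _ return Prop with
  | Eq a b => ieq (ev r a) (ev r b)
  | Lt a b => ilt (ev r a) (ev r b)
  | Bot => False
  | And a b => sat r a /\ sat r b
  | Or a b => sat r a \/ sat r b
  | Imp a b => sat r a -> sat r b
  | All s q => forall x : dom M s, sat (econs x r) q
  | Ex s q => exists x : dom M s, sat (econs x r) q
  end.

Definition models (T : sentence -> Prop) := forall p, T p -> sat (@enil (dom M)) p.
End Semantics.

(** * Enumeration of the formulas over a context *)

Section Enumeration.
Notation tree := (GenTree.tree nat).

Lemma ty_eq_dec (s t : ty) : {s = t} + {s <> t}.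
Proof. decide equality. Qed.

(** Trees of naturals are countable in the library. Only surjectivity of the decoders matters, so
    ill-formed trees may receive junk values. *)
Fixpoint decode_ty (t : tree) : ty :=
  match t with
  | GenTree.Node _ [:: a; b] => Arr (decode_ty a) (decode_ty b)
  | _ => TN
  end.

Fixpoint decode_var (G : ctx) (n : nat) : option {s & var G s} :=
  match G, n with
  | [::], _ => None
  | s :: G', 0 => Some (existT _ s vz)
  | s :: G', n'.+1 =>
    if decode_var G' n' is Some (existT _ v) then Some (existT _ _ (vs v)) else None
  end.

Definition mkapp G (a b : option {s & tm G s}) : option {s & tm G s} :=
  match a, b with
  | Some (existT (Arr s t) f), Some (existT s' x) =>
    match ty_eq_dec s' s with
    | left e => Some (existT _ t (App f (eq_rect s' (tm G) x s e)))
    | right _ => None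
    end
  | _, _ => None
  end.

Fixpoint decode_tm (G : ctx) (t : tree) : option {s & tm G s} :=
  match t with
  | GenTree.Leaf n =>
    if decode_var G n is Some (existT _ v) then Some (existT _ _ (Var v)) else None
  | GenTree.Node 0 [:: a; b] => mkapp (decode_tm G a) (decode_tm G b)
  | GenTree.Node 1 _ => Some (existT _ _ Zero)
  | GenTree.Node 2 _ => Some (existT _ _ One)
  | GenTree.Node 3 _ => Some (existT _ _ Plus)
  | GenTree.Node 4 _ => Some (existT _ _ Times)
  | GenTree.Node 5 [:: a; b] =>
    Some (existT _ _ (@Pi G (decode_ty a) (decode_ty b)))
  | GenTree.Node 6 [:: a; b; c] =>
    Some (existT _ _ (@Sigma G (decode_ty a) (decode_ty b) (decode_ty c)))
  | GenTree.Node 7 _ => Some (existT _ _ Rec)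
  | _ => None
  end.

Definition decode_num G (t : tree) : tm G TN :=
  if decode_tm G t is Some (existT TN a) then a else Zero.

Fixpoint decode_fm (t : tree) (G : ctx) : fm G :=
  match t with
  | GenTree.Node 0 [:: a; b] => Eq (decode_num G a) (decode_num G b)
  | GenTree.Node 1 [:: a; b] => Lt (decode_num G a) (decode_num G b)
  | GenTree.Node 2 [:: a; b] => And (decode_fm a G) (decode_fm b G)
  | GenTree.Node 3 [:: a; b] => Or (decode_fm a G) (decode_fm b G)
  | GenTree.Node 4 [:: a; b] => Imp (decode_fm a G) (decode_fm b G)
  | GenTree.Node 5 [:: a; b] => All (decode_fm b (decode_ty a :: G))
  | GenTree.Node 6 [:: a; b] => Ex (decode_fm b (decode_ty a :: G))
  | _ => Bot
  end.

Lemma decode_ty_surj s : exists t, decode_ty t = s.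
Proof.
elim: s => [|s [a ea] t [b eb]]; first by exists (GenTree.Leaf 0).
by exists (GenTree.Node 0 [:: a; b]); rewrite /= ea eb.
Qed.

Lemma decode_var_surj G s (v : var G s) : exists n, decode_var G n = Some (existT _ s v).
Proof.
elim: v => {G s} [G s|G s t v [n e]]; first by exists 0.
by exists n.+1; rewrite /= e.
Qed.

Lemma decode_tm_surj G s (a : tm G s) : exists t, decode_tm G t = Some (existT _ s a).
Proof.
elim: a => {s}.
- by move=> s v; have [n e] := decode_var_surj v; exists (GenTree.Leaf n); rewrite /= e.
- move=> s t a [x xE] b [y yE]; exists (GenTree.Node 0 [:: x; y]).
  rewrite /= xE yE /=; case: ty_eq_dec => // e.
  by rewrite (Eqdep_dec.UIP_dec ty_eq_dec e erefl).
- by exists (GenTree.Node 1 [::]).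
- by exists (GenTree.Node 2 [::]).
- by exists (GenTree.Node 3 [::]).
- by exists (GenTree.Node 4 [::]).
- move=> s t; have [x xE] := decode_ty_surj s; have [y yE] := decode_ty_surj t.
  by exists (GenTree.Node 5 [:: x; y]); rewrite /= xE yE.
- move=> r s t; have [z zE] := decode_ty_surj r; have [x xE] := decode_ty_surj s.
  have [y yE] := decode_ty_surj t.
  by exists (GenTree.Node 6 [:: z; x; y]); rewrite /= zE xE yE.
- by exists (GenTree.Node 7 [::]).
Qed.

Lemma decode_num_surj G (a : tm G TN) : exists t, decode_num G t = a.
Proof. by have [t e] := decode_tm_surj a; exists t; rewrite /decode_num e. Qed.

Lemma decode_fm_surj G (p : fm G) : exists t, decode_fm t G = p.
Proof.
elim: p => {G}.
- move=> G a b; have [x xE] := decode_num_surj a; have [y yE] := decode_num_surj b.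
  by exists (GenTree.Node 0 [:: x; y]); rewrite /= xE yE.
- move=> G a b; have [x xE] := decode_num_surj a; have [y yE] := decode_num_surj b.
  by exists (GenTree.Node 1 [:: x; y]); rewrite /= xE yE.
- by move=> G; exists (GenTree.Leaf 0).
- by move=> G p [x xE] q [y yE]; exists (GenTree.Node 2 [:: x; y]); rewrite /= xE yE.
- by move=> G p [x xE] q [y yE]; exists (GenTree.Node 3 [:: x; y]); rewrite /= xE yE.
- by move=> G p [x xE] q [y yE]; exists (GenTree.Node 4 [:: x; y]); rewrite /= xE yE.
- move=> G s p [x xE]; have [y yE] := decode_ty_surj s.
  by exists (GenTree.Node 5 [:: y; x]); rewrite /= yE xE.
- move=> G s p [x xE]; have [y yE] := decode_ty_surj s.
  by exists (GenTree.Node 6 [:: y; x]); rewrite /= yE xE.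
Qed.

Definition candidate G := {s & fm (s :: G)}.

Definition nth_candidate G (n : nat) : candidate G :=
  if unpickle n is Some (a, b) then
    existT _ (decode_ty a) (decode_fm b (decode_ty a :: G))
  else existT _ TN Bot.

Lemma nth_candidate_surj G (c : candidate G) : exists n, nth_candidate G n = c.
Proof.
case: c => s q; have [a ea] := decode_ty_surj s; have [b eb] := decode_fm_surj q.
by exists (pickle (a, b)); rewrite /nth_candidate pickleK ea eb.
Qed.

End Enumeration.

(** Every type has a closed inhabitant, which is what allows a contradiction over an extra variable
    to be brought back to the smaller context. *)
Fixpoint default_tm G s : tm G s :=
  match s with TN => Zero | Arr _ t => App Pi (default_tm G t) end.

(** * The Henkin construction and its term model *)

Section Completeness.
Variables (T : sentence -> Prop) (hyp0 : sentence).

Definition weaken_candidate G u (c : candidate G) : candidate (u :: G) :=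
  existT _ (projT1 c) (renf (upr (fun _ v => vs v)) (projT2 c)).

(* Stage of the Henkin construction: a context, the hypotheses assumed so far,
   and, as [cands i j], the j-th candidate of stage i weakened to the present
   context. *)
Record stage := Stage {
  sctx : ctx;
  hyps : list (fm sctx);
  cands : nat -> nat -> candidate sctx }.

(** The new variable serves as the witness when the existential is consistent with the hypotheses;
    otherwise its negation is recorded. The context grows in both cases, so that its shape does not
    depend on which one applies. *)
Definition next_hyps G (H : list (fm G)) (c : candidate G) : list (fm (projT1 c :: G)) :=
  if pselect (prv T (Ex (projT2 c) :: H) Bot)
  then wkf (projT1 c) (Imp (Ex (projT2 c)) Bot) :: List.map (@wkf G (projT1 c)) H
  else projT2 c :: List.map (@wkf G (projT1 c)) H.

(* Stage n treats candidate (i, j) when n = 2^i 3^j. *)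
Definition treated n (S : stage) : candidate (sctx S) := cands S (logn 2 n) (logn 3 n).

(** Row [n.+1] lists the candidates over the new context. Rows of larger index are placeholders,
    overwritten when their stage arrives. *)
Definition next_stage n (S : stage) : stage :=
  let c := treated n S in
  @Stage (projT1 c :: sctx S) (next_hyps (hyps S) c)
    (fun i j => if i == n.+1 then nth_candidate _ j
                else weaken_candidate (projT1 c) (cands S i j)).

Fixpoint chain (n : nat) : stage :=
  if n is m.+1 then next_stage m (chain m)
  else @Stage [::] [:: hyp0] (fun _ j => nth_candidate [::] j).

Notation C n := (sctx (chain n)).
Notation H n := (hyps (chain n)).

Definition up n : renaming (C n) (C n.+1) := fun _ v => vs v.
Definition fup n (p : fm (C n)) : fm (C n.+1) := renf (@up n) p.

Definition eventually (P : nat -> Prop) := exists m, forall n, m <= n -> P n.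

Lemma eventually_and P Q : eventually P -> eventually Q -> eventually (fun n => P n /\ Q n).
Proof.
move=> [m Pm] [k Qk]; exists (maxn m k) => n.
by rewrite geq_max => /andP[/Pm ? /Qk ?].
Qed.

Lemma eventually_mono (P Q : nat -> Prop) :
  (forall n, P n -> Q n) -> eventually P -> eventually Q.
Proof. by move=> PQ [m Pm]; exists m => n /Pm/PQ. Qed.

Lemma eventually_ex P : eventually P -> exists n, P n.
Proof. by case=> m; exists m; auto. Qed.

Hypothesis consistent0 : ~ prv T [:: hyp0] Bot.

(** A fresh witness is conservative by elimination of the existential quantifier; in the other case
    the recorded negation was already derivable and can be cut. *)
Lemma consistent n : ~ prv T (H n) Bot.
Proof.
elim: n => //= n IH; rewrite /next_hyps; set c := treated _ _.
case: pselect => [Hc|nHc] /= HB; last first.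
  apply: nHc; apply: (@p_exE _ _ _ _ (projT2 c)); first exact: prv_head.
  by apply: (prv_weaken (p := Bot) HB) => /= q [->|]; [left|right; right].
apply: IH; apply: (@prv_cut _ _ _ (Imp (Ex (projT2 c)) Bot)); first exact: p_impI.
set K := _ :: _ in HB.
have {}HB : prv T (List.map (@wkf _ (projT1 c)) (Imp (Ex (projT2 c)) Bot :: H n)) Bot
  by exact: HB.
by have := p_allE (default_tm _ _) (@p_allI _ _ _ _ Bot HB).
Qed.

Lemma hyps_next n p : prv T (H n) p -> prv T (H n.+1) (fup p).
Proof.
move=> Hp; have Hw := prv_wkf (projT1 (treated n (chain n))) Hp.
apply: (prv_weaken Hw) => q qH; rewrite /= /next_hyps.
by case: pselect => h /=; right.
Qed.

Definition coherent (A : nat -> Type) (lft : forall n, A n -> A n.+1) (x : forall n, A n) :=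
  eventually (fun n => x n.+1 = lft n (x n)).

Definition holds (p : forall n, fm (C n)) := eventually (fun n => prv T (H n) (p n)).

Lemma holds_from (p : forall n, fm (C n)) m n :
  (forall k, m <= k -> p k.+1 = fup (p k)) -> m <= n ->
  prv T (H n) (p n) -> holds p.
Proof.
move=> cp mn Hn; exists n.
elim=> [|k IH]; first by rewrite leqn0 => /eqP n0; rewrite -n0.
rewrite leq_eqVlt => /orP[/eqP<-//|nk].
have {}IH := IH nk; rewrite cp; first exact: hyps_next.
exact: leq_trans mn nk.
Qed.

Lemma cands_next n i j :
  i <= n -> cands (chain n.+1) i j = weaken_candidate _ (cands (chain n) i j).
Proof. by move=> le_in; rewrite /= ltn_eqF. Qed.

Lemma cands_diag n j : cands (chain n) n j = nth_candidate _ j.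
Proof. by case: n => //= n; rewrite eqxx. Qed.

(** Listed as the j-th candidate of row i, the formula is treated at stage 2^i 3^j, which is at
    least i; by then weakening has carried it to [q n], by coherence. As i may be chosen large, the
    stage is as late as desired. *)
Lemma treated_later s (q : forall n, fm (s :: C n)) :
  coherent (fun n (p : fm (s :: C n)) => renf (upr (@up n)) p : fm (s :: C n.+1)) q ->
  forall m, exists2 n, m <= n & treated n (chain n) = existT _ s (q n).
Proof.
move=> [k ck] m; set i := maxn k m.
have [j ej] := nth_candidate_surj (existT _ s (q i) : candidate (C i)).
exists (2 ^ i * 3 ^ j).
  apply: leq_trans (leq_maxr k m) _; rewrite -/i.
  apply: leq_trans (ltnW (ltn_expl i (isT : 1 < 2))) _.
  by rewrite leq_pmulr // expn_gt0.
have -> : treated (2 ^ i * 3 ^ j) (chain (2 ^ i * 3 ^ j)) = cands (chain (2 ^ i * 3 ^ j)) i j.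
  rewrite /treated; congr cands.
    by rewrite lognM ?expn_gt0 // !lognX /= !logn_prime //= muln1 muln0 addn0.
  by rewrite lognM ?expn_gt0 // !lognX /= !logn_prime //= muln1 muln0.
have : i <= 2 ^ i * 3 ^ j.
  apply: leq_trans (ltnW (ltn_expl i (isT : 1 < 2))) _.
  by rewrite leq_pmulr // expn_gt0.
elim: (2 ^ i * 3 ^ j) => [|n IH].
  by rewrite leqn0 => /eqP i0; rewrite -[0]i0 cands_diag.
rewrite leq_eqVlt => /orP[/eqP<-|lt_in]; first by rewrite cands_diag.
rewrite cands_next // (IH lt_in) /weaken_candidate /= ck //.
by apply: leq_trans (leq_maxl k m) _.
Qed.

(** At a late stage the existential is derivable, so the refuting branch of [next_hyps] would be
    inconsistent and the fresh variable is a witness. Arbitrarily late stages are provided because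
    the witness must be compared with an environment past its threshold of coherence. *)
Lemma henkin s (q : forall n, fm (s :: C n)) :
  coherent (fun n (p : fm (s :: C n)) => renf (upr (@up n)) p : fm (s :: C n.+1)) q ->
  holds (fun n => Ex (q n)) ->
  forall m, exists n, m <= n /\ exists a : tm (C n) s, prv T (H n) (inst a (q n)).
Proof.
move=> cq; have [k ck] := cq => -[l Hl] m.
have [n le_mn en] := treated_later cq (maxn k (maxn l m)).
move: le_mn; rewrite !geq_max => /and3P[kn ln mn].
exists n.+1; split; first exact: leqW.
rewrite ck //= /next_hyps /up en /=.
exists (Var vz).
case: pselect => [Hx|h] /=.
  by case: (@consistent n); exact: prv_cut (Hl _ ln) Hx.
suff -> : inst (Var vz) (renf (upr (fun _ v => vs (t := s) v)) (q n)) = q n by exact: prv_head.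
rewrite /inst subf_renf -[RHS]subf_id; congr subf.
by apply: fam_ext; apply: var_case.
Qed.

(** Maximality comes from the Henkin step alone: apply it to the vacuous quantification of [p] over
    a variable of type 0. No separate Lindenbaum extension is needed. *)
Lemma holds_dec (p : forall n, fm (C n)) :
  coherent (@fup) p -> holds p \/ holds (fun n => Imp (p n) Bot).
Proof.
move=> cp.
have cq : coherent (fun n (p : fm (TN :: C n)) => renf (upr (@up n)) p : fm (TN :: C n.+1))
    (fun n => wkf TN (p n)).
  by apply: eventually_mono cp => n ->; rewrite [RHS]renf_wkf.
have [m cm] := cp.
have [n le_mn en] := treated_later cq m.
have : prv T (H n.+1) (p n.+1) \/ prv T (H n.+1) (Imp (p n.+1) Bot).
  rewrite cm // /fup /= /next_hyps /up en /=.
  case: pselect => [Hx|h] /=; last by left; exact: prv_head.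
  right; apply: p_impI; apply: (@p_impE _ _ _ (wkf TN (Ex (wkf TN (p n))))).
    by apply: prv_cons; exact: prv_head.
  apply: (@p_exI _ _ _ _ _ Zero).
  have -> : inst Zero (renf (upr shift) (wkf TN (p n))) =
      wkf (projT1 (existT (fun s => fm (s :: C n)) TN (wkf TN (p n)))) (p n).
    by rewrite renf_wkf inst_wkf.
  exact: prv_head.
case=> Hn; [left|right].
  exact: holds_from cm (leqW le_mn) Hn.
by apply: (holds_from _ (leqW le_mn) Hn) => k /cm ->.
Qed.

(** Elements of the direct limit of the terms over the growing contexts, as sequences that
    eventually follow weakening. No quotient is taken: equality in the model is derivable equality,
    and identification is left to the collapse. *)
Definition germ s := {x : forall n, tm (C n) s | coherent (fun n a => ren (@up n) a) x}.

Lemma coherent_app s t (f : germ (s ~> t)%ty) (x : germ s) :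
  coherent (fun n a => ren (@up n) a) (fun n => App (sval f n) (sval x n)).
Proof. by apply: eventually_mono (eventually_and (svalP f) (svalP x)) => n [/= -> ->]. Qed.

Definition germ_ap s t (f : germ (s ~> t)%ty) (x : germ s) : germ t :=
  exist _ _ (coherent_app f x).

Definition germ_cst s (c : forall G, tm G s)
  (cE : forall G D (r : renaming G D), ren r (c G) = c D) : germ s :=
  exist (coherent _) (fun n => c (C n)) (ex_intro _ 0 (fun n _ => esym (cE _ _ (@up n)))).

Definition term_model : struct := @Struct germ germ_ap
  (@germ_cst _ (fun _ => Zero) (fun _ _ _ => erefl))
  (@germ_cst _ (fun _ => One) (fun _ _ _ => erefl))
  (@germ_cst _ (fun _ => Plus) (fun _ _ _ => erefl))
  (@germ_cst _ (fun _ => Times) (fun _ _ _ => erefl))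
  (fun s t => @germ_cst _ (fun _ => Pi) (fun _ _ _ => erefl))
  (fun r s t => @germ_cst _ (fun _ => Sigma) (fun _ _ _ => erefl))
  (@germ_cst _ (fun _ => Rec) (fun _ _ _ => erefl))
  (fun x y => holds (fun n => Eq (sval x n) (sval y n)))
  (fun x y => holds (fun n => Lt (sval x n) (sval y n))).

Notation env G := (forall t : ty, var G t -> germ t).

Definition at_stage G (r : env G) n : substitution G (C n) := fun t v => sval (r t v) n.

Lemma ev_at_stage G (r : env G) t (a : tm G t) n :
  sval (@ev term_model G r t a) n = sub (at_stage r n) a.
Proof. by elim: a => //= s u a -> b ->. Qed.

Lemma at_stage_econs G s (x : germ s) (r : env G) n :
  at_stage (econs x r) n = scons (sval x n) (at_stage r n).
Proof. by apply: fam_ext; apply: var_case. Qed.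

(** A context is finite, so the thresholds of its germs have a maximum. *)
Lemma env_coherent G (r : env G) :
  eventually (fun n => at_stage r n.+1 = fun t v => ren (@up n) (at_stage r n v)).
Proof.
elim: G r => [|s G IH] r.
  by exists 0 => n _; apply: fam0_ext.
have [m hm] := eventually_and (IH (fun t v => r t (vs v))) (svalP (r s vz)).
exists m => n /hm[e1 e2]; apply: fam_ext; apply: var_case => // t v.
exact: (congr1 (fun f : substitution G (C n.+1) => f t v) e1).
Qed.

Lemma subf_next G (r : env G) (p : fm G) n :
  at_stage r n.+1 = (fun t v => ren (@up n) (at_stage r n v)) ->
  subf (at_stage r n.+1) p = fup (subf (at_stage r n) p).
Proof. by move=> ->; rewrite /fup renf_subf. Qed.

Lemma coherent_subf G (r : env G) (p : fm G) :
  coherent (@fup) (fun n => subf (at_stage r n) p).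
Proof. by apply: eventually_mono (env_coherent r) => n /subf_next. Qed.

Lemma coherent_subf_ups G s (r : env G) (q : fm (s :: G)) :
  coherent (fun n (p : fm (s :: C n)) => renf (upr (@up n)) p : fm (s :: C n.+1))
    (fun n => subf (ups (at_stage r n)) q).
Proof.
apply: eventually_mono (env_coherent r) => n ->.
by rewrite renf_subf upr_ups.
Qed.

(* The weakenings of [a] from stage n on; junk before. *)
Fixpoint weakenings s n (a : tm (C n) s) m : tm (C m) s :=
  match PeanoNat.Nat.eq_dec n m with
  | left e => eq_rect n (fun m => tm (C m) s) a m e
  | right _ => match m with 0 => default_tm _ s | k.+1 => ren (@up k) (weakenings a k) end
  end.

Lemma weakeningsE s n (a : tm (C n) s) m : weakenings a m =
  match PeanoNat.Nat.eq_dec n m with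
  | left e => eq_rect n (fun m => tm (C m) s) a m e
  | right _ => match m with 0 => default_tm _ s | k.+1 => ren (@up k) (weakenings a k) end
  end.
Proof. by case: m. Qed.

Lemma germ_through n s (a : tm (C n) s) : exists x : germ s,
  sval x n = a /\ forall m, n <= m -> sval x m.+1 = ren (@up m) (sval x m).
Proof.
set x := weakenings a.
have xn : x n = a.
  rewrite /x weakeningsE; case: (PeanoNat.Nat.eq_dec n n) => // e.
  by rewrite (Eqdep_dec.UIP_dec PeanoNat.Nat.eq_dec e erefl).
have cx m : n <= m -> x m.+1 = ren (@up m) (x m).
  move=> le_nm; rewrite {1}/x weakeningsE.
  case: (PeanoNat.Nat.eq_dec n m.+1) => // e.
  by exfalso; move: le_nm; rewrite e ltnn.
by exists (exist (coherent _) x (ex_intro _ n cx)).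
Qed.

Lemma holds_witness G s (r : env G) (q : fm (s :: G)) :
  holds (fun n => Ex (subf (ups (at_stage r n)) q)) ->
  exists x : germ s, holds (fun n => subf (at_stage (econs x r) n) q).
Proof.
move=> /(henkin (coherent_subf_ups r q)); have [k ck] := env_coherent r.
move=> /(_ k)[n [le_kn [a Ha]]]; have [x [xn cx]] := germ_through a.
exists x; apply: (@holds_from _ n n) => // [m le_nm|]; last first.
  by rewrite at_stage_econs xn -inst_subf.
apply: subf_next; rewrite !at_stage_econs cx // ck; last exact: leq_trans le_kn le_nm.
by apply: fam_ext; apply: var_case.
Qed.

Lemma truth G (p : fm G) : forall r : env G,
  @sat term_model G r p <-> holds (fun n => subf (at_stage r n) p).
Proof.
have holds_mono (P Q : forall n, fm (C n)) :
    (forall n, prv T (H n) (P n) -> prv T (H n) (Q n)) -> holds P -> holds Q.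
  by move=> PQ; apply: eventually_mono.
have holds_contra (P : forall n, fm (C n)) : holds P -> holds (fun n => Imp (P n) Bot) -> False.
  move=> hP hN; have [n [Pn Nn]] := eventually_ex (eventually_and hP hN).
  by case: (@consistent n); exact: p_impE Nn Pn.
elim: p => {G}.
- move=> G a b r /=; split; apply: eventually_mono => n; by rewrite !ev_at_stage.
- move=> G a b r /=; split; apply: eventually_mono => n; by rewrite !ev_at_stage.
- by move=> G r; split=> //= hB; have [n /consistent] := eventually_ex hB.
- move=> G p IHp q IHq r; split=> /= [[/IHp hp /IHq hq]|h].
    by apply: eventually_mono (eventually_and hp hq) => n []; apply: p_andI.
  split; [apply/IHp|apply/IHq]; apply: holds_mono h => n; [exact: p_andE1|exact: p_andE2].
- move=> G p IHp q IHq r; split=> /= [[/IHp|/IHq]|h].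
  + by apply: holds_mono => n; apply: p_orI1.
  + by apply: holds_mono => n; apply: p_orI2.
  + have [hp|hN] := holds_dec (coherent_subf r p); [by left; apply/IHp|right; apply/IHq].
    apply: eventually_mono (eventually_and h hN) => n [Ho Hn].
    apply: p_orE Ho _ (prv_head _ _ _); apply: prv_bot.
    exact: p_impE (prv_cons _ Hn) (prv_head _ _ _).
- move=> G p IHp q IHq r; split=> /= [h|h /IHp hp].
  + have [/IHp/h/IHq|] := holds_dec (coherent_subf r p).
      by apply: holds_mono => n Hq; apply: p_impI; exact: prv_cons.
    apply: holds_mono => n Hn; apply: p_impI; apply: prv_bot.
    exact: p_impE (prv_cons _ Hn) (prv_head _ _ _).
  + apply/IHq; apply: eventually_mono (eventually_and h hp) => n [].
    exact: p_impE.
- move=> G s q IH r; split=> /= [h|h x]; last first.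
    apply/IH; apply: holds_mono h => n Hn.
    by rewrite at_stage_econs -inst_subf; apply: p_allE.
  (* If the universal formula is not derivable at late stages, its negation is, and a germ
     witnessing the negated body contradicts the semantic hypothesis. *)
  have [//|hN] := holds_dec (coherent_subf r (All q)).
  have hE : holds (fun n => Ex (subf (ups (at_stage r n)) (Imp q Bot))).
    by apply: holds_mono hN => n; apply: prv_notAll.
  have [x hx] := holds_witness hE.
  by have /IH hq := h x; have [] := holds_contra _ hq hx.
- move=> G s q IH r; split=> /= [[x /IH hx]|/holds_witness[x /IH hx]]; last by exists x.
  apply: holds_mono hx => n; rewrite at_stage_econs -inst_subf; exact: p_exI.
Qed.

Lemma truth_sentence (p : sentence) : 
  @sat term_model _ (@enil _) p <-> holds (fun n => renf (@no_var (C n)) p).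
Proof.
rewrite truth; split; apply: eventually_mono => n;
  rewrite (fam0_ext (at_stage _ n) (fun t v => Var (no_var (C n) v))).
all: have -> : subf (fun t v => Var (no_var (C n) v)) p = renf (@no_var (C n)) p
  by rewrite -[RHS]subf_id subf_renf.
all: exact.
Qed.

Lemma term_model_models : models term_model T.
Proof. by move=> p Tp; apply/truth_sentence; exists 0 => n _; apply: p_ax. Qed.

Lemma term_model_hyp0 : @sat term_model _ (@enil _) hyp0.
Proof.
apply/truth_sentence; apply: (@holds_from _ 0 0) => // [k _|].
  by rewrite /fup renf_renf; congr renf; exact: fam0_ext.
rewrite (_ : renf _ hyp0 = hyp0); first exact: prv_head.
by rewrite -[RHS]renf_id; congr renf; exact: fam0_ext.
Qed.

End Completeness.

(** By reductio in the calculus: were the negation of [p] consistent with [T], the term model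
    started from that negation would satisfy [T] and refute [p]. *)
Theorem completeness (T : sentence -> Prop) (p : sentence) :
  (forall M, models M T -> sat (@enil (dom M)) p) -> proves T p.
Proof.
move=> valid; apply: p_raa; apply: contrapT => cons0.
apply: (term_model_hyp0 cons0); apply: valid; exact: term_model_models.
Qed.

(** * The extensional collapse of a model *)

Lemma ev_ren M G D (r : forall t, var D t -> dom M t) (f : renaming G D) t (a : tm G t) :
  ev r (ren f a) = ev (fun t v => r t (f t v)) a.
Proof. by elim: a => //= s u a -> b ->. Qed.

Definition extensional (M : struct) :=
  @ieq M = eq /\
  forall s t (f g : dom M (s ~> t)%ty), (forall x, ap f x = ap g x) -> f = g.

Section ExtensionalCollapse.
Variable M : struct.
Hypothesis HM : models M RCA0w.

Fixpoint exteq s : dom M s -> dom M s -> Prop :=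
  match s with
  | TN => @ieq M
  | Arr r t => fun f g => forall z, exteq (ap f z) (ap g z)
  end.

Lemma sat_eqt G (r : forall t, var G t -> dom M t) s (a b : tm G s) :
  sat r (eqt a b) = exteq (ev r a) (ev r b).
Proof.
elim: s G r a b => [|s _ t IH] G r a b //=.
by apply: eq_forall => z; rewrite IH /= !ev_ren.
Qed.

Lemma exteq_refl s (a : dom M s) : exteq a a.
Proof. by elim: s a => [|s _ t IH] a //=; exact: (HM ax_refl). Qed.

Lemma exteq_sym s (a b : dom M s) : exteq a b -> exteq b a.
Proof.
elim: s a b => [|s _ t IH] a b /=; first exact: (HM ax_sym).
by move=> h z; apply: IH.
Qed.

Lemma exteq_trans s (a b c : dom M s) : exteq a b -> exteq b c -> exteq a c.
Proof.
elim: s a b c => [|s _ t IH] a b c /=; first exact: (HM ax_trans).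
by move=> h k z; apply: IH (h z) (k z).
Qed.

Lemma exteq_ap s t (f g : dom M (s ~> t)%ty) a b :
  exteq f g -> exteq a b -> exteq (ap f a) (ap g b).
Proof.
move=> fg ab; apply: exteq_trans (fg b).
by have /= /(_ f a b) := HM (ax_ext s t); rewrite !sat_eqt; apply.
Qed.

Lemma exteq_predE s (a b : dom M s) : exteq a b -> exteq a = exteq b.
Proof.
move=> ab; apply: funext => c; apply: propext.
by split; apply: exteq_trans => //; apply: exteq_sym.
Qed.

(** The choice is made from the predicate [exteq a]. Extensionally equal elements have the same
    predicate, hence, by proof irrelevance, the same representative; the quotient is then the
    subtype of representatives. *)
Definition rep s (a : dom M s) : dom M s := sval (cid (ex_intro (exteq a) a (exteq_refl a))).

Lemma repP s (a : dom M s) : exteq a (rep a).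
Proof. exact: svalP (cid _). Qed.

Lemma rep_eq s (a b : dom M s) : exteq a b -> rep a = rep b.
Proof.
have cid_eq (P Q : dom M s -> Prop) hP hQ : P = Q -> sval (@cid _ P hP) = sval (@cid _ Q hQ).
  by move=> e; case: _ / e hQ => hQ; rewrite (Prop_irrelevance hP hQ).
by move=> /exteq_predE; apply: cid_eq.
Qed.

Lemma rep_rep s (a : dom M s) : rep (rep a) = rep a.
Proof. by apply: rep_eq; apply: exteq_sym; exact: repP. Qed.

Definition quot s := {a : dom M s | rep a = a}.
Definition proj s (a : dom M s) : quot s := exist _ (rep a) (rep_rep a).

Lemma proj_eq s (a b : dom M s) : proj a = proj b <-> exteq a b.
Proof.
split=> [/(congr1 sval)/= e|/rep_eq e].
  by apply: exteq_trans (repP a) _; rewrite e; apply: exteq_sym; exact: repP.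
exact: eq_exist.
Qed.

Lemma projK s (x : quot s) : proj (sval x) = x.
Proof. by case: x => a e; apply: eq_exist. Qed.

Lemma sval_proj s (a : dom M s) : exteq (sval (proj a)) a.
Proof. by apply: exteq_sym; exact: repP. Qed.

Definition collapse : struct := @Struct quot
  (fun s t f x => proj (ap (sval f) (sval x)))
  (proj (i0 M)) (proj (i1 M)) (proj (iplus M)) (proj (itimes M))
  (fun s t => proj (iPi M s t)) (fun r s t => proj (iSigma M r s t)) (proj (iRec M))
  eq (fun x y => ilt (sval x) (sval y)).

Lemma proj_ap s t (f : dom M (s ~> t)%ty) a :
  proj (ap f a) = ap (M := collapse) (proj f) (proj a).
Proof. by apply/proj_eq; apply: exteq_ap; apply: exteq_sym; exact: sval_proj. Qed.

Lemma ev_proj G (r : forall t, var G t -> dom M t) t (a : tm G t) :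
  @ev collapse G (fun t v => proj (r t v)) t a = proj (ev r a).
Proof. by elim: a => //= s u a -> b ->; rewrite [RHS]proj_ap. Qed.

Lemma sat_collapse G (p : fm G) : forall r : (forall t, var G t -> dom M t),
  @sat collapse G (fun t v => proj (r t v)) p <-> sat r p.
Proof.
have econs_proj G' s (x : dom M s) (r : forall t, var G' t -> dom M t) :
    econs (proj x) (fun t v => proj (r t v)) = fun t v => proj (econs x r v).
  by apply: fam_ext; apply: var_case.
elim: p => {G} /=.
- by move=> G a b r; rewrite !ev_proj; exact: proj_eq.
- move=> G a b r; rewrite !ev_proj /=.
  have lt_compat a1 b1 a2 b2 : exteq a1 a2 -> exteq b1 b2 -> ilt a1 b1 -> ilt a2 b2.
    exact: (HM ax_lt_eq).
  by split; apply: lt_compat; try exact: sval_proj; apply: exteq_sym; exact: sval_proj.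
- by [].
- by move=> G p IHp q IHq r; rewrite IHp IHq.
- by move=> G p IHp q IHq r; rewrite IHp IHq.
- by move=> G p IHp q IHq r; rewrite IHp IHq.
- move=> G s p IH r; split=> h x.
    by apply/IH; rewrite -econs_proj; apply: h.
  by rewrite -(projK x) econs_proj; apply/IH.
- move=> G s p IH r; split=> [[x]|[x h]].
    by rewrite -(projK x) econs_proj => /IH; exists (sval x).
  by exists (proj x); rewrite econs_proj; apply/IH.
Qed.

Lemma sat_collapse0 (p : sentence) : @sat collapse _ (@enil _) p <-> @sat M _ (@enil _) p.
Proof. by rewrite -sat_collapse (fam0_ext (@enil (dom collapse)) (fun t v => proj (enil _ v))). Qed.

Lemma collapse_extensional : extensional collapse.
Proof.
split=> // s t f g fg; rewrite -(projK f) -(projK g); apply/proj_eq => z /=.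
by apply/proj_eq; rewrite !proj_ap !projK.
Qed.

End ExtensionalCollapse.

Theorem extensional_completeness (T : sentence -> Prop) (p : sentence) :
  (forall q, RCA0w q -> T q) ->
  (forall M, models M T -> extensional M -> sat (@enil (dom M)) p) -> proves T p.
Proof.
move=> RT valid; apply: completeness => M MT.
have MR : models M RCA0w by move=> q /RT/MT.
apply/(sat_collapse0 MR); apply: valid; last exact: collapse_extensional.
by move=> q /MT h; apply/(sat_collapse0 MR).
Qed.

(** * Fractions of an ordered semiring *)

Section OrderedFractions.
Local Open Scope ring_scope.
Local Open Scope quotient_scope.

(** The nonnegative part of an ordered domain, with the order made algebraic: x is below y when y =
    x + d. In this reading [cone_pointed] is antisymmetry and [cone_total] is comparability. *)
Record cone := Cone {
  cone_semiring :> comNzSemiRingType;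
  cone_cancel : forall x y z : cone_semiring, x + z = y + z -> x = y;
  cone_pointed : forall x y : cone_semiring, x + y = 0 -> x = 0;
  cone_integral : forall x y : cone_semiring, x * y = 0 -> x = 0 \/ y = 0;
  cone_total : forall x y : cone_semiring, exists d, y = x + d \/ x = y + d }.

Variable R : cone.

Definition diff_equiv (p q : R * R) : bool := p.1 + q.2 == q.1 + p.2.

Lemma diff_equiv_is_equiv : equiv_class_of diff_equiv.
Proof.
split=> [x|x y|y x z]; rewrite /diff_equiv.
- exact: eqxx.
- exact: eq_sym.
move=> /eqP xy /eqP yz; apply/eqP; apply: (@cone_cancel _ _ _ y.2).
have -> : x.1 + z.2 + y.2 = (x.1 + y.2) + z.2 by ring.
rewrite xy; have -> : y.1 + x.2 + z.2 = (y.1 + z.2) + x.2 by ring.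
by rewrite yz; ring.
Qed.

Canonical diff_equiv_equiv := EquivRelPack diff_equiv_is_equiv.
Canonical diff_equiv_direct := defaultEncModRel diff_equiv.

Definition diff := {eq_quot diff_equiv}.
HB.instance Definition _ : EqQuotient _ diff_equiv diff := EqQuotient.on diff.
HB.instance Definition _ := Choice.on diff.

Definition mkdiff (a b : R) : diff := \pi_diff (a, b).

Lemma mkdiffP a b c d : mkdiff a b = mkdiff c d <-> a + d = c + b.
Proof.
rewrite /mkdiff; split.
  by move/eqmodP => /eqP.
by move=> e; apply/eqmodP; rewrite /= /diff_equiv /= e.
Qed.

Lemma diffW (P : diff -> Prop) : (forall a b, P (mkdiff a b)) -> forall x, P x.
Proof. by move=> h x; rewrite -[x]reprK; case: (repr x) => a b; apply: h. Qed.

Lemma repr_mkdiff a b : a + (repr (mkdiff a b)).2 = (repr (mkdiff a b)).1 + b.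
Proof. by apply/mkdiffP; rewrite /mkdiff -[LHS]reprK; case: (repr _). Qed.

Definition addd (x y : diff) := mkdiff ((repr x).1 + (repr y).1) ((repr x).2 + (repr y).2).
Definition muld (x y : diff) :=
  mkdiff ((repr x).1 * (repr y).1 + (repr x).2 * (repr y).2)
         ((repr x).1 * (repr y).2 + (repr x).2 * (repr y).1).
Definition oppd (x : diff) := mkdiff (repr x).2 (repr x).1.

Lemma adddE a b c d : addd (mkdiff a b) (mkdiff c d) = mkdiff (a + c) (b + d).
Proof.
apply/mkdiffP; have := repr_mkdiff a b; have := repr_mkdiff c d.
case: (repr (mkdiff a b)) (repr (mkdiff c d)) => a' b' [c' d'] /= e1 e2.
have -> : a' + c' + (b + d) = (a' + b) + (c' + d) by ring.
by rewrite -e1 -e2; ring.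
Qed.

Lemma oppdE a b : oppd (mkdiff a b) = mkdiff b a.
Proof.
apply/mkdiffP; have := repr_mkdiff a b; case: (repr _) => a' b' /= e.
by rewrite addrC e addrC.
Qed.

Lemma muldE a b c d : muld (mkdiff a b) (mkdiff c d) = mkdiff (a * c + b * d) (a * d + b * c).
Proof.
apply/mkdiffP; have := repr_mkdiff a b; have := repr_mkdiff c d.
case: (repr (mkdiff a b)) (repr (mkdiff c d)) => a' b' [c' d'] /= e1 e2.
(* In place of subtraction, mixed products are added on both sides so that the two equivalences can
   be substituted. *)
apply: (@cone_cancel _ _ _ (b' * c + b' * d)).
have -> : a' * c' + b' * d' + (a * d + b * c) + (b' * c + b' * d) =
  a' * c' + b' * (c + d') + (a + b') * d + b * c by ring.
rewrite e1 e2.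
have -> : a' * c' + b' * (c' + d) + (a' + b) * d + b * c =
  a' * (c' + d) + b' * (c' + d) + b * c + b * d by ring.
rewrite -e1.
have -> : a' * (c + d') + b' * (c + d') + b * c + b * d =
  (a' + b) * c + a' * d' + b' * (c + d') + b * d by ring.
by rewrite -e2 e1; ring.
Qed.

Lemma adddA : associative addd.
Proof. by do 3!elim/diffW => ? ?; rewrite !adddE !addrA. Qed.
Lemma adddC : commutative addd.
Proof. by do 2!elim/diffW => ? ?; rewrite !adddE; congr mkdiff; rewrite addrC. Qed.
Lemma add0d : left_id (mkdiff 0 0) addd.
Proof. by elim/diffW => ? ?; rewrite !adddE !add0r. Qed.
Lemma addNd : left_inverse (mkdiff 0 0) oppd addd.
Proof. by elim/diffW => a b; rewrite oppdE adddE; apply/mkdiffP; rewrite addr0 add0r addrC. Qed.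

HB.instance Definition _ := GRing.isZmodule.Build diff adddA adddC add0d addNd.

Lemma muldA : associative muld.
Proof. by do 3!elim/diffW => ? ?; rewrite !muldE; congr mkdiff; ring. Qed.
Lemma muldC : commutative muld.
Proof. by do 2!elim/diffW => ? ?; rewrite !muldE; congr mkdiff; ring. Qed.
Lemma mul1d : left_id (mkdiff 1 0) muld.
Proof. by elim/diffW => ? ?; rewrite !muldE; congr mkdiff; ring. Qed.
Lemma muldDl : left_distributive muld addd.
Proof.
move=> x y z; elim/diffW: x => ? ?; elim/diffW: y => ? ?; elim/diffW: z => ? ?.
by rewrite adddE !muldE adddE; congr mkdiff; ring.
Qed.
Lemma oned_neq0 : mkdiff 1 0 != mkdiff 0 0.
Proof. by apply/eqP => /mkdiffP; rewrite addr0 => /eqP; rewrite addr0 oner_eq0. Qed.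

HB.instance Definition _ :=
  GRing.Zmodule_isComNzRing.Build diff muldA muldC mul1d muldDl oned_neq0.

(** The fraction field is formed over an integral domain whose interface includes inverses of units;
    classical choice provides them. *)
Definition unitd (x : diff) : bool := `[< exists y, y * x = 1 >].
Definition invd (x : diff) : diff :=
  if pselect (exists y, y * x = 1) is left h then sval (cid h) else x.

Lemma mulVd : {in unitd, left_inverse 1 invd *%R}.
Proof.
move=> x /asboolP h; rewrite /invd; case: pselect => // h'.
exact: svalP (cid h').
Qed.
Lemma unitdP (x y : diff) : y * x = 1 -> unitd x.
Proof. by move=> e; apply/asboolP; exists y. Qed.
Lemma invd_out : {in [predC unitd], invd =1 id}.
Proof. by move=> x /asboolP h; rewrite /invd; case: pselect. Qed.

HB.instance Definition _ := GRing.ComNzRing_hasMulInverse.Build diff mulVd unitdP invd_out.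

Definition dnat (a : R) : diff := mkdiff a 0.

Lemma dnatD a b : dnat (a + b) = dnat a + dnat b.
Proof. by rewrite /dnat [RHS]adddE addr0. Qed.
Lemma dnatM a b : dnat (a * b) = dnat a * dnat b.
Proof. by rewrite /dnat [RHS]muldE !mulr0 !mul0r !addr0. Qed.
Lemma dnat_inj : injective dnat.
Proof. by move=> a b /mkdiffP; rewrite !addr0. Qed.

Lemma diff_sign (x : diff) : exists a, x = dnat a \/ x = - dnat a.
Proof.
elim/diffW: x => a b; have [d [->|->]] := cone_total a b; exists d; [right|left].
  by rewrite [RHS]oppdE; apply/mkdiffP; ring.
by apply/mkdiffP; ring.
Qed.

Lemma diff_integral (x y : diff) : x * y = 0 -> (x == 0) || (y == 0).
Proof.
have main a b : dnat a * dnat b = 0 -> (dnat a == 0) || (dnat b == 0).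
  rewrite -dnatM => /dnat_inj/cone_integral[->|->]; apply/orP; [left|right]; exact/eqP.
have [a [->|->]] := diff_sign x; have [b [->|->]] := diff_sign y;
  rewrite ?mulNr ?mulrN ?opprK ?oppr_eq0 => /eqP; rewrite ?oppr_eq0 => /eqP; exact: main.
Qed.

HB.instance Definition _ := GRing.ComUnitRing_isIntegral.Build diff diff_integral.

Definition ofrac := {fraction diff}.
HB.instance Definition _ := GRing.Field.on ofrac.

Definition emb (a : R) : ofrac := tofrac (dnat a).

Lemma embD a b : emb (a + b) = emb a + emb b.
Proof. by rewrite /emb dnatD tofracD. Qed.
Lemma embM a b : emb (a * b) = emb a * emb b.
Proof. by rewrite /emb dnatM tofracM. Qed.
Lemma emb0 : emb 0 = 0.
Proof. exact: tofrac0. Qed.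
Lemma emb1 : emb 1 = 1.
Proof. exact: tofrac1. Qed.
Lemma emb_inj : injective emb.
Proof. by move=> a b /eqP; rewrite tofrac_eq => /eqP/dnat_inj. Qed.
Lemma emb_eq0 a : (emb a == 0) = (a == 0).
Proof. by rewrite -emb0 (inj_eq emb_inj). Qed.

Lemma fracP (K : idomainType) (x : {fraction K}) :
  exists n d : K, d != 0 /\ x = tofrac n / tofrac d.
Proof.
elim/quotW: x => r; exists (\n_r)%qT, (\d_r)%qT; have dr := denom_ratioP r.
split=> //; apply: (canRL (mulfK _)); first by rewrite tofrac_eq0.
rewrite !piE /FracField.mulf; apply/eqmodP.
rewrite /= FracField.equivfE !numden_Ratio ?mulr1 ?oner_neq0 //.
by rewrite mulrC.
Qed.

Lemma ofrac_sign (x : ofrac) :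
  exists a b : R, b != 0 /\ (x = emb a / emb b \/ x = - (emb a / emb b)).
Proof.
have [n [d [d0 ->]]] := fracP x.
have embN (z : diff) : exists a, tofrac z = emb a \/ tofrac z = - emb a.
  have [a [->|->]] := diff_sign z; exists a; [by left|right].
  by rewrite tofracN.
have [a na] := embN n; have [b db] := embN d; exists a, b.
have b0 : b != 0.
  apply: contra_neq d0 => b0; apply/eqP; rewrite -tofrac_eq0.
  by case: db => ->; rewrite b0 emb0 ?oppr0.
split=> //; case: na db => -> [] ->; rewrite ?invrN ?mulNr ?mulrN ?opprK; auto.
Qed.

Definition nonneg (x : ofrac) := exists a b : R, b != 0 /\ x = emb a / emb b.

Definition leof (x y : ofrac) : bool := `[< nonneg (y - x) >].
Definition ltof (x y : ofrac) : bool := (y != x) && leof x y.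
Definition normof (x : ofrac) : ofrac := if leof 0 x then x else - x.

Lemma leof0P x : reflect (nonneg x) (leof 0 x).
Proof. by rewrite /leof subr0; exact: asboolP. Qed.

Lemma cone_mul_neq0 (a b : R) : a != 0 -> b != 0 -> a * b != 0.
Proof. by move=> a0 b0; apply/eqP => /cone_integral[] /eqP; apply/negP. Qed.

Lemma leof0D x y : leof 0 x -> leof 0 y -> leof 0 (x + y).
Proof.
move=> /leof0P[a [b [b0 ->]]] /leof0P[c [d [d0 ->]]]; apply/leof0P.
exists (a * d + c * b), (b * d); split; first exact: cone_mul_neq0.
by rewrite addf_div ?emb_eq0 // embD !embM.
Qed.

Lemma leof0M x y : leof 0 x -> leof 0 y -> leof 0 (x * y).
Proof.
move=> /leof0P[a [b [b0 ->]]] /leof0P[c [d [d0 ->]]]; apply/leof0P.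
exists (a * c), (b * d); split; first exact: cone_mul_neq0.
by rewrite mulf_div !embM.
Qed.

Lemma leof0_anti x : leof 0 x -> leof x 0 -> x = 0.
Proof.
move=> /leof0P[a [b [b0 ->]]] /asboolP; rewrite sub0r => -[c [d [d0 e]]].
have /eqP : emb a / emb b + emb c / emb d = 0 by rewrite -e subrr.
rewrite addf_div ?emb_eq0 // mulf_eq0 invr_eq0 -!embM -embD !emb_eq0.
rewrite (negbTE (cone_mul_neq0 b0 d0)) orbF => /eqP/cone_pointed/cone_integral[->|/eqP].
  by rewrite emb0 mul0r.
by rewrite (negbTE d0).
Qed.

Lemma leof0_sub x y : leof 0 (y - x) = leof x y.
Proof. by rewrite /leof subr0. Qed.

Lemma leof_total x : leof 0 x || leof x 0.
Proof.
have [a [b [b0 h]]] := ofrac_sign x.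
apply/orP; rewrite -(leof0_sub x) sub0r.
by case: h => ->; [left|right]; apply/leof0P; exists a, b; rewrite ?opprK.
Qed.

Lemma normofN x : normof (- x) = normof x.
Proof.
have e : leof 0 (- x) = leof x 0 by rewrite -(leof0_sub x) sub0r.
rewrite /normof e opprK; have := leof_total x.
case h1: (leof 0 x); case h2: (leof x 0) => // _.
by rewrite (leof0_anti h1 h2) oppr0.
Qed.

Lemma normof_ge0 x : leof 0 x -> normof x = x.
Proof. by rewrite /normof => ->. Qed.

Lemma ltof_def x y : ltof x y = (y != x) && leof x y.
Proof. by []. Qed.

HB.instance Definition _ := Num.IntegralDomain_isLeReal.Build ofrac
  leof0D leof0M leof0_anti leof0_sub leof_total normofN normof_ge0 ltof_def.

Lemma emb_le (a b : R) : (emb a <= emb b)%R <-> exists d, b = a + d.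
Proof.
split=> [|[d ->]]; last first.
  apply/asboolP; exists d, 1; rewrite oner_neq0; split=> //.
  by rewrite embD emb1 divr1 addrC addKr.
have [d [->|->]] := cone_total a b; first by exists d.
move=> h; exists 0; rewrite addr0; apply: emb_inj; apply/eqP.
rewrite eq_le h andbT; apply/asboolP; exists d, 1; rewrite oner_neq0; split=> //.
by rewrite embD emb1 divr1 addrC addKr.
Qed.

End OrderedFractions.

(** * Arithmetic in an extensional model *)

Record emodel := EModel {
  em_struct :> struct;
  em_RCA : models em_struct RCA0w;
  em_ext : extensional em_struct }.

Lemma ieqE (M : emodel) (x y : dom M TN) : ieq x y = (x = y).
Proof. by case: (em_ext M) => ->. Qed.

Lemma ap_ext (M : emodel) s t (f g : dom M (s ~> t)%ty) : (forall x, ap f x = ap g x) -> f = g.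
Proof. by case: (em_ext M) => _; apply. Qed.

Lemma sat_eqtE (M : emodel) G (r : forall t, var G t -> dom M t) s (a b : tm G s) :
  sat r (eqt a b) = (ev r a = ev r b).
Proof.
rewrite sat_eqt; apply: propext; split=> [|->]; last exact: (exteq_refl (@em_RCA M)).
move: (ev r a) (ev r b) => {a b}; elim: s => [|s _ t IH] x y /=; first by rewrite ieqE.
by move=> h; apply: ap_ext => z; apply: IH.
Qed.

(** * Evaluation of terms and formulas in an extensional model *)

Section Combinators.
Variable M : emodel.

Lemma ap_Pi s t (x : dom M s) (y : dom M t) : ap (ap (iPi M s t) x) y = x.
Proof. by have /= /(_ x y) := @em_RCA M _ (ax_Pi s t); rewrite sat_eqtE. Qed.

Lemma ap_Sigma r s t (x : dom M (r ~> s ~> t)%ty) y z :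
  ap (ap (ap (iSigma M r s t) x) y) z = ap (ap x z) (ap y z).
Proof. by have /= /(_ x y z) := @em_RCA M _ (ax_Sigma r s t); rewrite sat_eqtE. Qed.

Lemma ev_lambda G (r : forall t, var G t -> dom M t) s t (a : tm (s :: G) t) x :
  ap (ev r (lambda a)) x = ev (econs x r) a.
Proof.
elim: a => {t} /=; try by move=> *; rewrite ap_Pi.
  move=> t v; move: t v; apply: var_case => [|t v] /=.
    by rewrite ap_Sigma ap_Pi.
  by rewrite ap_Pi.
by move=> u t a ea b eb; rewrite ap_Sigma ea eb.
Qed.

Lemma ev_lam G (r : forall t, var G t -> dom M t) s t (a : tm (s :: G) s -> tm (s :: G) t) x :
  ap (ev r (lamx a)) x = ev (econs x r) (a (Var vz)).
Proof. exact: ev_lambda. Qed.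

Lemma ev_lift0 G (r : forall t, var G t -> dom M t) t (a : tm G t) :
  ev r (lift (@ext_refl G) a) = ev r a.
Proof. by rewrite /lift ev_ren. Qed.

Lemma ev_liftS G D s (r : forall t, var D t -> dom M t) (e : Ext G D) x t (a : tm G t) :
  ev (econs (s := s) x r) (lift (@ext_step G D s e) a) = ev r (lift e a).
Proof. by rewrite /lift !ev_ren. Qed.

Lemma ev_sub G D (r : forall t, var D t -> dom M t) (f : substitution G D) t (a : tm G t) :
  ev r (sub f a) = ev (fun t v => ev r (f t v)) a.
Proof. by elim: a => //= s u a -> b ->. Qed.

Lemma sat_subf G (p : fm G) : forall D (r : forall t, var D t -> dom M t) (f : substitution G D),
  sat r (subf f p) = sat (fun t v => ev r (f t v)) p.
Proof.
have ups_ev G' D s (x : dom M s) (r : forall t, var D t -> dom M t) (f : substitution G' D) :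
    (fun t v => ev (econs x r) (ups f v)) = econs x (fun t v => ev r (f t v)).
  by apply: fam_ext; apply: var_case => //= t v; rewrite ev_ren.
elim: p => //= {G}.
- by move=> G a b D r f; rewrite !ev_sub.
- by move=> G a b D r f; rewrite !ev_sub.
- by move=> G a ea b eb D r f; rewrite ea eb.
- by move=> G a ea b eb D r f; rewrite ea eb.
- by move=> G a ea b eb D r f; rewrite ea eb.
- by move=> G s q IH D r f; apply: eq_forall => x; rewrite IH ups_ev.
- by move=> G s q IH D r f; apply: eq_exists => x; rewrite IH ups_ev.
Qed.

Lemma sat_closure G (p : fm G) : sat (@enil (dom M)) (closure p) -> forall r, sat (M := M) r p.
Proof.
elim: G p => [|s G IH] p /= h r; first by rewrite (fam0_ext r (@enil _)).
have /= := IH (All p) h (fun t v => r t (vs v)) => /(_ (r s vz)).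
by congr sat; apply: fam_ext; apply: var_case.
Qed.

Lemma qf_choice G (A : fm (TN :: T1 :: G)) (r : forall t, var G t -> dom M t) :
  qf A = true -> (forall x, exists n, sat (econs n (econs x r)) A) ->
  exists Y : dom M T2, forall x, sat (econs (ap Y x) (econs x r)) A.
Proof.
move=> qA h; have /sat_closure/(_ r) /= := @em_RCA M _ (ax_qfac qA).
case=> // Y hY; exists Y => x; have := hY x; rewrite sat_subf.
by congr sat; apply: fam_ext; apply: var_case => //=; apply: var_case.
Qed.

End Combinators.

Definition num (M : emodel) : Type := dom M TN.
HB.instance Definition _ M := gen_eqMixin (num M).
HB.instance Definition _ M := gen_choiceMixin (num M).

Section Macros.
Variable M : emodel.
Local Notation N := (num M).

(** Each macro is evaluated once, at variables of a small fixed context; evaluation in any other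
    context then agrees with it by conversion. *)
Definition pred_ (n : N) : N := ev (econs n (@enil _)) (predec (Var vz)).
Definition monus_ (x y : N) : N :=
  ev (econs x (econs y (@enil _))) (monus (Var vz) (Var (vs vz))).
Definition exp2_ (n : N) : N := ev (econs n (@enil _)) (exp2 (Var vz)).
Definition isqrt_ (n : N) : N := ev (econs n (@enil _)) (isqrt (Var vz)).

Variables (G : ctx) (r : forall t, var G t -> dom M t).
Implicit Types a b : tm G TN.
Lemma ev_predec a : ev r (predec a) = pred_ (ev r a).
Proof. by []. Qed.
Lemma ev_monus a b : ev r (monus a b) = monus_ (ev r a) (ev r b).
Proof. by []. Qed.
Lemma ev_exp2 a : ev r (exp2 a) = exp2_ (ev r a).
Proof. by []. Qed.
Lemma ev_isqrt a : ev r (isqrt a) = isqrt_ (ev r a).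
Proof. by []. Qed.
End Macros.

(* From here on [lam] is only evaluated through [ev_lam]. *)
Opaque lamx.

Section Arithmetic.
Variable M : emodel.

Definition addn_ (x y : num M) : num M := ap (ap (iplus M) x) y.
Definition muln_ (x y : num M) : num M := ap (ap (itimes M) x) y.

Let axE (p : sentence) (h : RCA0w p) := @em_RCA M _ h.

Lemma addnA_ : associative addn_.
Proof. by move=> x y z; have /= /(_ x y z) := axE ax_addA; rewrite ieqE. Qed.
Lemma addnC_ : commutative addn_.
Proof. by move=> x y; have /= /(_ x y) := axE ax_addC; rewrite ieqE. Qed.
Lemma add0n_ : left_id (i0 M) addn_.
Proof. by move=> x; rewrite addnC_; have /= /(_ x) := axE ax_add0; rewrite ieqE. Qed.
HB.instance Definition _ := GRing.isNmodule.Build (num M) addnA_ addnC_ add0n_.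

Lemma mulnA_ : associative muln_.
Proof. by move=> x y z; have /= /(_ x y z) := axE ax_mulA; rewrite ieqE. Qed.
Lemma mulnC_ : commutative muln_.
Proof. by move=> x y; have /= /(_ x y) := axE ax_mulC; rewrite ieqE. Qed.
Lemma mul1n_ : left_id (i1 M) muln_.
Proof. by move=> x; rewrite mulnC_; have /= /(_ x) := axE ax_mul1; rewrite ieqE. Qed.
Lemma mulnDl_ : left_distributive muln_ addn_.
Proof.
by move=> x y z; have /= /(_ z x y) := axE ax_mulD; rewrite ieqE ![muln_ _ z]mulnC_.
Qed.
Lemma mul0n_ : left_zero (i0 M) muln_.
Proof. by move=> x; rewrite mulnC_; have /= /(_ x) := axE ax_mul0; rewrite ieqE. Qed.
Lemma onen_neq0 : i1 M != i0 M :> num M.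
Proof.
apply/eqP => e; have /= := axE ax_lt01; have /= := axE ax_lt_irrefl.
by move=> /(_ (i0 M)); rewrite e.
Qed.
HB.instance Definition _ :=
  GRing.Nmodule_isComNzSemiRing.Build (num M) mulnA_ mulnC_ mul1n_ mulnDl_ mul0n_ onen_neq0.

Lemma num_ind_fm G (A : fm (TN :: G)) (r : forall t, var G t -> dom M t) :
  qf A = true -> sat (econs (0%R : num M) r) A ->
  (forall n : num M, sat (econs n r) A -> sat (econs (n + 1)%R r) A) ->
  forall n : num M, sat (econs n r) A.
Proof.
move=> qA h0 hS; have /sat_closure/(_ r) /= := axE (ax_ind qA); apply; split.
  by rewrite /inst sat_subf; congr sat: h0; apply: fam_ext; apply: var_case.
move=> n /hS; rewrite sat_subf; congr sat.
by apply: fam_ext; apply: var_case.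
Qed.

(** The form in which the induction schema is used throughout: a predicate on the numbers of the
    model is inductive only once a quantifier-free formula [A], with parameters [r], has been shown
    to express it. *)
Lemma num_ind (P : num M -> Prop) G (A : fm (TN :: G)) (r : forall t, var G t -> dom M t) :
  qf A = true -> (forall n, sat (econs n r) A = P n) ->
  P 0%R -> (forall n, P n -> P (n + 1)%R) -> forall n, P n.
Proof.
move=> qA satA P0 PS n; rewrite -satA; apply: num_ind_fm => //.
  by rewrite satA.
by move=> m; rewrite !satA; apply: PS.
Qed.

Local Open Scope ring_scope.
Local Notation N := (num M).
Definition ltnum (x y : N) : Prop := ilt x y.
Local Notation "x <N y" := (ltnum x y) (at level 70).

Lemma ilt_irr (x : N) : ~ x <N x.
Proof. exact: (axE ax_lt_irrefl). Qed.
Lemma ilt_trans (y x z : N) : x <N y -> y <N z -> x <N z.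
Proof. exact: (axE ax_lt_trans). Qed.
Lemma ilt_total (x y : N) : x <N y \/ x = y \/ y <N x.
Proof. by have /= /(_ x y) := axE ax_lt_total; rewrite ieqE. Qed.
Lemma ilt_add (x y z : N) : x <N y -> x + z <N y + z.
Proof. exact: (axE ax_lt_add). Qed.
Lemma ilt_mul (x y z : N) : x <N y -> 0 <N z -> x * z <N y * z.
Proof. exact: (axE ax_lt_mul). Qed.
Lemma ilt01 : (0 : N) <N (1 : N).
Proof. exact: (axE ax_lt01). Qed.

Lemma ltS (x : N) : x <N x + 1.
Proof. by rewrite -[X in X <N _]add0r [x + 1]addrC; apply: ilt_add; exact: ilt01. Qed.

Lemma num_gt0 (n : N) : 0 = n \/ 0 <N n.
Proof.
apply: (@num_ind (fun n => 0 = n \/ 0 <N n) [::]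
  (Or (Eq Zero (Var vz)) (Lt Zero (Var vz))) (@enil _) erefl) n => [n||n].
- by rewrite /= ieqE.
- by left.
- by case=> [<-|n0]; right; [rewrite add0r; exact: ilt01|exact: ilt_trans n0 (ltS n)].
Qed.

Lemma num_lt0 (n : N) : ~ n <N 0.
Proof.
case: (num_gt0 n) => [<-|n0 /(ilt_trans n0)]; exact: ilt_irr.
Qed.

Lemma num_cancel (x y z : N) : x + z = y + z -> x = y.
Proof.
move=> e; have [|[//|]] := ilt_total x y => /(ilt_add z); rewrite e => /ilt_irr [].
Qed.

Lemma rec0 f (m : N) : ap (ap (ap (iRec M) f) m) (0 : N) = m.
Proof. by have /= /(_ f m) := axE ax_Rec0; rewrite ieqE. Qed.
Lemma recS f (m n : N) :
  ap (ap (ap (iRec M) f) m) (n + 1) = ap (ap f n) (ap (ap (ap (iRec M) f) m) n).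
Proof. by have /= /(_ f m n) := axE ax_RecS; rewrite ieqE. Qed.

Lemma pred0 : pred_ (0 : N) = 0.
Proof. exact: rec0. Qed.
Lemma predS (n : N) : pred_ (n + 1) = n.
Proof. by rewrite /pred_ /predec /= recS !ev_lam. Qed.
Lemma monus0 (x : N) : monus_ x 0 = x.
Proof. exact: rec0. Qed.
Lemma monusS (x y : N) : monus_ x (y + 1) = pred_ (monus_ x y).
Proof. by rewrite /monus_ /monus /= recS !ev_lam ev_predec. Qed.
Lemma exp2_0 : exp2_ (0 : N) = 1.
Proof. exact: rec0. Qed.
Lemma exp2S (n : N) : exp2_ (n + 1) = exp2_ n + exp2_ n.
Proof. by rewrite /exp2_ /exp2 /= recS !ev_lam. Qed.
Lemma isqrt0 : isqrt_ (0 : N) = 0.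
Proof. exact: rec0. Qed.
Lemma isqrtS (n : N) : isqrt_ (n + 1) =
  isqrt_ n + monus_ 1 (monus_ ((isqrt_ n + 1) * (isqrt_ n + 1)) (n + 1)).
Proof. by rewrite /isqrt_ /isqrt /= recS !ev_lam; cbn [ev econs lift ren]; rewrite !ev_monus. Qed.

Opaque predec monus exp2 isqrt.

Lemma pred_eq (n : N) : 0 = n \/ n = pred_ n + 1.
Proof.
apply: (@num_ind (fun n => 0 = n \/ n = pred_ n + 1) [::]
  (Or (Eq Zero (Var vz)) (Eq (Var vz) (predec (Var vz) + One)%fm)) (@enil _) erefl) n => [n||n _].
- by rewrite /= !ieqE ev_predec.
- by left.
- by right; rewrite predS.
Qed.

(** Truncated subtraction supplies the differences that make the order algebraic, as [cone_total]
    demands. Both implications are kept in one formula so that the induction stays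
    quantifier-free. *)
Lemma monus_spec (x y : N) :
  (y <N x -> monus_ y x = 0) /\ (~ y <N x -> y = x + monus_ y x).
Proof.
apply: (@num_ind (fun x => (y <N x -> monus_ y x = 0) /\ (~ y <N x -> y = x + monus_ y x))
  [:: TN] (And
    (Imp (Lt (Var (vs vz)) (Var vz)) (Eq (monus (Var (vs vz)) (Var vz)) Zero))
    (Imp (Imp (Lt (Var (vs vz)) (Var vz)) Bot)
       (Eq (Var (vs vz)) (Var vz + monus (Var (vs vz)) (Var vz))%fm)))
  (econs y (@enil _)) erefl) x => [x||n [h1 h2]].
- by rewrite /= !ieqE ev_monus.
- by split=> [/num_lt0 //|_]; rewrite add0r monus0.
rewrite monusS.
have [lt_yn|nlt_yn] := pselect (y <N n).
  rewrite h1 // pred0; split=> // -[]; exact: ilt_trans lt_yn (ltS n).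
have yE := h2 nlt_yn; have [m0|mE] := pred_eq (monus_ y n).
  rewrite -m0 pred0; split=> // -[]; rewrite yE -m0 addr0; exact: ltS.
split=> [lt|_]; last by rewrite {1}yE {1}mE; ring.
have [//|p0] := num_gt0 (pred_ (monus_ y n)).
case: (ilt_irr (x := y)); apply: ilt_trans lt _; rewrite {1}yE {1}mE.
have -> : n + (pred_ (monus_ y n) + 1) = pred_ (monus_ y n) + (n + 1) by ring.
by rewrite -[X in X <N _]add0r; apply: ilt_add.
Qed.

Lemma num_mul_eq0 (x y : N) : x * y = 0 -> x = 0 \/ y = 0.
Proof.
have [<-|x0] := num_gt0 x; first by left.
have [<-|y0] := num_gt0 y; first by right.
by move=> e; have := ilt_mul x0 y0; rewrite e mul0r => /ilt_irr.
Qed.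

Lemma num_add_eq0 (x y : N) : x + y = 0 -> x = 0.
Proof.
have [<- //|x0] := num_gt0 x => e; have := ilt_add y x0; rewrite e => /num_lt0 [].
Qed.

Lemma num_total (x y : N) : exists d, y = x + d \/ x = y + d.
Proof.
have [yx|] := pselect (y <N x); last by move/(proj2 (monus_spec x y)); eexists; left; eauto.
exists (monus_ x y); right; apply: (proj2 (monus_spec y x)).
by move/(ilt_trans yx)/ilt_irr.
Qed.

Definition num_cone : cone :=
  @Cone (num M) num_cancel num_add_eq0 num_mul_eq0 num_total.

(** Surjectivity is stated in the shape of [decode], so that every element of the field has a code
    in the model. *)
Record embedding (F : realFieldType) (f : N -> F) : Prop := Embedding {
  embedding0 : f 0 = 0;
  embedding1 : f 1 = 1;
  embeddingD : forall x y, f (x + y) = f x + f y;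
  embeddingM : forall x y, f (x * y) = f x * f y;
  embedding_inj : injective f;
  embedding_le : forall x y, f x <= f y <-> exists d, y = x + d;
  embedding_surj : forall q, exists x y z, q = (f x - f y) / (f z + 1) }.

Lemma rational_sig : {F : realFieldType & {f : N -> F | embedding f}}.
Proof.
exists (ofrac num_cone), (@emb num_cone); split.
- exact: (@emb0 num_cone).
- exact: (@emb1 num_cone).
- exact: (@embD num_cone).
- exact: (@embM num_cone).
- exact: (@emb_inj num_cone).
- exact: (@emb_le num_cone).
move=> q; have [a [b [b0 qE]]] := @ofrac_sign num_cone q.
have [b00|bE] := pred_eq b; first by rewrite -b00 eqxx in b0.
have bE' : emb (b : num_cone) = emb (pred_ b : num_cone) + 1.
  by rewrite -(@emb1 num_cone) -(@embD num_cone) {1}bE.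
case: qE => ->; [exists a, 0, (pred_ b)|exists 0, a, (pred_ b)].
  by rewrite -bE' (@emb0 num_cone) subr0.
by rewrite -bE' (@emb0 num_cone) sub0r mulNr.
Qed.

(* The ordered field of rational numbers of the model: opaque, since unfolding
   the fractions makes [lra] and [field] diverge. *)
Definition rational : realFieldType := projT1 rational_sig.
Definition toQ : N -> rational := sval (projT2 rational_sig).
Lemma toQ_embedding : embedding toQ.
Proof. exact: svalP. Qed.

End Arithmetic.

Opaque predec monus exp2 isqrt.

Notation "x <N y" := (ltnum x y) (at level 70).

(** * The model's powers of two and pairing, seen in the field *)

Section Rationals.
Variable M : emodel.
Local Open Scope ring_scope.
Local Notation N := (num M).
Local Notation Q := (rational M).
Implicit Types x y z n m : N.

Lemma toQD x y : toQ (x + y) = toQ x + toQ y.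
Proof. exact: (embeddingD (toQ_embedding M)). Qed.
Lemma toQM x y : toQ (x * y) = toQ x * toQ y.
Proof. exact: (embeddingM (toQ_embedding M)). Qed.
Lemma toQ0 : toQ (0 : N) = 0.
Proof. exact: (embedding0 (toQ_embedding M)). Qed.
Lemma toQ1 : toQ (1 : N) = 1.
Proof. exact: (embedding1 (toQ_embedding M)). Qed.
Lemma toQ_inj : injective (@toQ M).
Proof. exact: (embedding_inj (toQ_embedding M)). Qed.

Definition toQE := (toQD, toQM, toQ0, toQ1).

Lemma toQ_ge0 x : 0 <= toQ x.
Proof. by rewrite -toQ0; apply/(embedding_le (toQ_embedding M)); exists x; rewrite add0r. Qed.

Lemma toQ_leP x y : toQ x <= toQ y <-> ~ y <N x.
Proof.
split=> [/(embedding_le (toQ_embedding M))[d ->] h|/(proj2 (monus_spec x y)) e]; last first.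
  by apply/(embedding_le (toQ_embedding M)); eexists; exact: e.
have [d0|d0] := num_gt0 d; first by move: h; rewrite -d0 addr0; exact: ilt_irr.
apply: (@ilt_irr _ x); apply: ilt_trans h; have := ilt_add x d0.
by rewrite add0r addrC.
Qed.

Lemma ltnumE x y : x <N y = (toQ x < toQ y).
Proof.
apply: propext; rewrite ltNge; split=> [h|/negP/toQ_leP/contrapT//].
by apply/negP => /toQ_leP.
Qed.

(** Discreteness of the naturals, in the form in which linear arithmetic can use it. *)
Lemma toQ_lt x y : toQ x < toQ y -> toQ x + 1 <= toQ y.
Proof.
move=> lt_xy; have yE := proj2 (monus_spec x y).
have {}yE : y = x + monus_ y x by apply/yE/toQ_leP/ltW.
have [m0|mE] := pred_eq (monus_ y x); first by move: lt_xy; rewrite yE -m0 addr0 ltxx.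
by rewrite yE mE !toQE addrA; have := toQ_ge0 (pred_ (monus_ y x)); lra.
Qed.

Lemma toQ_monus x y : toQ y <= toQ x -> toQ (monus_ x y) = toQ x - toQ y.
Proof. by move=> /toQ_leP/(proj2 (monus_spec y x)) {2}->; rewrite toQD; ring. Qed.

Lemma monus_eq0 x y : toQ x <= toQ y -> monus_ x y = 0.
Proof.
move=> le_xy; have [/(proj1 (monus_spec y x)) //|/toQ_leP le_yx] := pselect (x <N y).
have e : toQ x = toQ y by apply/eqP; rewrite eq_le le_xy.
by apply: toQ_inj; rewrite toQ_monus // e toQ0; ring.
Qed.

(** This is 2^-n. Since n may be nonstandard, the power is the one computed by the model and not
    that of the field. *)
Definition h n : Q := (toQ (exp2_ n))^-1.

Lemma exp2_gt0 n : 0 < toQ (exp2_ n).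
Proof.
apply: (@num_ind _ (fun n => 0 < toQ (exp2_ n)) [::] (Lt Zero (exp2 (Var vz))) (@enil _) erefl) n
  => [n||n IH].
- by rewrite /= ev_exp2 -[0 in RHS]toQ0 -ltnumE.
- by rewrite exp2_0 toQ1.
- by rewrite exp2S toQD; lra.
Qed.

Lemma h_gt0 n : 0 < h n.
Proof. by rewrite invr_gt0 exp2_gt0. Qed.

Lemma h0 : h 0 = 1.
Proof. by rewrite /h exp2_0 toQ1 invr1. Qed.

Lemma hS n : h (n + 1) = h n / 2.
Proof. by rewrite /h exp2S toQD; rewrite -mulr2n -[toQ _ *+ 2]mulr_natr invfM. Qed.

Lemma exp2D n m : exp2_ (n + m) = exp2_ n * exp2_ m.
Proof.
apply: (@num_ind _ (fun m => exp2_ (n + m) = exp2_ n * exp2_ m) [:: TN]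
  (Eq (exp2 (Var (vs vz) + Var vz)%fm) (exp2 (Var (vs vz)) * exp2 (Var vz))%fm)
  (econs n (@enil _)) erefl) m => [m||m IH].
- by rewrite /= ieqE !ev_exp2.
- by rewrite exp2_0 addr0 mulr1.
- by rewrite addrA !exp2S IH mulrDr.
Qed.

Lemma hD n m : h (n + m) = h n * h m.
Proof. by rewrite /h exp2D toQM invfM. Qed.

Lemma hV n : toQ (exp2_ n) * h n = 1.
Proof. by rewrite divff // gt_eqF // exp2_gt0. Qed.

Lemma h_le1 n : h n <= 1.
Proof.
rewrite invf_le1 ?exp2_gt0 //.
have := @toQ_lt 0 (exp2_ n); rewrite toQ0 add0r; apply; exact: exp2_gt0.
Qed.

Lemma hD_le n m : h (n + m) <= h n.
Proof. by rewrite hD ler_piMr ?h_le1 // ltW // h_gt0. Qed.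

Definition pair_ x y : N := (x + y) * (x + y) + x.
Definition pfst_ c : N := monus_ c (isqrt_ c * isqrt_ c).
Definition psnd_ c : N := monus_ (isqrt_ c) (pfst_ c).

Lemma isqrt_spec n : (~ n <N isqrt_ n * isqrt_ n) /\ n <N (isqrt_ n + 1) * (isqrt_ n + 1).
Proof.
apply: (@num_ind _
  (fun n => (~ n <N isqrt_ n * isqrt_ n) /\ n <N (isqrt_ n + 1) * (isqrt_ n + 1)) [::]
  (And (Imp (Lt (Var vz) (isqrt (Var vz) * isqrt (Var vz))%fm) Bot)
     (Lt (Var vz) ((isqrt (Var vz) + One) * (isqrt (Var vz) + One))%fm))
  (@enil _) erefl) n => [n||n].
- by rewrite /= !ev_isqrt.
- by rewrite isqrt0 !ltnumE !toQE; split; [apply/negP|]; lra.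
rewrite isqrtS; set s := isqrt_ n; rewrite -toQ_leP !ltnumE !toQE => -[h1 h2].
have s0 := toQ_ge0 s; have n0 := toQ_ge0 n.
have [lt|le] := ltP (toQ n + 1) ((toQ s + 1) * (toQ s + 1)).
  have -> : monus_ 1 (monus_ ((s + 1) * (s + 1)) (n + 1)) = 0.
    apply: monus_eq0; rewrite toQ_monus !toQE; last by lra.
    have := @toQ_lt (n + 1) ((s + 1) * (s + 1)); rewrite !toQE => /(_ lt); lra.
  by rewrite toQ0 addr0; split; [apply/negP|]; lra.
have -> : monus_ 1 (monus_ ((s + 1) * (s + 1)) (n + 1)) = 1.
  by rewrite [monus_ (_ * _) _]monus_eq0 ?monus0 // !toQE.
by rewrite toQ1; split; [apply/negP|]; lra.
Qed.

Lemma isqrt_pair x y : isqrt_ (pair_ x y) = x + y.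
Proof.
have [] := isqrt_spec (pair_ x y); rewrite -toQ_leP !ltnumE.
set s := isqrt_ _; rewrite /pair_ !toQE => h1 h2; apply: toQ_inj; rewrite toQD.
have := toQ_ge0 x; have := toQ_ge0 y; have := toQ_ge0 s => s0 y0 x0.
apply/eqP; rewrite eq_le; apply/andP; split; rewrite leNgt; apply/negP => lt.
  have := @toQ_lt (x + y) s; rewrite toQD => /(_ lt) lt'.
  have : (toQ x + toQ y + 1) * (toQ x + toQ y + 1) <= toQ s * toQ s by apply: ler_pM; lra.
  lra.
have := @toQ_lt s (x + y); rewrite toQD => /(_ lt) lt'.
have : (toQ s + 1) * (toQ s + 1) <= (toQ x + toQ y) * (toQ x + toQ y) by apply: ler_pM; lra.
lra.
Qed.

Lemma pfst_pair x y : pfst_ (pair_ x y) = x.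
Proof.
rewrite /pfst_ isqrt_pair; apply: toQ_inj; rewrite toQ_monus /pair_ !toQE; first by ring.
by have := toQ_ge0 x; lra.
Qed.

Lemma psnd_pair x y : psnd_ (pair_ x y) = y.
Proof.
rewrite /psnd_ pfst_pair isqrt_pair; apply: toQ_inj; rewrite toQ_monus !toQE; first by ring.
by have := toQ_ge0 y; lra.
Qed.

End Rationals.

(** * Rational and real numbers of a model *)

Section Reals.
Variable M : emodel.
Local Open Scope ring_scope.
Local Notation N := (num M).
Local Notation Q := (rational M).
Local Notation D1 := (dom M T1).

Definition val (c : N) : Q :=
  (toQ (pfst_ (pfst_ c)) - toQ (psnd_ (pfst_ c))) / (toQ (psnd_ c) + 1).

Lemma val_surj (q : Q) : exists c, val c = q.
Proof.
have [a [b [d ->]]] := embedding_surj (toQ_embedding M) q.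
by exists (pair_ (pair_ a b) d); rewrite /val !pfst_pair !psnd_pair.
Qed.

Section Terms.
Variables (G : ctx) (r : forall t, var G t -> dom M t).
Implicit Types (a b : tm G TN) (p q : rat G) (x y : tm G T1).

Lemma ev_app s t (f : tm G (s ~> t)) (a : tm G s) : ev r (f @ a)%fm = ap (ev r f) (ev r a).
Proof. by []. Qed.
Lemma ev_plus a b : ev r (a + b)%fm = (ev r a : N) + ev r b.
Proof. by []. Qed.
Lemma ev_times a b : ev r (a * b)%fm = (ev r a : N) * ev r b.
Proof. by []. Qed.
Lemma ev_zero : ev r Zero = 0 :> N.
Proof. by []. Qed.
Lemma ev_one : ev r One = 1 :> N.
Proof. by []. Qed.

Lemma ev_pair a b : ev r (pair a b) = pair_ (ev r a) (ev r b).
Proof. by []. Qed.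
Lemma ev_pfst a : ev r (pfst a) = pfst_ (ev r a).
Proof. by rewrite /pfst ev_monus ev_times ev_isqrt. Qed.
Lemma ev_psnd a : ev r (psnd a) = psnd_ (ev r a).
Proof. by rewrite /psnd ev_monus ev_isqrt ev_pfst. Qed.

Definition ratval q : Q :=
  (toQ (ev r (pos q) : N) - toQ (ev r (neg q) : N)) / toQ (ev r (den q) : N).
Definition ratok q : Prop := 0 < toQ (ev r (den q) : N).

Lemma ratok_decode a : ratok (decode a).
Proof.
by rewrite /ratok /decode; cbn [den]; rewrite ev_plus ev_one toQD toQ1 ltr_wpDl ?toQ_ge0.
Qed.

Lemma ratval_decode a : ratval (decode a) = val (ev r a).
Proof. by rewrite /ratval /decode ev_plus !ev_pfst !ev_psnd ev_pfst toQD toQ1. Qed.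

Lemma val_encode q : ratok q -> val (ev r (encode q)) = ratval q.
Proof.
move=> dq; rewrite /encode !ev_pair /val !pfst_pair !psnd_pair ev_predec.
rewrite /ratval; congr (_ / _); rewrite -toQ1 -toQD.
have [d0|{2}->//] := pred_eq (ev r (den q) : N).
by move: dq; rewrite /ratok -d0 toQ0 ltxx.
Qed.

Lemma ratok_add p q : ratok p -> ratok q -> ratok (qadd p q).
Proof. by rewrite /ratok ev_times toQM => *; rewrite mulr_gt0. Qed.
Lemma ratok_opp q : ratok q -> ratok (qopp q).
Proof. by []. Qed.
Lemma ratok_sub p q : ratok p -> ratok q -> ratok (qsub p q).
Proof. by move=> *; apply: ratok_add. Qed.
Lemma ratok_abs q : ratok q -> ratok (qabs q).
Proof. by []. Qed.
Lemma ratok_half a : ratok (qhalf a).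
Proof. by rewrite /ratok; cbn [den qhalf qhalf1]; rewrite ev_exp2 exp2_gt0. Qed.
Lemma ratok_half1 a : ratok (qhalf1 a).
Proof. by rewrite /ratok; cbn [den qhalf qhalf1]; rewrite ev_exp2 exp2_gt0. Qed.

Lemma ratval_add p q : ratok p -> ratok q -> ratval (qadd p q) = ratval p + ratval q.
Proof.
move=> /lt0r_neq0 dp /lt0r_neq0 dq.
by rewrite /ratval /qadd !ev_plus !ev_times !toQE addf_div //; congr (_ / _); ring.
Qed.
Lemma ratval_opp q : ratval (qopp q) = - ratval q.
Proof. by rewrite /ratval /= -mulNr; congr (_ / _); ring. Qed.
Lemma ratval_sub p q : ratok p -> ratok q -> ratval (qsub p q) = ratval p - ratval q.
Proof. by move=> *; rewrite ratval_add // ratval_opp. Qed.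
Lemma ratval_abs q : ratok q -> ratval (qabs q) = `|ratval q|.
Proof.
move=> dq; rewrite /ratval /qabs ev_plus !ev_monus ev_zero toQ0 subr0 normrM.
rewrite [ `|_^-1|]gtr0_norm ?invr_gt0 //; congr (_ / _).
set u := ev r (pos q) : N; set v := ev r (neg q) : N; rewrite toQD.
have [le|/ltW le] := leP (toQ u) (toQ v).
  by rewrite (monus_eq0 le) toQ_monus // toQ0 add0r distrC ger0_norm // subr_ge0.
by rewrite (monus_eq0 le) toQ_monus // toQ0 addr0 ger0_norm // subr_ge0.
Qed.
Lemma ratval_half a : ratval (qhalf a) = h (ev r a).
Proof.
rewrite /ratval /qhalf; cbn [pos neg den]; rewrite ev_exp2 ev_one ev_zero toQ1 toQ0.
by rewrite subr0 mul1r.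
Qed.
Lemma ratval_half1 a : ratval (qhalf1 a) = 2 * h (ev r a).
Proof.
rewrite /ratval /qhalf1; cbn [pos neg den].
by rewrite ev_exp2 ev_plus ev_one ev_zero toQD toQ1 toQ0 subr0.
Qed.

Lemma ratval_lt p q : ratok p -> ratok q ->
  (toQ (ev r (pos p * den q + neg q * den p)%fm : N) <
   toQ (ev r (pos q * den p + neg p * den q)%fm : N)) = (ratval p < ratval q).
Proof.
rewrite /ratok => dp dq; rewrite !ev_plus !ev_times !toQE.
rewrite /ratval ltr_pdivrMr // mulrAC ltr_pdivlMr // !mulrBl.
by rewrite ltrBlDr addrAC ltrBrDr.
Qed.

Lemma sat_qlt p q : ratok p -> ratok q -> sat r (qlt p q) = (ratval p < ratval q).
Proof. by move=> dp dq; rewrite -ratval_lt // -ltnumE. Qed.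

Lemma sat_qle p q : ratok p -> ratok q -> sat r (qle p q) = (ratval p <= ratval q).
Proof.
move=> dp dq; apply: propext; rewrite leNgt -ratval_lt //.
rewrite /qle /= ieqE; split=> [[]|].
- by rewrite -/(ltnum _ _) ltnumE => /ltW; rewrite leNgt.
- move=> e; set u := toQ _; set v := toQ _; have -> : u = v by rewrite /u /v /= e.
  by rewrite ltxx.
- rewrite -leNgt le_eqVlt => /orP[/eqP/toQ_inj|]; first by right.
  by rewrite -ltnumE; left.
Qed.
End Terms.

Definition v (x : D1) (n : N) : Q := val (ap x n).

Definition Real (x : D1) := forall n i : N, `|v x n - v x (n + i)| < h n.
Definition Req (x y : D1) := forall n, `|v x n - v y n| <= 2 * h n.
Definition Rlt (x y : D1) := exists n, v x n + 2 * h n < v y n.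
Definition Rle (x y : D1) := forall n, v x n <= v y n + 2 * h n.

Lemma sat_all G (r : forall t, var G t -> dom M t) s (p : tm (s :: G) s -> fm (s :: G)) :
  sat r (allx p) = forall x : dom M s, sat (econs x r) (p (Var vz)).
Proof. by []. Qed.
Lemma sat_ex G (r : forall t, var G t -> dom M t) s (p : tm (s :: G) s -> fm (s :: G)) :
  sat r (exx p) = exists x : dom M s, sat (econs x r) (p (Var vz)).
Proof. by []. Qed.

Section RealTerms.
Variables (G : ctx) (r : forall t, var G t -> dom M t).
Implicit Types (x y : tm G T1).

Ltac okrat := repeat first [exact: ratok_decode | exact: ratok_half | exact: ratok_half1
  | apply: ratok_sub | apply: ratok_add | apply: ratok_abs].

Lemma sat_real x : sat r (is_real x) = Real (ev r x).
Proof.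
rewrite /is_real sat_all; apply: eq_forall => n; rewrite sat_all; apply: eq_forall => i.
rewrite sat_qlt; [|okrat..]; rewrite ratval_abs; [|okrat..].
rewrite ratval_sub; [|okrat..]; rewrite !ratval_decode ratval_half.
by rewrite !ev_app !ev_liftS !ev_lift0.
Qed.

Lemma sat_req x y : sat r (req x y) = Req (ev r x) (ev r y).
Proof.
rewrite /req sat_all; apply: eq_forall => n.
rewrite sat_qle; [|okrat..]; rewrite ratval_abs; [|okrat..].
rewrite ratval_sub; [|okrat..]; rewrite !ratval_decode ratval_half1.
by rewrite !ev_app !ev_liftS !ev_lift0.
Qed.

Lemma sat_rlt x y : sat r (rlt x y) = Rlt (ev r x) (ev r y).
Proof.
rewrite /rlt sat_ex; apply: eq_exists => n.
rewrite sat_qlt; [|okrat..]; rewrite ratval_add; [|okrat..].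
rewrite !ratval_decode ratval_half1.
by rewrite !ev_app !ev_liftS !ev_lift0.
Qed.

Lemma sat_rle x y : sat r (rle x y) = Rle (ev r x) (ev r y).
Proof.
rewrite /rle sat_all; apply: eq_forall => n.
rewrite sat_qle; [|okrat..]; rewrite ratval_add; [|okrat..].
rewrite !ratval_decode ratval_half1.
by rewrite !ev_app !ev_liftS !ev_lift0.
Qed.

Lemma v_radd x y n : v (ev r (radd x y)) n = v (ev r x) (n + 1) + v (ev r y) (n + 1).
Proof.
rewrite /v /radd ev_lam val_encode; last by okrat.
rewrite ratval_add; [|okrat..]; rewrite !ratval_decode.
by rewrite !ev_app !ev_liftS !ev_lift0.
Qed.

Lemma v_rsub x y n : v (ev r (rsub x y)) n = v (ev r x) (n + 1) - v (ev r y) (n + 1).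
Proof.
rewrite /v /rsub ev_lam val_encode; last by okrat.
rewrite ratval_sub; [|okrat..]; rewrite !ratval_decode.
by rewrite !ev_app !ev_liftS !ev_lift0.
Qed.

Lemma v_rabs x n : v (ev r (rabs x)) n = `|v (ev r x) n|.
Proof.
rewrite /v /rabs ev_lam val_encode; last by okrat.
rewrite ratval_abs; [|okrat..]; rewrite !ratval_decode.
by rewrite !ev_app !ev_liftS !ev_lift0.
Qed.

Lemma v_rzero n : v (ev r rzero) n = 0.
Proof.
rewrite /v /rzero ev_lam val_encode; last by rewrite /ratok /= toQ1.
by rewrite /ratval /= subrr mul0r.
Qed.

Lemma v_rone n : v (ev r rone) n = 1.
Proof.
rewrite /v /rone ev_lam val_encode; last by rewrite /ratok /= toQ1.
by rewrite /ratval /= toQ1 toQ0 subr0 divr1.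
Qed.
End RealTerms.

End Reals.

(** * The two principles read in a model *)

Section Principles.
Variable M : emodel.
Local Open Scope ring_scope.
Local Notation N := (num M).
Local Notation D1 := (dom M T1).

Definition In01 (x : D1) :=
  Real x /\ (forall n, 0 <= v x n + 2 * h n) /\ (forall n, v x n <= 1 + 2 * h n).
Definition Pos (x : D1) := Real x /\ exists n : N, 2 * h n < v x n.
(* |a - b| < e: the shift by one is that of [rsub]. *)
Definition Near (a b e : D1) := exists n, `|v a (n + 1) - v b (n + 1)| + 2 * h n < v e n.

Definition Fun01 (f : dom M (T1 ~> T1)%ty) :=
  (forall x, In01 x -> Real (ap f x)) /\
  (forall x y, In01 x /\ In01 y -> Req x y -> Req (ap f x) (ap f y)).
Definition FunPos (f : dom M (T1 ~> T1)%ty) :=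
  (forall x, Real x -> Pos (ap f x)) /\
  (forall x y, Real x /\ Real y -> Req x y -> Req (ap f x) (ap f y)).
Definition Continuous01 (f : dom M (T1 ~> T1)%ty) :=
  forall x, In01 x -> forall e, Pos e -> exists d, Pos d /\
    forall y, In01 y -> Near x y d -> Near (ap f x) (ap f y) e.

Definition Directed (D : dom M T2) (R : dom M (T1 ~> T1 ~> TN)%ty) :=
  (exists d, ap D d = 1 :> N) /\
  (forall a, ap D a = 1 :> N -> ap (ap R a) a = 1 :> N) /\
  (forall a b c, ap D a = 1 :> N /\ ap D b = 1 :> N /\ ap D c = 1 :> N ->
     ap (ap R a) b = 1 :> N -> ap (ap R b) c = 1 :> N -> ap (ap R a) c = 1 :> N) /\
  (forall a b, ap D a = 1 :> N /\ ap D b = 1 :> N ->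
     exists c, ap D c = 1 :> N /\ ap (ap R a) c = 1 :> N /\ ap (ap R b) c = 1 :> N).
Definition Converges (D : dom M T2) (R : dom M (T1 ~> T1 ~> TN)%ty)
    (F : dom M (T1 ~> T1 ~> T1)%ty) (f : dom M (T1 ~> T1)%ty) :=
  forall x, In01 x -> forall e, Pos e -> exists d0, ap D d0 = 1 :> N /\
    forall d, ap D d = 1 :> N -> ap (ap R d0) d = 1 :> N ->
      Near (ap (ap F d) x) (ap f x) e.

Section Terms.
Variables (G : ctx) (r : forall t, var G t -> dom M t).
Implicit Types (p q : fm G) (a b : tm G TN) (x y e : tm G T1) (f : tm G (T1 ~> T1)).

Lemma sat_and p q : sat r (p /\ q)%fm = (sat r p /\ sat r q).
Proof. by []. Qed.
Lemma sat_imp p q : sat r (p --> q)%fm = (sat r p -> sat r q).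
Proof. by []. Qed.
Lemma sat_eq a b : sat r (a == b)%fm = (ev r a = ev r b :> N).
Proof. exact: ieqE. Qed.
Lemma sat_le a b : sat r (a <=0 b)%fm = (toQ (ev r a : N) <= toQ (ev r b : N)) :> Prop.
Proof.
apply: propext; rewrite /= ieqE -/(ltnum _ _) ltnumE le_eqVlt; split.
  by case=> [->|->]; rewrite ?orbT ?eqxx.
by case/orP => [/eqP/toQ_inj|]; [right|left].
Qed.

Lemma sat_in01 x : sat r (in01 x) = In01 (ev r x).
Proof.
rewrite /in01 !sat_and sat_real !sat_rle; congr (_ /\ (_ /\ _)).
  by apply: eq_forall => n; rewrite v_rzero.
by apply: eq_forall => n; rewrite v_rone.
Qed.

Lemma sat_pos x : sat r (is_pos x) = Pos (ev r x).
Proof.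
rewrite /is_pos sat_and sat_real sat_rlt; congr (_ /\ _).
by apply: eq_exists => n; rewrite v_rzero add0r.
Qed.

Lemma sat_near x y e : sat r (rlt (rabs (rsub x y)) e) = Near (ev r x) (ev r y) (ev r e).
Proof. by rewrite sat_rlt; apply: eq_exists => n; rewrite v_rabs v_rsub. Qed.

End Terms.

Section Terms.
Variables (G : ctx) (r : forall t, var G t -> dom M t).
Implicit Types (f : tm G (T1 ~> T1)) (D : tm G T2) (R : tm G (T1 ~> T1 ~> TN))
  (F : tm G (T1 ~> T1 ~> T1)).

Lemma sat_fun01 f : sat r (fun01 f) = Fun01 (ev r f).
Proof.
rewrite /fun01 sat_and !sat_all; congr (_ /\ _); apply: eq_forall => x.
  by rewrite sat_imp sat_in01 sat_real ev_app !ev_liftS !ev_lift0.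
rewrite sat_all; apply: eq_forall => y.
by rewrite !sat_imp sat_and !sat_in01 !sat_req !ev_app !ev_liftS !ev_lift0.
Qed.

Lemma sat_fun_pos f : sat r (fun_pos f) = FunPos (ev r f).
Proof.
rewrite /fun_pos sat_and !sat_all; congr (_ /\ _); apply: eq_forall => x.
  by rewrite sat_imp sat_pos sat_real ev_app !ev_liftS !ev_lift0.
rewrite sat_all; apply: eq_forall => y.
by rewrite !sat_imp sat_and !sat_real !sat_req !ev_app !ev_liftS !ev_lift0.
Qed.

Lemma sat_continuous01 f : sat r (continuous01 f) = Continuous01 (ev r f).
Proof.
rewrite /continuous01 sat_all; apply: eq_forall => x.
rewrite sat_imp sat_in01; congr (_ -> _).
rewrite sat_all; apply: eq_forall => e.
rewrite sat_imp sat_pos; congr (_ -> _).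
rewrite sat_ex; apply: eq_exists => d.
rewrite sat_and sat_pos; congr (_ /\ _).
rewrite sat_all; apply: eq_forall => y.
by rewrite !sat_imp sat_in01 !sat_near !ev_app !ev_liftS !ev_lift0.
Qed.

Lemma sat_charset D : sat r (charset D) = forall d, toQ (ap (ev r D) d : N) <= 1.
Proof.
rewrite /charset sat_all; apply: eq_forall => d.
by rewrite sat_le ev_app ev_one toQ1 !ev_liftS !ev_lift0.
Qed.

Lemma sat_charrel R : sat r (charrel R) = forall d e, toQ (ap (ap (ev r R) d) e : N) <= 1.
Proof.
rewrite /charrel sat_all; apply: eq_forall => d; rewrite sat_all; apply: eq_forall => e.
by rewrite sat_le !ev_app ev_one toQ1 !ev_liftS !ev_lift0.
Qed.

Lemma sat_mem D d : sat r (mem D d) = (ap (ev r D) (ev r d) = 1 :> N).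
Proof. by rewrite /mem sat_eq. Qed.

Lemma sat_prec R d e : sat r (prec R d e) = (ap (ap (ev r R) (ev r d)) (ev r e) = 1 :> N).
Proof. by rewrite /prec sat_eq. Qed.

End Terms.

Section Terms.
Variables (G : ctx) (r : forall t, var G t -> dom M t).
Implicit Types (f : tm G (T1 ~> T1)) (D : tm G T2) (R : tm G (T1 ~> T1 ~> TN))
  (F : tm G (T1 ~> T1 ~> T1)).

Lemma sat_directed D R : sat r (directed D R) = Directed (ev r D) (ev r R).
Proof.
rewrite /directed !sat_and; congr (_ /\ (_ /\ (_ /\ _))).
- rewrite sat_ex; apply: eq_exists => d.
  by rewrite sat_mem !ev_liftS !ev_lift0.
- rewrite sat_all; apply: eq_forall => a.
  by rewrite sat_imp sat_prec sat_mem !ev_liftS !ev_lift0.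
- rewrite sat_all; apply: eq_forall => a; rewrite sat_all; apply: eq_forall => b.
  rewrite sat_all; apply: eq_forall => c.
  by rewrite !sat_imp !sat_and !sat_prec !sat_mem !ev_liftS !ev_lift0.
- rewrite sat_all; apply: eq_forall => a; rewrite sat_all; apply: eq_forall => b.
  rewrite sat_imp sat_and !sat_mem; congr (_ -> _).
    by rewrite !ev_liftS !ev_lift0.
  rewrite sat_ex; apply: eq_exists => c.
  by rewrite !sat_and !sat_prec sat_mem !ev_liftS !ev_lift0.
Qed.

Lemma sat_converges D R F f :
  sat r (converges D R F f) = Converges (ev r D) (ev r R) (ev r F) (ev r f).
Proof.
rewrite /converges sat_all; apply: eq_forall => x.
rewrite sat_imp sat_in01; congr (_ -> _).
rewrite sat_all; apply: eq_forall => e.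
rewrite sat_imp sat_pos; congr (_ -> _).
rewrite sat_ex; apply: eq_exists => d0.
rewrite sat_and sat_mem; congr (_ /\ _).
  by rewrite !ev_liftS !ev_lift0.
rewrite sat_all; apply: eq_forall => d.
by rewrite !sat_imp sat_prec sat_mem sat_near !ev_app !ev_liftS !ev_lift0.
Qed.

End Terms.

Lemma arzela_net : sat (@enil (dom M)) ARZ_net ->
  forall D R F f,
    (forall d, toQ (ap D d : N) <= 1) -> (forall d e, toQ (ap (ap R d) e : N) <= 1) ->
    Directed D R ->
    (forall d, ap D d = 1 :> N -> Fun01 (ap F d) /\ Continuous01 (ap F d)) ->
    Fun01 f -> Continuous01 f -> Converges D R F f ->
    forall e, Pos e -> forall d, ap D d = 1 :> N ->
    exists (k : N) (s : dom M (TN ~> T1)%ty),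
      forall x, In01 x -> exists j : N, toQ j <= toQ k /\
        Near (ap (ap F (ap s j)) x) (ap f x) e.
Proof.
move=> hA D R F f cD cR dir contF fun_f cont_f conv.
move: hA; rewrite /ARZ_net sat_all => /(_ D); rewrite sat_all => /(_ R).
rewrite sat_all => /(_ F); rewrite sat_all => /(_ f).
rewrite !sat_imp sat_charset sat_charrel sat_directed sat_fun01 sat_continuous01 sat_converges.
rewrite !ev_liftS !ev_lift0 => /(_ cD cR dir) h1.
refine (_ (h1 _ fun_f cont_f conv)); last first.
  rewrite sat_all => d; rewrite sat_imp sat_mem sat_and sat_fun01 sat_continuous01.
  by rewrite !ev_app !ev_liftS !ev_lift0; apply: contF.
rewrite /quasi_uniform sat_and => -[_]; rewrite sat_all => h2 e e0 d Dd.
move: h2 => /(_ e); rewrite sat_imp sat_pos sat_all => /(_ e0 d).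
rewrite sat_imp sat_mem !ev_liftS !ev_lift0 sat_ex => /(_ Dd)[k].
rewrite sat_ex => -[s]; rewrite sat_and sat_all => -[_]; rewrite sat_all => h2.
exists k, s => x x01; move: h2 => /(_ x); rewrite sat_imp sat_in01 sat_ex => /(_ x01)[j].
rewrite sat_and sat_le sat_near !ev_app !ev_liftS !ev_lift0 => hj.
by exists j.
Qed.

Lemma heine_borel :
  (forall Psi, FunPos Psi -> exists (k : N) (y : dom M (TN ~> T1)%ty),
     (forall i, In01 (ap y i)) /\
     forall x, In01 x -> exists i : N, (1 <= toQ i /\ toQ i <= toQ k) /\
       (exists n, v (ap y i) (n + 1) - v (ap Psi (ap y i)) (n + 1) + 2 * h n < v x n) /\
       (exists n, v x n + 2 * h n < v (ap y i) (n + 1) + v (ap Psi (ap y i)) (n + 1))) ->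
  sat (@enil (dom M)) HBU.
Proof.
move=> hb; rewrite /HBU sat_all => Psi.
rewrite sat_imp sat_fun_pos !ev_lift0 => /hb[k [y [y01 cov]]].
rewrite sat_ex; exists k; rewrite sat_ex; exists y; rewrite sat_and; split.
  rewrite sat_all => i; rewrite sat_imp sat_in01 !ev_app !ev_liftS !ev_lift0 => _.
  exact: y01.
rewrite sat_all => x; rewrite sat_imp sat_in01 => /cov[i [ik [[n hn] [m hm]]]].
rewrite sat_ex; exists i; rewrite !sat_and !sat_le !sat_rlt; split.
  by rewrite !ev_liftS !ev_lift0 ev_one toQ1.
split; [exists n; rewrite v_rsub|exists m; rewrite v_radd]; rewrite !ev_app !ev_liftS !ev_lift0.
  exact: hn.
exact: hm.
Qed.

End Principles.

(** * Internal iterations *)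

Definition qhalve G (q : rat G) : rat G := Rat (pos q) (neg q) (den q + den q)%fm.
(** The closed formula (p + q + |p - q|) / 2 avoids a definition by cases in the term language. *)
Definition qmax G (p q : rat G) : rat G := qhalve (qadd (qadd p q) (qabs (qsub p q))).
Definition qmin G (p q : rat G) : rat G := qopp (qmax (qopp p) (qopp q)).
Definition qscale G (n : tm G TN) (q : rat G) : rat G :=
  Rat (exp2 n * pos q)%fm (exp2 n * neg q)%fm (den q).
Definition qzero G : rat G := Rat Zero Zero One.
Definition qone G : rat G := Rat One Zero One.
Arguments qzero {G}.
Arguments qone {G}.

Section Terms.
Variable M : emodel.
Local Open Scope ring_scope.
Local Notation N := (num M).
Local Notation Q := (rational M).
Variables (G : ctx) (r : forall t, var G t -> dom M t).
Implicit Types (p q : rat G) (a : tm G TN).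

Lemma ratok_halve q : ratok r q -> ratok r (qhalve q).
Proof. by rewrite /ratok /qhalve; cbn [den]; rewrite ev_plus toQD => ?; rewrite addr_gt0. Qed.
Lemma ratok_max p q : ratok r p -> ratok r q -> ratok r (qmax p q).
Proof.
by move=> hp hq; apply: ratok_halve; apply: ratok_add; [exact: ratok_add|exact/ratok_abs/ratok_sub].
Qed.
Lemma ratok_min p q : ratok r p -> ratok r q -> ratok r (qmin p q).
Proof. by move=> hp hq; apply: ratok_opp; apply: ratok_max; apply: ratok_opp. Qed.
Lemma ratok_scale a q : ratok r q -> ratok r (qscale a q).
Proof. by []. Qed.
Lemma ratok_zero : ratok r qzero.
Proof. by rewrite /ratok /qzero; cbn [den]; rewrite ev_one toQ1 ltr01. Qed.
Lemma ratok_one : ratok r qone.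
Proof. by rewrite /ratok /qone; cbn [den]; rewrite ev_one toQ1 ltr01. Qed.

Lemma ratval_halve q : ratval r (qhalve q) = ratval r q / 2.
Proof.
rewrite /ratval /qhalve; cbn [pos neg den].
by rewrite ev_plus toQD -mulr2n -[toQ _ *+ 2]mulr_natr invfM mulrA.
Qed.
Lemma ratval_max p q : ratok r p -> ratok r q ->
  ratval r (qmax p q) = Num.max (ratval r p) (ratval r q).
Proof.
move=> hp hq; rewrite /qmax ratval_halve ratval_add; last 2 first.
- exact: ratok_add.
- exact/ratok_abs/ratok_sub.
by rewrite ratval_add // ratval_abs ?ratval_sub //; [rewrite maxr_absE|exact: ratok_sub].
Qed.
Lemma ratval_min p q : ratok r p -> ratok r q ->
  ratval r (qmin p q) = Num.min (ratval r p) (ratval r q).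
Proof.
move=> hp hq; rewrite /qmin ratval_opp ratval_max ?ratval_opp; try exact: ratok_opp.
by rewrite oppr_max !opprK.
Qed.
Lemma ratval_scale a q : ratval r (qscale a q) = toQ (exp2_ (ev r a)) * ratval r q.
Proof.
rewrite /ratval /qscale; cbn [pos neg den].
by rewrite !ev_times !ev_exp2 !toQM -mulrBr mulrA.
Qed.
Lemma ratval_zero : ratval r qzero = 0.
Proof. by rewrite /ratval /qzero; cbn [pos neg den]; rewrite subrr mul0r. Qed.
Lemma ratval_one : ratval r qone = 1.
Proof.
by rewrite /ratval /qone; cbn [pos neg den]; rewrite ev_one ev_zero toQ1 toQ0 subr0 divr1.
Qed.
End Terms.

Ltac okrat := repeat first [exact: ratok_decode | exact: ratok_half | exact: ratok_half1
  | exact: ratok_zero | exact: ratok_one | apply: ratok_min | apply: ratok_max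
  | apply: ratok_scale | apply: ratok_sub | apply: ratok_add | apply: ratok_abs].

(* Evaluates terms by syntactic matching: rewriting with [ev_app] would unfold
   the defined operations. *)
Ltac evsimp := repeat (cbv beta; match goal with
  | |- context [ap (ev ?r (lamx ?f)) ?x] => rewrite (ev_lam r f x)
  | |- context [ev (econs ?x ?r) (lift (ext_step ?s ?e) ?a)] => rewrite (ev_liftS r e x a)
  | |- context [ev ?r (lift (@ext_refl _) ?a)] => rewrite (ev_lift0 r a)
  | |- context [ev (econs ?x ?r) (Var vz)] => change (ev (econs x r) (Var vz)) with x
  | |- context [ev (econs ?x ?r) (Var (vs ?w))] =>
      change (ev (econs x r) (Var (vs w))) with (ev r (Var w))
  | |- context [ev ?r (predec ?a)] => rewrite (ev_predec r a)
  | |- context [ev ?r (monus ?a ?b)] => rewrite (ev_monus r a b)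
  | |- context [ev ?r (pair ?a ?b)] => rewrite (ev_pair r a b)
  | |- context [ev ?r (pfst ?a)] => rewrite (ev_pfst r a)
  | |- context [ev ?r (psnd ?a)] => rewrite (ev_psnd r a)
  | |- context [ev ?r (App (App Plus ?a) ?b)] => rewrite (ev_plus r a b)
  | |- context [ev ?r (App (App Times ?a) ?b)] => rewrite (ev_times r a b)
  | |- context [ev ?r (App ?f ?a)] => rewrite (ev_app r f a)
  | |- context [ev ?r Zero] => rewrite (ev_zero r)
  | |- context [ev ?r One] => rewrite (ev_one r)
  end).

Section Iterations.
Variable M : emodel.
Local Open Scope ring_scope.
Local Notation N := (num M).
Local Notation Q := (rational M).
Local Notation D1 := (dom M T1).

Lemma toQ_ltS (l j : N) : toQ l < toQ (j + 1) -> toQ l < toQ j \/ l = j.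
Proof.
have [lt_lj|lt_jl|/toQ_inj] := ltgtP (toQ l) (toQ j); [by left| |by right].
by have := toQ_lt lt_jl; rewrite toQD toQ1 => ? ?; left; lra.
Qed.

Lemma ev_rec0 G (r : forall t, var G t -> dom M t) f b :
  ap (ev r (Rec @ f @ b)%fm) (0 : N) = ev r b.
Proof. by rewrite !ev_app rec0. Qed.

Lemma ev_recS G (r : forall t, var G t -> dom M t)
    (f : tm (TN :: G) TN -> tm (TN :: G) (TN ~> TN)) b (k : N) :
  let g := ev r (Rec @ lamx f @ b)%fm in
  ap g (k + 1) = ap (ev (econs k r) (f (Var vz))) (ap g k) :> N.
Proof. by rewrite /= recS ev_lam. Qed.

(** Starting from 0, the value at k is the maximum of 0 and the entries below k. A single functional
    serves all sequences, so it can occur as a parameter in later terms. *)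
Lemma iterated_max : exists X : dom M (T1 ~> T1)%ty, forall t : D1,
  v (ap X t) 0 = 0 /\ forall k, v (ap X t) (k + 1) = Num.max (v (ap X t) k) (v t k).
Proof.
exists (ev (@enil _) (lam t : T1, Rec @ (lam j : TN, lam z : TN,
  encode (qmax (decode #z) (decode (#t @ #j)))) @ encode qzero)%fm) => t.
rewrite ev_lam; split=> [|k].
  by rewrite /v ev_rec0 val_encode ?ratval_zero //; okrat.
rewrite /v ev_recS ev_lam val_encode; last by okrat.
by rewrite ratval_max; [|okrat..]; rewrite !ratval_decode.
Qed.

(** Sums play two roles: a sum of naturals bounds each of its terms, and it vanishes exactly when
    all terms do, which turns bounded quantifiers into terms. *)
Lemma iterated_sum : exists X : dom M (T1 ~> T1)%ty, forall t : D1,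
  ap (ap X t) (0 : N) = 0 :> N /\
  forall k : N, ap (ap X t) (k + 1) = (ap (ap X t) k : N) + ap t k :> N.
Proof.
exists (ev (@enil _) (lam t : T1, Rec @ (lam j : TN, lam z : TN, #z + #t @ #j) @ Zero)%fm) => t.
rewrite ev_lam; split=> [|k]; first by rewrite ev_rec0.
by rewrite ev_recS ev_lam.
Qed.

Lemma max_ub (m t : D1) (k : N) (b : Q) :
  v m 0 = 0 -> (forall k, v m (k + 1) = Num.max (v m k) (v t k)) ->
  0 <= b -> (forall l, toQ l < toQ k -> v t l <= b) -> v m k <= b.
Proof.
move=> m0 mS b0 ub; have [c cb] := val_surj b.
suff main j : toQ j <= toQ k -> v m j <= val c by rewrite -cb; apply: main; exact: lexx.
apply: (@num_ind _ (fun j => toQ j <= toQ k -> v m j <= val c) [:: TN; TN; T1]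
  (Imp (Or (Lt (Var vz) (Var (vs vz))) (Eq (Var vz) (Var (vs vz))))
    (qle (decode (Var (vs (vs (vs vz))) @ Var vz)%fm) (decode (Var (vs (vs vz))))))
  (econs k (econs c (econs m (@enil _)))) erefl) j => [j||j IH le].
- by rewrite sat_imp sat_le sat_qle; [|okrat..]; rewrite !ratval_decode.
- by rewrite m0 cb.
have lt : toQ j < toQ k by move: le; rewrite toQD toQ1; lra.
by rewrite mS ge_max IH ?(ltW lt) // cb; exact: ub.
Qed.

Lemma max_ge0 (m t : D1) (k : N) :
  v m 0 = 0 -> (forall k, v m (k + 1) = Num.max (v m k) (v t k)) -> 0 <= v m k.
Proof.
move=> m0 mS; apply: (@num_ind _ (fun k => 0 <= v m k) [:: T1]
  (qle qzero (decode (Var (vs vz) @ Var vz)%fm)) (econs m (@enil _)) erefl) k => [j||j IH].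
- by rewrite sat_qle; [|okrat..]; rewrite ratval_zero ratval_decode.
- by rewrite m0.
- by rewrite mS le_max IH.
Qed.

Lemma max_ge (m t : D1) (k l : N) :
  (forall k, v m (k + 1) = Num.max (v m k) (v t k)) ->
  toQ l < toQ k -> v t l <= v m k.
Proof.
move=> mS; apply: (@num_ind _ (fun k => toQ l < toQ k -> v t l <= v m k) [:: TN; T1; T1]
  (Imp (Lt (Var (vs vz)) (Var vz))
    (qle (decode (Var (vs (vs (vs vz))) @ Var (vs vz))%fm) (decode (Var (vs (vs vz)) @ Var vz)%fm)))
  (econs l (econs m (econs t (@enil _)))) erefl) k => [j||j IH /toQ_ltS[/IH le|->]].
- by rewrite sat_imp sat_qle; [|okrat..]; rewrite !ratval_decode /= -/(ltnum _ _) ltnumE.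
- by rewrite toQ0 ltNge toQ_ge0.
- by rewrite mS le_max le.
- by rewrite mS le_max lexx orbT.
Qed.

Lemma sum_eq0 (s t : D1) (k : N) :
  ap s (0 : N) = 0 :> N -> (forall k : N, ap s (k + 1) = (ap s k : N) + ap t k :> N) ->
  (forall l : N, toQ l < toQ k -> ap t l = 0 :> N) -> ap s k = 0 :> N.
Proof.
move=> s0 sS t0.
suff main (j : N) : toQ j <= toQ k -> ap s j = 0 :> N by apply: main; exact: lexx.
apply: (@num_ind _ (fun j => toQ j <= toQ k -> ap s j = 0 :> N) [:: TN; T1]
  (Imp (Or (Lt (Var vz) (Var (vs vz))) (Eq (Var vz) (Var (vs vz))))
    (Eq (Var (vs (vs vz)) @ Var vz)%fm Zero))
  (econs k (econs s (@enil _))) erefl) j => [j||j IH le].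
- by rewrite sat_imp sat_le sat_eq.
- by rewrite s0.
have lt : toQ j < toQ k by move: le; rewrite toQD toQ1; lra.
by rewrite sS IH ?ltW // t0 // addr0.
Qed.

Lemma sum_ge (s t : D1) (k l : N) :
  (forall k : N, ap s (k + 1) = (ap s k : N) + ap t k :> N) ->
  toQ l < toQ k -> toQ (ap t l : N) <= toQ (ap s k : N).
Proof.
move=> sS; apply: (@num_ind _
  (fun k => toQ l < toQ k -> toQ (ap t l : N) <= toQ (ap s k : N)) [:: TN; T1; T1]
  (Imp (Lt (Var (vs vz)) (Var vz))
    (Or (Lt (Var (vs (vs (vs vz))) @ Var (vs vz))%fm (Var (vs (vs vz)) @ Var vz)%fm)
        (Eq (Var (vs (vs (vs vz))) @ Var (vs vz))%fm (Var (vs (vs vz)) @ Var vz)%fm)))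
  (econs l (econs s (econs t (@enil _)))) erefl) k => [j||j IH /toQ_ltS[/IH le|->]].
- by rewrite sat_imp sat_le /= -/(ltnum _ _) ltnumE.
- by rewrite toQ0 ltNge toQ_ge0.
- by rewrite sS toQD; have := toQ_ge0 (ap t j : N); lra.
- by rewrite sS toQD; have := toQ_ge0 (ap s j : N); lra.
Qed.

End Iterations.

(** * Reals in [0,1] from arbitrary sequences *)

Section Hat.
Local Open Scope ring_scope.

(** Entry k+1 of y is moved into the interval of radius 2^-k around the previous clamped entry. A
    sequence that is already a real is not changed in value. *)
Definition clampseq_tm G : tm G (T1 ~> T1) :=
  (lam y : T1, Rec @ (lam k : TN, lam z : TN, encode
     (qmax (qsub (decode #z) (qhalf #k))
           (qmin (qadd (decode #z) (qhalf #k)) (decode (#y @ (#k + One)))))) @ (#y @ Zero))%fm.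
Definition hat_tm G (Z : tm G (T1 ~> T1)) : tm G (T1 ~> T1) :=
  (lam y : T1, lam n : TN,
     encode (qmax qzero (qmin qone (decode (#Z @ #y @ (#n + One))))))%fm.

Variable M : emodel.
Local Notation N := (num M).
Local Notation Q := (rational M).
Local Notation D1 := (dom M T1).

Lemma clampseq_ex : exists Z : dom M (T1 ~> T1)%ty, forall y : D1,
  v (ap Z y) 0 = v y 0 /\ forall k, v (ap Z y) (k + 1) =
    Num.max (v (ap Z y) k - h k) (Num.min (v (ap Z y) k + h k) (v y (k + 1))).
Proof.
exists (ev (@enil _) (clampseq_tm _)) => y.
rewrite ev_lam; split=> [|k]; first by rewrite /v ev_rec0.
rewrite /v ev_recS ev_lam val_encode; last by okrat.
rewrite ratval_max; [|okrat..]; rewrite ratval_min; [|okrat..].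
rewrite ratval_sub; [|okrat..]; rewrite ratval_add; [|okrat..].
by rewrite !ratval_decode !ratval_half.
Qed.

Lemma clamp_near (a e b : Q) : 0 <= e ->
  a - e <= Num.max (a - e) (Num.min (a + e) b) <= a + e.
Proof. by move=> e0; rewrite le_max lexx ge_max ge_min lexx /=; lra. Qed.

Lemma clamp_id (a e b : Q) : a - e <= b -> b <= a + e ->
  Num.max (a - e) (Num.min (a + e) b) = b.
Proof. by move=> l1 l2; rewrite min_r // max_r. Qed.

Definition clamp01 (a : Q) : Q := Num.max 0 (Num.min 1 a).

Lemma clamp01_ge0 a : 0 <= clamp01 a.
Proof. by rewrite le_max lexx. Qed.

Lemma clamp01_le1 a : clamp01 a <= 1.
Proof. by rewrite ge_max ler01 ge_min lexx. Qed.

Lemma clamp01_lip a b : `|clamp01 a - clamp01 b| <= `|a - b|.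
Proof.
rewrite /clamp01 ler_norml; have := ler_norm (a - b); have := ler_norm (b - a).
rewrite (distrC b) => h1 h2; apply/andP.
by case: (leP 1 a); case: (leP 1 b); case: (leP 0 a); case: (leP 0 b);
  rewrite ?(max_r ler01) => *; split; lra.
Qed.

(** Makes every element of Baire space name a point of [0,1], so that all of Baire space can serve
    as index set, while each point of [0,1] is still named by itself. *)
Lemma hat_ex : exists H : dom M (T1 ~> T1)%ty,
  (forall y, In01 (ap H y)) /\ (forall x, In01 x -> Req x (ap H x)).
Proof.
have [Z Zrec] := clampseq_ex.
exists (ev (econs Z (@enil _)) (hat_tm (Var vz))); set H := ev _ _.
have vH y n : v (ap H y) n = clamp01 (v (ap Z y) (n + 1)).
  rewrite /v /H !ev_lam val_encode; last by okrat.
  rewrite ratval_max; [|okrat..]; rewrite ratval_min; [|okrat..].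
  by rewrite ratval_zero ratval_one ratval_decode !ev_app !ev_liftS !ev_lift0.
split=> [y|x [xR [x0 x1]] n].
  split=> [n i|].
    rewrite !vH; apply: le_lt_trans (clamp01_lip _ _) _.
    (* The geometric sum in closed form, since the induction formula can only mention the two end
       points. The subtracted term yields the strict inequality; the factor 2 is absorbed by the
       shift to n+1 in [hat_tm]. *)
    have drift m j : `|v (ap Z y) (m + j) - v (ap Z y) m| <= 2 * h m - 2 * h (m + j).
      apply: (@num_ind _ (fun j => `|v (ap Z y) (m + j) - v (ap Z y) m| <= 2 * h m - 2 * h (m + j))
        [:: TN; T1]
        (qle (qabs (qsub (decode (Var (vs (vs vz)) @ (Var (vs vz) + Var vz)))
                         (decode (Var (vs (vs vz)) @ Var (vs vz)))))
             (qsub (qhalf1 (Var (vs vz))) (qhalf1 (Var (vs vz) + Var vz))))%fm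
        (econs m (econs (ap Z y) (@enil _))) erefl) j => [j||j IH].
      - rewrite sat_qle; [|okrat..]; rewrite ratval_abs; [|okrat..].
        rewrite ratval_sub; [|okrat..]; rewrite ratval_sub; [|okrat..].
        by rewrite !ratval_decode !ratval_half1.
      - by rewrite addr0 !subrr normr0.
      rewrite addrA (proj2 (Zrec y)) hS; have h0 := h_gt0 (m + j).
      set a := v _ (m + j) in IH *; set b := v y _; set c := v _ m in IH *.
      have /andP[l3 l4] := clamp_near a b (ltW h0).
      by move: IH; rewrite !ler_norml => /andP[l1 l2]; apply/andP; split; lra.
    rewrite distrC -addrA [i + 1]addrC addrA; apply: le_lt_trans (drift _ _) _.
    by rewrite hS; have := h_gt0 (n + 1 + i); lra.
  by split=> n; have := h_gt0 n; rewrite vH;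
    [have := clamp01_ge0 (v (ap Z y) (n + 1))|have := clamp01_le1 (v (ap Z y) (n + 1))]; lra.
(* The codes may differ while the rationals agree, so the induction formula is a pair of
   inequalities between values. *)
have Zx m : v (ap Z x) m = v x m.
  apply: (@num_ind _ (fun m => v (ap Z x) m = v x m) [:: T1; T1]
    (And (qle (decode (Var (vs vz) @ Var vz)) (decode (Var (vs (vs vz)) @ Var vz)))
         (qle (decode (Var (vs (vs vz)) @ Var vz)) (decode (Var (vs vz) @ Var vz))))%fm
    (econs (ap Z x) (econs x (@enil _))) erefl) m => [m||m IH].
  - rewrite sat_and !sat_qle; [|okrat..]; rewrite !ratval_decode !ev_app.
    by apply: propext; split=> [[l1 l2]|e]; [apply/eqP; rewrite eq_le l1|rewrite -/(v _ _) e lexx].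
  - exact: (proj1 (Zrec x)).
  rewrite (proj2 (Zrec x)) IH; have := xR m 1; rewrite ltr_norml => /andP[l1 l2].
  by rewrite clamp_id //; lra.
rewrite vH Zx; have := xR n 1; rewrite ler_norml ltr_norml => /andP[l1 l2].
have := x0 (n + 1); have := x1 (n + 1); rewrite hS /clamp01 => l3 l4; have h0 := h_gt0 n.
apply/andP; case: (leP 1 (v x (n + 1))) => ?; first by rewrite (max_r ler01); split; lra.
by case: (leP 0 (v x (n + 1))) => ?; split; lra.
Qed.

End Hat.

(** * Finite sequences *)

Section Sequences.
Local Open Scope ring_scope.

(* A finite sequence of elements of Baire space is coded by a single one: [w 0]
   is its length, and [w (pair l n + 1)] is the value at [n] of its [l]-th entry. *)
Definition entry_tm G : tm G (T1 ~> TN ~> T1) :=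
  (lam w : T1, lam l : TN, lam n : TN, #w @ (pair #l #n + One))%fm.
(** Definition by cases through multiplication: [monus One #m] is 1 at m = 0 and 0 elsewhere, and a
    second [monus One] complements it. *)
Definition pack_tm G (s : tm G (TN ~> T1)) (k : tm G TN) : tm G T1 :=
  (lam m : TN, monus One #m * #k +
     monus One (monus One #m) * (#s @ pfst (predec #m) @ psnd (predec #m)))%fm.
(** The test is that [monus (#l + One) #k] vanishes exactly when l < k. *)
Definition concat_tm G (s t : tm G (TN ~> T1)) (k : tm G TN) : tm G (TN ~> T1) :=
  (lam l : TN, lam n : TN,
     monus One (monus (#l + One) #k) * (#s @ #l @ #n) +
     monus One (monus One (monus (#l + One) #k)) * (#t @ monus #l #k @ #n))%fm.

Variable M : emodel.
Local Notation N := (num M).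
Local Notation Q := (rational M).
Local Notation D1 := (dom M T1).

Definition entry : dom M (T1 ~> TN ~> T1)%ty := ev (@enil _) (entry_tm _).
Definition len (w : D1) : N := ap w (0 : N).

Lemma entryE w l n : ap (ap (ap entry w) l) n = ap w (pair_ l n + 1).
Proof. by rewrite /entry /entry_tm; evsimp. Qed.

Lemma monus11 : monus_ 1 1 = 0 :> N.
Proof. exact: monus_eq0. Qed.

Lemma monus1S (n : N) : monus_ 1 (n + 1) = 0 :> N.
Proof. by apply: monus_eq0; rewrite toQD; have := toQ_ge0 n; lra. Qed.

Opaque entry.

Lemma pack_ex (s : dom M (TN ~> T1)%ty) (k : N) : exists w : D1,
  len w = k /\ forall l, ap (ap entry w) l = ap s l.
Proof.
set w := ev (econs s (econs k (@enil (dom M)))) (pack_tm (Var vz) (Var (vs vz))).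
have wE (m : N) : ap w m = monus_ 1 m * k +
    monus_ 1 (monus_ 1 m) * (ap (ap s (pfst_ (pred_ m))) (psnd_ (pred_ m)) : N) :> N.
  by rewrite /w /pack_tm; evsimp.
exists w; split=> [|l]; first by rewrite /len wE monus0 monus11 mul0r addr0 mul1r.
apply: ap_ext => n; rewrite entryE wE.
by rewrite monus1S monus0 predS pfst_pair psnd_pair mul0r add0r mul1r.
Qed.

Lemma concat_ex (a b : D1) : exists c : D1,
  len c = len a + len b /\
  (forall l, toQ l < toQ (len a) -> ap (ap entry c) l = ap (ap entry a) l) /\
  (forall l, ap (ap entry c) (len a + l) = ap (ap entry b) l).
Proof.
set r := econs (ap entry a) (econs (ap entry b) (econs (len a) (@enil _))).
have [c [lc ec]] := pack_ex (ev r (concat_tm (Var vz) (Var (vs vz)) (Var (vs (vs vz)))))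
  (len a + len b).
exists c; split=> //.
have cE (l n : N) : let g := monus_ (l + 1) (len a) in
    ap (ap (ap entry c) l) n =
      monus_ 1 g * (ap (ap (ap entry a) l) n : N) +
      monus_ 1 (monus_ 1 g) * (ap (ap (ap entry b) (monus_ l (len a))) n : N).
  by cbv zeta; rewrite ec /concat_tm /r; evsimp.
split=> [l lt|l]; apply: ap_ext => n; rewrite cE.
  have -> : monus_ (l + 1) (len a) = 0.
    by apply: monus_eq0; have := toQ_lt lt; rewrite toQD toQ1.
  by rewrite monus0 monus11 mul1r mul0r addr0.
have -> : monus_ (len a + l) (len a) = l.
  by apply: toQ_inj; rewrite toQ_monus !toQD; have := toQ_ge0 l; lra.
have -> : monus_ (len a + l + 1) (len a) = l + 1.
  by apply: toQ_inj; rewrite toQ_monus !toQE; have := toQ_ge0 l; lra.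
by rewrite monus1S monus0 mul0r add0r mul1r.
Qed.

Lemma singleton_ex (x : D1) : exists w : D1, len w = 1 /\ ap (ap entry w) (0 : N) = x.
Proof.
have [w [lw ew]] := pack_ex (ap (iPi M T1 TN) x) 1.
by exists w; rewrite lw ew ap_Pi.
Qed.

End Sequences.

Opaque entry.

(** * The net of bump functions *)

Section Net.
Local Open Scope ring_scope.

(* [B w l] is the code [(q, n)] of the [l]-th rational ball of [w], with centre
   [q] and radius [2^-(n+1)]. *)
Definition precision_tm G (S : tm G (T1 ~> T1)) (B : tm G (T1 ~> TN ~> TN)) : tm G T2 :=
  (lam w : T1, #S @ (lam l : TN, psnd (#B @ #w @ #l) + (One + One + One + One)) @ (#w @ Zero))%fm.
Definition peak_tm G (X : tm G (T1 ~> T1)) (B : tm G (T1 ~> TN ~> TN)) : tm G (T1 ~> TN ~> TN) :=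
  (lam w : T1, lam u : TN, #X @ (lam l : TN,
     encode (qsub (qhalf (psnd (#B @ #w @ #l) + One))
                  (qabs (qsub (decode #u) (decode (pfst (#B @ #w @ #l))))))) @ (#w @ Zero))%fm.
(** The function min(1, 2^K peak). Scaling by 2^K produces the plateau of height 1; it also
    multiplies errors by 2^K, so x is read at index n + K. *)
Definition net_tm G (K : tm G T2) (P : tm G (T1 ~> TN ~> TN)) : tm G (T1 ~> T1 ~> T1) :=
  (lam w : T1, lam x : T1, lam n : TN, encode (qmin qone
     (qscale (#K @ #w) (decode (#P @ #w @ (#x @ (#n + #K @ #w)))))))%fm.
Definition distance_tm G (a b : tm G TN) : tm G TN := (monus a b + monus b a)%fm.
Definition match_tm G (B : tm G (T1 ~> TN ~> TN)) (u : tm G T1) (c : tm G TN) : tm G T1 :=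
  (lam j : TN, monus One (distance_tm (#B @ #u @ #j) #c))%fm.
(** The inner sum counts the balls of u with a given code and is nonzero when one exists; the outer
    sum counts the balls of w with no match, and w is below u when that count is 0. *)
Definition order_tm G (S : tm G (T1 ~> T1)) (B : tm G (T1 ~> TN ~> TN)) : tm G (T1 ~> T1 ~> TN) :=
  (lam w : T1, lam u : T1, monus One (#S @ (lam l : TN, monus One
     (#S @ match_tm #B #u (#B @ #w @ #l) @ (#u @ Zero))) @ (#w @ Zero)))%fm.

Variable M : emodel.
Local Notation N := (num M).
Local Notation Q := (rational M).
Local Notation D1 := (dom M T1).
Variable B : dom M (T1 ~> TN ~> TN)%ty.
Local Notation ball w l := (ap (ap B w) l : N).

(** A sum of the exponents, each increased by 4, replaces their maximum. The margin 4 is spent in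
    [bump_eq1]. *)
Lemma precision_ex : exists K : dom M T2, forall (w : D1) (l : N),
  toQ l < toQ (len w) -> toQ (psnd_ (ball w l)) + 4 <= toQ (ap K w : N).
Proof.
have [S hS] := iterated_sum M.
exists (ev (econs S (econs B (@enil _))) (precision_tm (Var vz) (Var (vs vz)))) => w l lt.
rewrite /precision_tm; evsimp; set t := ev _ _.
have -> : toQ (psnd_ (ball w l)) + 4 = toQ (ap t l : N).
  by rewrite /t; evsimp; rewrite !toQE; ring.
by apply: (sum_ge _ lt); case: (hS t).
Qed.

Definition tent (c : N) (q : Q) : Q := h (psnd_ c + 1) - `|q - val (pfst_ c)|.

(** The maximum of 0 and internally many tents, given by its universal property; the Lipschitz bound
    and the location of a positive tent follow from this alone. *)
Lemma peak_ex : exists P : dom M (T1 ~> TN ~> TN)%ty, forall (w : D1) (u : N),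
  0 <= val (ap (ap P w) u) /\
  (forall l, toQ l < toQ (len w) -> tent (ball w l) (val u) <= val (ap (ap P w) u)) /\
  (forall b, 0 <= b -> (forall l, toQ l < toQ (len w) -> tent (ball w l) (val u) <= b) ->
     val (ap (ap P w) u) <= b).
Proof.
have [X hX] := iterated_max M.
exists (ev (econs X (econs B (@enil _))) (peak_tm (Var vz) (Var (vs vz)))) => w u.
rewrite /peak_tm; evsimp; set t := ev _ _; have [X0 XS] := hX t.
have tE l : v t l = tent (ball w l) (val u).
  rewrite /v /t; evsimp; rewrite val_encode; last by okrat.
  rewrite ratval_sub; [|okrat..]; rewrite ratval_abs; [|okrat..].
  rewrite ratval_sub; [|okrat..]; rewrite !ratval_decode ratval_half.
  by evsimp.
split; first exact: (max_ge0 _ X0 XS).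
split=> [l lt|b b0 ub]; first by rewrite -tE; apply: (max_ge XS).
by apply: (max_ub X0 XS) => // l lt; rewrite tE ub.
Qed.

Lemma net_ex (K : dom M T2) (P : dom M (T1 ~> TN ~> TN)%ty) :
  exists F : dom M (T1 ~> T1 ~> T1)%ty, forall (w x : D1) (n : N),
  v (ap (ap F w) x) n =
    Num.min 1 (toQ (exp2_ (ap K w)) * val (ap (ap P w) (ap x (n + (ap K w : N))))).
Proof.
exists (ev (econs K (econs P (@enil _))) (net_tm (Var vz) (Var (vs vz)))) => w x n.
rewrite /v /net_tm; evsimp; rewrite val_encode; last by okrat.
rewrite ratval_min; [|okrat..]; rewrite ratval_one ratval_scale ratval_decode.
by evsimp.
Qed.

Lemma monus1_eq0 (a : N) : monus_ 1 a = 0 :> N <-> a <> 0.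
Proof.
split=> [e a0|]; first by move: e; rewrite a0 monus0 => /eqP; rewrite oner_eq0.
by case: (pred_eq a) => [<- //|-> _]; rewrite monus1S.
Qed.

Lemma distance_eq0 (a b : N) : monus_ a b + monus_ b a = 0 -> a = b.
Proof.
move=> e; have e1 := num_add_eq0 e; have e2 := num_add_eq0 (etrans (addrC _ _) e).
apply: toQ_inj; have [le|/ltW le] := leP (toQ a) (toQ b).
  by have := toQ_monus le; rewrite e2 toQ0; lra.
by have := toQ_monus le; rewrite e1 toQ0; lra.
Qed.

Lemma order_ex : exists R : dom M (T1 ~> T1 ~> TN)%ty, forall w u : D1,
  toQ (ap (ap R w) u : N) <= 1 /\
  (ap (ap R w) u = 1 :> N <-> forall l, toQ l < toQ (len w) ->
     exists j, toQ j < toQ (len u) /\ ball u j = ball w l).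
Proof.
have [S hS] := iterated_sum M.
exists (ev (econs S (econs B (@enil _))) (order_tm (Var vz) (Var (vs vz)))) => w u.
rewrite /order_tm; evsimp; set t := ev _ _; have [S0 SS] := hS t.
pose d c : D1 := ev (econs c (econs u (econs B (@enil (dom M)))))
  (match_tm (Var (vs (vs vz))) (Var (vs vz)) (Var vz)).
have dE c (j : N) : ap (d c) j = monus_ 1 (monus_ (ball u j) c + monus_ c (ball u j)).
  by rewrite /d /match_tm /distance_tm; evsimp.
have tE (l : N) : ap t l = monus_ 1 (ap (ap S (d (ball w l))) (len u)).
  rewrite /t; evsimp; congr (monus_ 1 (ap (ap S _) _)).
  by apply: ap_ext => j; rewrite dE /match_tm /distance_tm; evsimp.
have dP c : ap (ap S (d c)) (len u) <> (0 : N) <-> exists j, toQ j < toQ (len u) /\ ball u j = c.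
  have [dS0 dSS] := hS (d c); split=> [ne|[j [lt e]] s0].
    apply: contrapT => no; apply: ne; apply: (sum_eq0 dS0 dSS) => l lt; rewrite dE.
    by apply/monus1_eq0 => /distance_eq0 e; apply: no; exists l.
  have := sum_ge dSS lt; rewrite dE s0 e.
  by rewrite (monus_eq0 (lexx _)) addr0 monus0 toQ0 toQ1 ler10.
split.
  have [s0|->] := pred_eq (ap (ap S t) (ap w (i0 M)) : N); last by rewrite monus1S toQ0 ler01.
  by rewrite -s0 monus0 toQ1.
split=> [e l lt|hl].
  have {e} e0 : ap (ap S t) (len w) = 0 :> N.
    apply: contrapT => /monus1_eq0 e0; move: e; rewrite e0 => /esym/eqP.
    by rewrite oner_eq0.
  apply/dP/monus1_eq0; rewrite -tE; apply: toQ_inj; apply/eqP.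
  by rewrite eq_le toQ0 toQ_ge0 andbT -toQ0 -e0; apply: (sum_ge SS).
rewrite -/(len w) (sum_eq0 S0 SS (k := len w)) ?monus0 // => l lt.
by rewrite tE; apply/monus1_eq0/dP/hl.
Qed.

End Net.

(** * Estimates for the bump functions *)

Section Bumps.
Local Open Scope ring_scope.
Variable M : emodel.
Local Notation N := (num M).
Local Notation Q := (rational M).
Local Notation D1 := (dom M T1).
Variables (B : dom M (T1 ~> TN ~> TN)%ty) (K : dom M T2) (P : dom M (T1 ~> TN ~> TN)%ty).
Variable F : dom M (T1 ~> T1 ~> T1)%ty.
Local Notation ball w l := (ap (ap B w) l : N).
Local Notation prec w := (ap K w : N).
Local Notation peak w u := (val (ap (ap P w) u)).
Hypothesis precP : forall (w : D1) (l : N),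
  toQ l < toQ (len w) -> toQ (psnd_ (ball w l)) + 4 <= toQ (prec w).
Hypothesis peakP : forall (w : D1) (u : N), 0 <= peak w u /\
  (forall l, toQ l < toQ (len w) -> tent (ball w l) (val u) <= peak w u) /\
  (forall b, 0 <= b -> (forall l, toQ l < toQ (len w) -> tent (ball w l) (val u) <= b) ->
     peak w u <= b).
Hypothesis FE : forall (w x : D1) (n : N),
  v (ap (ap F w) x) n = Num.min 1 (toQ (exp2_ (prec w)) * peak w (ap x (n + prec w))).

(** Each tent is 1-Lipschitz, so the right-hand side bounds all tents at u, and the peak is their
    least bound. *)
Lemma peak_lip w u u' : peak w u <= peak w u' + `|val u - val u'|.
Proof.
have [p0 [ub _]] := peakP w u'; have [_ [_ lub]] := peakP w u.
apply: lub => [|l /ub]; first by rewrite addr_ge0.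
rewrite /tent; set q := val (pfst_ _).
have := ler_distD (val u) (val u') q; rewrite [ `|val u' - val u|]distrC.
set a := h _; set b := `|_|; set c := `|_|; set d := `|_| => ? ?; lra.
Qed.

Lemma min1_lip (a b : Q) : `|Num.min 1 a - Num.min 1 b| <= `|a - b|.
Proof.
rewrite ler_norml; have := ler_norm (a - b); have := ler_norm (b - a).
rewrite (distrC b) => h1 h2; apply/andP.
by case: (leP 1 a); case: (leP 1 b) => *; split; lra.
Qed.

(** Points and indices vary independently, so one estimate yields convergence of the value (same
    point), extensionality (same index) and continuity. *)
Lemma bump_lip w x y (n m : N) : `|v (ap (ap F w) x) n - v (ap (ap F w) y) m| <=
  toQ (exp2_ (prec w)) * `|v x (n + prec w) - v y (m + prec w)|.
Proof.
rewrite !FE; apply: le_trans (min1_lip _ _) _; rewrite -mulrBr normrM.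
have E0 := exp2_gt0 (prec w); rewrite (gtr0_norm E0) ler_pM2l //.
have := peak_lip w (ap x (n + prec w)) (ap y (m + prec w)).
have := peak_lip w (ap y (m + prec w)) (ap x (n + prec w)).
rewrite [ `|val (ap y _) - _|]distrC -/(v x _) -/(v y _) => h1 h2.
by rewrite ler_norml; apply/andP; split; lra.
Qed.

Lemma bump_fun01 w : Fun01 (ap F w).
Proof.
have E0 := exp2_gt0 (prec w); have EV := hV (prec w).
split=> [x [xR _] n i|x y _ xy n].
  apply: le_lt_trans (bump_lip _ _ _ _ _) _.
  have -> : h n = toQ (exp2_ (prec w)) * h (n + prec w) by rewrite hD mulrCA EV mulr1.
  by rewrite ltr_pM2l // addrAC; exact: xR.
apply: le_trans (bump_lip _ _ _ _ _) _.
have -> : 2 * h n = toQ (exp2_ (prec w)) * (2 * h (n + prec w)).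
  by rewrite hD -[LHS]mulr1 -EV; ring.
by rewrite ler_pM2l.
Qed.

Lemma const_ex (q : Q) : exists c : D1, forall n, v c n = q.
Proof.
have [c cq] := val_surj q; exists (ap (iPi M TN TN) c) => n.
by rewrite /v ap_Pi.
Qed.

Lemma const_real (c : D1) (q : Q) : (forall n, v c n = q) -> Real c.
Proof. by move=> cq n i; rewrite !cq subrr normr0 h_gt0. Qed.

Lemma bump_continuous w : Continuous01 (ap F w).
Proof.
move=> x [xR _] e [eR [n0 en0]].
(* After scaling by 2^K this distance becomes 2^-(n0+3), an eighth of the room 2^-n0 that [e] leaves
   at indices beyond n0. *)
set k := prec w; set d := h (n0 + k + 1 + 1 + 1).
have [c cd] := const_ex d; exists c; split.
  split; first exact: const_real cd.
  exists (n0 + k + 1 + 1 + 1 + 1 + 1); rewrite cd /d !hS.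
  by have := h_gt0 (n0 + k); lra.
move=> y [yR _] [m]; rewrite cd => xy.
(* An index beyond both that of the positivity of [e] and that of the closeness of x and y; the
   entries of x and y drift by at most 2 * 2^-(m+1) after m+1, which the term 2 * 2^-m in the
   closeness hypothesis covers. *)
set n := n0 + (1 + 1 + 1 + m); exists n.
have kE : n + 1 + k = m + 1 + (n0 + k + 1 + 1 + 1) by rewrite /n; ring.
have lt : toQ (exp2_ k) * `|v x (n + 1 + k) - v y (n + 1 + k)| < h (n0 + 1 + 1 + 1).
  have -> : h (n0 + 1 + 1 + 1) = toQ (exp2_ k) * d.
    by rewrite /d !hS hD -[h n0 in LHS]mulr1 -(hV k); ring.
  rewrite ltr_pM2l ?exp2_gt0 // kE.
  have := xR (m + 1) (n0 + k + 1 + 1 + 1); have := yR (m + 1) (n0 + k + 1 + 1 + 1).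
  set x1 := v x _ in xy *; set y1 := v y _ in xy *; set x2 := v x _; set y2 := v y _.
  have hm := h_gt0 m; move: xy; rewrite hS.
  have := ler_norm (x1 - y1); have := ler_norm (y1 - x1); rewrite (distrC y1).
  move=> l1 l2 l3; rewrite !ltr_norml => /andP[l4 l5] /andP[l6 l7].
  by apply/andP; split; lra.
have := bump_lip w x y (n + 1) (n + 1); rewrite -/k => l1.
have := eR n0 (1 + 1 + 1 + m); rewrite -/n ltr_norml => /andP[_ l2].
have l3 : h n <= h (n0 + 1 + 1 + 1) by rewrite /n !addrA; apply: hD_le.
by move: lt l3; rewrite !hS; have := h_gt0 n0; lra.
Qed.

(** With b the exponent of the ball, x is read within 2^-(b+2) + 2 * 2^-K of the centre, so the tent
    is at least 2^-(b+2) - 2 * 2^-K. As K is at least b + 4, this is at least 2^-K, and scaling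
    reaches the plateau. *)
Lemma bump_eq1 w x y l n : Real y -> Req x y -> toQ l < toQ (len w) ->
  val (pfst_ (ball w l)) = v y (psnd_ (ball w l) + 1 + 1) ->
  v (ap (ap F w) x) n = 1.
Proof.
move=> yR xy lt qE; rewrite FE min_l //; set k := prec w; set u := ap x _.
have [_ [/(_ l lt) + _]] := peakP w u; rewrite /tent qE.
set b := psnd_ _ in qE *; have := precP lt; rewrite -/b -/k => bk.
have [j kE] : exists j, k = b + 1 + 1 + 1 + 1 + j.
  by apply/(embedding_le (toQ_embedding M)); rewrite !toQE; lra.
have := xy (n + k); rewrite -/u -[v x _]/(val u).
have := yR (b + 1 + 1) (1 + 1 + j + n).
have -> : b + 1 + 1 + (1 + 1 + j + n) = n + k by rewrite kE; ring.
rewrite ltr_norml ler_norml => /andP[l1 l2] /andP[l3 l4] l5.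
have l6 : h (n + k) <= h k by rewrite addrC hD_le.
have l7 : h k <= h (b + 1 + 1) / 4.
  have := hD_le (b + 1 + 1 + 1 + 1) j; rewrite -kE !hS; lra.
have : `|val u - v y (b + 1 + 1)| <= 2 * h k + h (b + 1 + 1).
  by rewrite ler_norml; apply/andP; split; lra.
move=> l8; have l9 : h k <= peak w u.
  by move: l5 l7 l8; rewrite !hS; have := h_gt0 k; lra.
by rewrite -(hV k) ler_pM2l ?exp2_gt0.
Qed.

Lemma bump_gt w x n (b : Q) : 0 <= b -> b < v (ap (ap F w) x) n ->
  exists l, toQ l < toQ (len w) /\
    b * h (prec w) < tent (ball w l) (v x (n + prec w)).
Proof.
move=> b0; rewrite FE lt_min => /andP[_ lt].
have {}lt : b * h (prec w) < peak w (ap x (n + prec w)).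
  by rewrite -(ltr_pM2l (exp2_gt0 (prec w))) mulrCA hV mulr1.
apply: contrapT => no; have [_ [_ lub]] := peakP w (ap x (n + prec w)).
have h0 := h_gt0 (prec w).
suff : peak w (ap x (n + prec w)) <= b * h (prec w) by rewrite leNgt lt.
apply: lub => [|l ltl]; first by rewrite mulr_ge0 // ltW.
by rewrite leNgt; apply/negP => lt'; apply: no; exists l.
Qed.

End Bumps.

(** * The covering *)

Section Cover.
Local Open Scope ring_scope.

Definition ball_tm G (H : tm G (T1 ~> T1)) (nu : tm G T2) (E : tm G (T1 ~> TN ~> T1)) :
    tm G (T1 ~> TN ~> TN) :=
  (lam w : T1, lam l : TN, pair
     (#H @ (#E @ #w @ #l) @ (#nu @ (#E @ #w @ #l) + One + One)) (#nu @ (#E @ #w @ #l)))%fm.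
Definition points_tm G (H : tm G (T1 ~> T1)) (E : tm G (T1 ~> TN ~> T1))
    (s : tm G (TN ~> T1)) : tm G (TN ~> T1) :=
  (lam i : TN, #H @ (#E @ (#s @ pfst (predec #i)) @ psnd (predec #i)))%fm.
Definition lengths_tm G (s : tm G (TN ~> T1)) : tm G T1 := (lam j : TN, #s @ #j @ Zero)%fm.

Variable M : emodel.
Local Notation N := (num M).
Local Notation Q := (rational M).
Local Notation D1 := (dom M T1).
Variables (Psi H : dom M (T1 ~> T1)%ty).
Hypothesis Psi_pos : FunPos Psi.
Hypothesis H01 : forall y, In01 (ap H y).
Hypothesis Hreq : forall x, In01 x -> Req x (ap H x).

(** Positivity of a real is witnessed by one inequality between rational approximations, a
    quantifier-free condition, so QF-AC^{1,0} applies. *)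
Lemma radius_ex : exists nu : dom M T2, forall y : D1,
  2 * h (ap nu y) < v (ap Psi (ap H y)) (ap nu y).
Proof.
pose A : fm [:: TN; T1; (T1 ~> T1)%ty; (T1 ~> T1)%ty] :=
  qlt (qhalf1 (Var vz))
    (decode (Var (vs (vs vz)) @ (Var (vs (vs (vs vz))) @ Var (vs vz)) @ Var vz)%fm).
have AE (n : N) (y : D1) : sat (econs n (econs y (econs Psi (econs H (@enil _))))) A =
    (2 * h n < v (ap Psi (ap H y)) n).
  by rewrite /A sat_qlt; [|okrat..]; rewrite ratval_half1 ratval_decode.
have [|nu hnu] := @qf_choice M _ A (econs Psi (econs H (@enil _))) erefl.
  by move=> y; have [_ [n]] := proj1 Psi_pos _ (proj1 (H01 y)); exists n; rewrite AE.
by exists nu => y; rewrite -AE.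
Qed.

(** The error budget behind the radius 2^-(b+1) and the centre at index b+2. The surplus g pays for
    reading x at index m, so x is within 2^-(b+1) + 2^-(b+2) of y; the slack 2 * 2^-n of the strict
    order is at most 2^-(b+2). The total is 2^-b, which lies below the entries of Psi(y) beyond
    index b. *)
Lemma near_center (y x : D1) (b m : N) (g : Q) : Real y -> Real x -> Real (ap Psi y) ->
  2 * h b < v (ap Psi y) b -> h m <= g ->
  g < h (b + 1) - `|v x m - v y (b + 1 + 1)| ->
  (exists n, v y (n + 1) - v (ap Psi y) (n + 1) + 2 * h n < v x n) /\
  (exists n, v x n + 2 * h n < v y (n + 1) + v (ap Psi y) (n + 1)).
Proof.
move=> yR xR PR Pb mg gb; set n := m + (b + 1 + 1 + 1).
have := PR b (1 + 1 + 1 + m + 1).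
have -> : b + (1 + 1 + 1 + m + 1) = n + 1 by rewrite /n; ring.
have := yR (b + 1 + 1) (m + 1 + 1).
have -> : b + 1 + 1 + (m + 1 + 1) = n + 1 by rewrite /n; ring.
have := xR m (b + 1 + 1 + 1); rewrite -/n.
have := hD_le (b + 1 + 1 + 1) m; rewrite addrC -/n => hn.
rewrite !ltr_norml => /andP[l1 l2] /andP[l3 l4] /andP[l5 l6].
have l7 : `|v x m - v y (b + 1 + 1)| < h (b + 1) - g by lra.
move: l7; rewrite ltr_norml => /andP[l7 l8].
move: hn l3 l4 l7 l8; rewrite !hS => hn l3 l4 l7 l8; have hb := h_gt0 b.
by split; exists n; lra.
Qed.

Hypothesis arz : sat (@enil (dom M)) ARZ_net.

Lemma cover_ex : exists (k : N) (y : dom M (TN ~> T1)%ty),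
  (forall i, In01 (ap y i)) /\
  forall x, In01 x -> exists i : N, (1 <= toQ i /\ toQ i <= toQ k) /\
    (exists n, v (ap y i) (n + 1) - v (ap Psi (ap y i)) (n + 1) + 2 * h n < v x n) /\
    (exists n, v x n + 2 * h n < v (ap y i) (n + 1) + v (ap Psi (ap y i)) (n + 1)).
Proof.
have [nu nuP] := radius_ex.
pose B := ev (econs H (econs nu (econs (entry M) (@enil _))))
  (ball_tm (Var vz) (Var (vs vz)) (Var (vs (vs vz)))).
have BE w l : ap (ap B w) l = let y := ap (ap (entry M) w) l in
    pair_ (ap (ap H y) ((ap nu y : N) + 1 + 1)) (ap nu y).
  by rewrite /B /ball_tm; evsimp.
have [K precP] := precision_ex B.
have [P peakP] := peak_ex B.
have [F FE] := net_ex K P.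
have [R RP] := order_ex B.
have [one oneE] := const_ex (1 : Q).
pose D := ap (iPi M TN T1) (1 : N); have DE d : ap D d = 1 :> N by rewrite ap_Pi.
pose f := ap (iPi M T1 T1) one; have fE x : ap f x = one by rewrite ap_Pi.
have oneR := const_real oneE.
have h01 : h (0 + 1 + 1 : N) = 4^-1 by rewrite !hS h0; lra.
have onepos : Pos one by split=> //; exists (0 + 1 + 1); rewrite oneE h01; lra.
have dir : Directed D R.
  split; first by exists one.
  split; first by move=> a _; apply/(proj2 (RP _ _)) => l lt; exists l.
  split=> [a b c _ /(proj2 (RP _ _)) ab /(proj2 (RP _ _)) bc|a b _].
    apply/(proj2 (RP _ _)) => l /ab[j [/bc[i [lt <-]] <-]]; by exists i.
  have [c [lc [ca cb]]] := concat_ex a b.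
  exists c; split=> //; split; apply/(proj2 (RP _ _)) => l lt.
    exists l; rewrite !BE ca //; split=> //.
    by rewrite lc toQD; have := toQ_ge0 (len b); lra.
  by exists (len a + l); rewrite !BE cb lc !toQD; split=> //; lra.
have fun_f : Fun01 f.
  by split=> [x _|x y _ _ n]; rewrite !fE // subrr normr0; have := h_gt0 n; lra.
have cont_f : Continuous01 f.
  move=> x _ e [eR [n en]]; exists one; split=> // y _ _; exists n.
  by rewrite !fE subrr normr0 add0r.
have conv : Converges D R F f.
  move=> x x01 e [eR [n en]]; have [d0 [ld ed]] := singleton_ex x.
  (* The ball at position j of d has the code of the ball of x, although its own entry may be
     another point. The estimate is therefore made with the point attached to x, not with that
     entry. *)
  exists d0; split=> // d _ /(proj2 (RP _ _)) /(_ 0)[|j [lt jE]].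
    by rewrite ld toQ0 toQ1 ltr01.
  exists n; rewrite fE oneE (bump_eq1 precP peakP FE _ (proj1 (H01 x)) (Hreq x01) lt) //.
    by rewrite subrr normr0 add0r.
  by rewrite jE !BE ed; cbv zeta; rewrite pfst_pair psnd_pair.
have D01 d : toQ (ap D d : N) <= 1 by rewrite DE toQ1.
have contF d : ap D d = 1 :> N -> Fun01 (ap F d) /\ Continuous01 (ap F d).
  by move=> _; split; [exact: bump_fun01 peakP FE _|exact: bump_continuous peakP FE _].
have [k [s ks]] := arzela_net arz D01 (fun w u => proj1 (RP w u)) dir contF fun_f cont_f conv
  onepos (DE one).
have [S sumP] := iterated_sum M.
pose t := ev (econs s (@enil _)) (lengths_tm (Var vz)); have [_ SS] := sumP t.
(* The sum of the lengths of the indices 0, ..., k bounds each of these lengths. *)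
pose L : N := ap (ap S t) (k + 1).
have lenL (j : N) : toQ j <= toQ k -> toQ (len (ap s j)) <= toQ L.
  move=> le; have -> : len (ap s j) = ap t j by rewrite /t /lengths_tm; evsimp.
  by apply: (sum_ge SS); rewrite toQD toQ1; lra.
pose y := ev (econs H (econs (entry M) (econs s (@enil _))))
  (points_tm (Var vz) (Var (vs vz)) (Var (vs (vs vz)))).
have yE (j l : N) : ap y (pair_ j l + 1) = ap H (ap (ap (entry M) (ap s j)) l).
  by rewrite /y /points_tm; evsimp; rewrite predS pfst_pair psnd_pair.
(* The l-th point of the j-th index gets number [pair_ j l + 1], the shift making numbers start at
   1; monotonicity of the pairing gives the bound. Numbers of no such pair still denote points of
   [0,1]. *)
exists (pair_ k L + 1), y; split=> [i|x x01].
  by rewrite /y /points_tm; evsimp; exact: H01.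
have [j [jk [n]]] := ks x x01; rewrite fE !oneE => near.
set w := ap s j in near *.
have h0 := h_gt0 n.
have gt : 2 * h n < v (ap (ap F w) x) (n + 1).
  by have := ler_norm (1 - v (ap (ap F w) x) (n + 1)); rewrite distrC; lra.
(* Closeness to 1 within 1 leaves the bump above 2 * 2^-n, not merely positive; this surplus is what
   [near_center] consumes. *)
have [|l [lt tl]] := bump_gt peakP FE _ gt; first lra.
exists (pair_ j l + 1); rewrite yE -/w.
have lL := lenL j jk; rewrite -/w in lL.
split.
  have := toQ_ge0 (pair_ j l); rewrite /pair_ !toQE => p0; split; first lra.
  have j0 := toQ_ge0 j; have l0 := toQ_ge0 l.
  have : (toQ j + toQ l) * (toQ j + toQ l) <= (toQ k + toQ L) * (toQ k + toQ L).
    by apply: ler_pM; lra.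
  lra.
move: tl; rewrite /tent BE; cbv zeta; rewrite pfst_pair psnd_pair -/(v _ _) => tl.
have [y0R _] := H01 (ap (ap (entry M) w) l).
apply: (near_center y0R (proj1 x01) (proj1 (proj1 Psi_pos _ y0R)) (nuP _) _ tl).
(* The surplus 2 * 2^-n * 2^-K dominates the error 2^-(n+1+K) of reading x at index n + 1 + K. *)
rewrite [n + 1 + _]addrAC hS hD; have hK := h_gt0 (ap K w : N).
have := mulr_gt0 h0 hK; lra.
Qed.

End Cover.

Theorem theorem3p31 : proves (add_axiom RCA0w ARZ_net) HBU.
Proof.
apply: extensional_completeness => [q|M MT Mext]; first by left.
have MR : models M RCA0w by move=> q Rq; apply: MT; left.
pose E := EModel MR Mext; apply: (@heine_borel E) => Psi Psi_pos.
have [H [H01 Hreq]] := hat_ex E.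
by apply: (cover_ex Psi_pos H01 Hreq); apply: MT; right.
Qed.
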